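(* Let $\Bbbk$ be an algebraically closed field, let $n\ge 2$, and let $(f_m)_{m\ge 1}$ be an infinite sequence of pairwise distinct elements of $\mathrm{Bir}(\mathbb{P}^n)$. Then the set $\{f_m : m\ge 1\}$ is closed in $\mathrm{Bir}(\mathbb{P}^n)$ for the Zariski topology if and only if $\lim_{m\to\infty}\deg(f_m)=\infty$. In particular, the Zariski topology on $\mathrm{Bir}(\mathbb{P}^n)$ is not Noetherian.
   Context: For an irreducible variety $X$ over $\Bbbk$, $\mathrm{Bir}(X)$ is the group of birational maps $X\dashrightarrow X$. For a variety $T$, a pseudo-automorphism of $T\times X$ over $T$ is a birational map $\varphi:T\times X\dashrightarrow T\times X$ for which there is a dense open $U\subset T\times X$ such that: $\varphi$ is defined on $U$; $U_t:=U\cap(\{t\}\times X)$ is dense in $\{t\}\times X$ for all $t\in T$; and there is a morphism $f:U\to X$ with $\varphi|_U(t,x)=(t,f(t,x))$ and $\varphi|_{U_t}:U_t\to\{t\}\times X$ a birational morphism for every $t$. The induced map $T\to\mathrm{Bir}(X)$, $t\mapsto\varphi_t$ (also written $\varphi(t)$), is called a morphism from $T$ to $\mathrm{Bir}(X)$. Zariski topology on $\mathrm{Bir}(X)$: $\mathcal{F}\subset\mathrm{Bir}(X)$ is closed iff $\varphi^{-1}(\mathcal{F})$ is closed in $T$ for every variety $T$ and every morphism $\varphi:T\to\mathrm{Bir}(X)$ (it is equivalent to use only affine irreducible $T$). The degree $\deg(f)$ of $f\in\mathrm{Bir}(\mathbb{P}^n)$ is the common degree of homogeneous polynomials $f_0,\dots,f_n\in\Bbbk[x_0,\dots,x_n]$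 without nontrivial common factor such that $f=(f_0:\cdots:f_n)$.
   Formalization: The implication ''closed implies lim deg(f_m)=∞'' is stated only for uncountable 𝕜: for countable 𝕜, an enumeration of all of Bir(P^n) is closed but has infinitely many terms of degree 1. *)

(* Defs.v *)
From HB Require Import structures.
From mathcomp Require Import all_boot all_order all_algebra.
From mathcomp Require Import generic_quotient mpoly.
From mathcomp Require Import boolp classical_sets functions cardinality filter.
From mathcomp Require Import topology_structure nat_topology subspace_topology.

Set Implicit Arguments.
Unset Strict Implicit.
Unset Printing Implicit Defensive.

Import GRing.Theory.

Local Open Scope classical_set_scope.
Local Open Scope ring_scope.
Local Open Scope quotient_scope.

(* Varieties over an algebraically closed field K are handled in the classical
   language of spaces with functions: a topological space together with, for
   every open U, the set of K-valued functions that are regular on U.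

   Partially defined maps and functions are encoded by total ones that are only
   considered on a given set; the values outside that set are irrelevant. *)
Record fun_space (K : closedFieldType) := Space {
  pt :> topologicalType;
  reg : set pt -> set (pt -> K)
}.

Section Morphisms.
Variable K : closedFieldType.
Implicit Types S T : fun_space K.

(* For arbitrary A, B this is a morphism A -> B for the induced structures: the
   regular functions on a subset are locally restrictions of regular functions
   of the ambient space. *)
Definition morphism_on S T (A : set S) (B : set T) (f : S -> T) : Prop :=
  [/\ {homo f : x / A x >-> B x},
      {within A, continuous f}
    & forall (V : set T) (g : T -> K), open V -> reg V g ->
      forall x, A x -> V (f x) ->
      exists O h, [/\ open O, O x, reg O h &
                      forall y, A y -> O y -> h y = g (f y)]].

Definition iso_via S T (A : set S) (B : set T) (f : S -> T) : Prop :=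
  morphism_on A B f /\
  exists g, [/\ morphism_on B A g,
                forall x, A x -> g (f x) = x &
                forall y, B y -> f (g y) = y].

Definition isomorphic S T (A : set S) (B : set T) : Prop :=
  exists f, iso_via A B f.

Definition birational_on S T (U : set S) (f : S -> T) : Prop :=
  [/\ open U, dense U, morphism_on U setT f &
      exists (U' : set S) (V' : set T),
        [/\ open U', dense U', open V', dense V' &
            U' `<=` U /\ iso_via U' V' f]].

End Morphisms.

Section Affine.
Variables (K : closedFieldType) (N : nat).

Definition aff_pt : Type := 'rV[K]_N.
HB.instance Definition _ := Choice.on aff_pt.

Definition aff_zeros (P : set {mpoly K[N]}) : set aff_pt :=
  [set x : aff_pt | forall p, P p -> p.@[x 0] = 0].

Definition aff_op (U : set aff_pt) : Prop := exists P, ~` U = aff_zeros P.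

Fact aff_opT : aff_op setT.
Proof.
exists setT; rewrite setCT; apply/seteqP; split=> // x /= /(_ 1 I).
by rewrite meval1; apply/eqP; rewrite oner_neq0.
Qed.

Fact aff_opI : setI_closed aff_op.
Proof.
move=> U V [P UP] [Q VQ].
exists [set r | exists2 p, P p & exists2 q, Q q & r = p * q].
rewrite setCI UP VQ; apply/seteqP; split=> x /=.
  by case=> x0 _ [p Pp [q Qq ->]]; rewrite mevalM;
    [rewrite (x0 p Pp) mul0r|rewrite (x0 q Qq) mulr0].
move=> x0; have [|/existsNP[p /not_implyP[Pp px]]] := pselect (aff_zeros P x).
  by left.
right=> q Qq; have /eqP := x0 (p * q) (ex_intro2 _ _ p Pp (ex_intro2 _ _ q Qq erefl)).
by rewrite mevalM mulf_eq0 => /orP[/eqP//|/eqP].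
Qed.

Fact aff_op_bigU (I : Type) (U : I -> set aff_pt) :
  (forall i, aff_op (U i)) -> aff_op (\bigcup_i U i).
Proof.
move=> /choice[P UP]; exists (\bigcup_i P i).
rewrite setC_bigcup; apply/seteqP; split=> x /=.
  by move=> Ux p [i _ Pp]; have := Ux i Logic.I; rewrite UP; apply.
by move=> x0 i _; rewrite UP => p Pp; apply: x0; exists i.
Qed.

HB.instance Definition _ :=
  isOpenTopological.Build aff_pt aff_opT aff_opI aff_op_bigU.

Definition aff_reg (U : set aff_pt) : set (aff_pt -> K) :=
  [set f | forall x, U x -> exists p q : {mpoly K[N]}, q.@[x 0] != 0 /\
     forall y, U y -> q.@[y 0] != 0 -> f y = p.@[y 0] / q.@[y 0]].

Definition affine_space : fun_space K := Space aff_reg.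

End Affine.

Section Projective.
Variables (K : closedFieldType) (n : nat).

Definition proj_pt : Type := {L : {vspace 'rV[K]_n.+1} | \dim L == 1%N}.
HB.instance Definition _ := Choice.on proj_pt.

(* A nonzero vector of the line x. *)
Definition hcoord (x : proj_pt) : 'I_n.+1 -> K := vpick (val x) 0.

Definition proj_zeros (P : set {mpoly K[n.+1]}) : set proj_pt :=
  [set x | forall p, P p -> p.@[hcoord x] = 0].

Definition proj_op (U : set proj_pt) : Prop :=
  exists P : set {mpoly K[n.+1]},
    (forall p, P p -> exists d, p \is d.-homog) /\ ~` U = proj_zeros P.

Fact proj_opT : proj_op setT.
Proof.
exists [set 1]; split=> [_ ->|]; first by exists 0%N; apply: dhomog1.
rewrite setCT; apply/seteqP; split=> // x /= /(_ 1 erefl).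
by rewrite meval1; apply/eqP; rewrite oner_neq0.
Qed.

Fact proj_opI : setI_closed proj_op.
Proof.
move=> U V [P [hP UP]] [Q [hQ VQ]].
exists [set r | exists2 p, P p & exists2 q, Q q & r = p * q]; split.
  move=> _ [p /hP[d hp] [q /hQ[e hq] ->]].
  by exists (d + e)%N; apply: dhomogM.
rewrite setCI UP VQ; apply/seteqP; split=> x /=.
  by case=> x0 _ [p Pp [q Qq ->]]; rewrite mevalM;
    [rewrite (x0 p Pp) mul0r|rewrite (x0 q Qq) mulr0].
move=> x0; have [|/existsNP[p /not_implyP[Pp px]]] := pselect (proj_zeros P x).
  by left.
right=> q Qq; have /eqP := x0 (p * q) (ex_intro2 _ _ p Pp (ex_intro2 _ _ q Qq erefl)).
by rewrite mevalM mulf_eq0 => /orP[/eqP//|/eqP].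
Qed.

Fact proj_op_bigU (I : Type) (U : I -> set proj_pt) :
  (forall i, proj_op (U i)) -> proj_op (\bigcup_i U i).
Proof.
move=> /choice[P UP]; exists (\bigcup_i P i); split.
  by move=> p [i _ Pp]; apply: (UP i).1 Pp.
rewrite setC_bigcup; apply/seteqP; split=> x /=.
  by move=> Ux p [i _ Pp]; have := Ux i Logic.I; rewrite (UP i).2; apply.
by move=> x0 i _; rewrite (UP i).2 => p Pp; apply: x0; exists i.
Qed.

HB.instance Definition _ :=
  isOpenTopological.Build proj_pt proj_opT proj_opI proj_op_bigU.

Definition proj_reg (U : set proj_pt) : set (proj_pt -> K) :=
  [set f | forall x, U x -> exists (d : nat) (p q : {mpoly K[n.+1]}),
     [/\ p \is d.-homog, q \is d.-homog, q.@[hcoord x] != 0 &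
         forall y, U y -> q.@[hcoord y] != 0 ->
           f y = p.@[hcoord y] / q.@[hcoord y]]].

Definition projective_space : fun_space K := Space proj_reg.

End Projective.

Section Product.
Variables (K : closedFieldType) (S T : fun_space K).

(* An alias, because S * T canonically carries the product topology, which is
   not the topology of the product variety. *)
Definition prod_pt : Type := (S * T)%type.
HB.instance Definition _ := Choice.on prod_pt.

(* h is a sum of products f(s) g(t), with f regular on A and g regular on B. *)
Definition tensor_reg (A : set S) (B : set T) (h : prod_pt -> K) : Prop :=
  exists (m : nat) (f : 'I_m -> S -> K) (g : 'I_m -> T -> K),
    (forall i, reg A (f i) /\ reg B (g i)) /\
    h = fun p => \sum_(i < m) f i p.1 * g i p.2.

(* For varieties these sets are stable under finite intersections, so that
   they form a base of the topology that they generate. *)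
Definition prod_basic : set (set prod_pt) :=
  [set W | exists (A : set S) (B : set T) h,
     [/\ open A, open B, tensor_reg A B h &
         W = [set p | [/\ A p.1, B p.2 & h p != 0]]]].

HB.instance Definition _ :=
  isSubBaseTopological.Build prod_pt prod_basic (fun W : set prod_pt => W).

Definition prod_reg (U : set prod_pt) : set (prod_pt -> K) :=
  [set f | forall x, U x -> exists (A : set S) (B : set T) h k,
     [/\ [/\ open A, open B, A x.1 & B x.2],
         tensor_reg A B h, tensor_reg A B k, k x != 0 &
         forall y, U y -> A y.1 -> B y.2 -> k y != 0 -> f y = h y / k y]].

Definition prod_space : fun_space K := Space prod_reg.

End Product.

Section Variety.
Variable K : closedFieldType.

Definition sheaf_of_functions (T : fun_space K) : Prop :=
  forall (U : set T) (f : T -> K), open U ->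
    reg U f <->
    (forall x, U x -> exists V g,
       [/\ open V, V x, reg V g & forall y, U y -> V y -> f y = g y]).

Definition affine_open (T : fun_space K) (V : set T) : Prop :=
  open V /\
  exists (N : nat) (Z : set (affine_space K N)), closed Z /\ isomorphic V Z.

(* A not necessarily irreducible variety: T has a finite cover by affine opens
   and is separated. *)
Definition is_variety (T : fun_space K) : Prop :=
  [/\ sheaf_of_functions T,
      exists (m : nat) (V : 'I_m -> set T),
        (forall i, affine_open (V i)) /\ \bigcup_i V i = setT &
      closed [set p : prod_space T T | p.1 = p.2]].

End Variety.

Section Bir.
Variables (K : closedFieldType) (X : fun_space K).

Record birmap := BirMap {
  bdom : set X;
  bfun : X -> X;
  bfunP : birational_on bdom bfun
}.

HB.instance Definition _ := gen_eqMixin birmap.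
HB.instance Definition _ := gen_choiceMixin birmap.

Definition bir_eqv (f g : birmap) : bool :=
  `[< exists W : set X,
        [/\ open W, dense W, W `<=` bdom f `&` bdom g &
            forall x, W x -> bfun f x = bfun g x] >].

Fact bir_eqv_refl : reflexive bir_eqv.
Proof.
move=> f; apply/asboolP; have [oU dU _ _] := bfunP f.
by exists (bdom f); split=> // x.
Qed.

Fact bir_eqv_sym : ssrbool.symmetric bir_eqv.
Proof.
suff H f g : bir_eqv f g -> bir_eqv g f by move=> f g; apply/idP/idP; apply: H.
move=> /asboolP[W [oW dW sW eW]]; apply/asboolP; exists W; split=> //.
  by rewrite setIC.
by move=> x Wx; rewrite eW.
Qed.

Fact bir_eqv_trans : transitive bir_eqv.
Proof.
move=> g f h /asboolP[W [oW dW sW eW]] /asboolP[W' [oW' dW' sW' eW']].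
apply/asboolP; exists (W `&` W'); split.
- exact: openI.
- exact: denseI.
- by move=> x [/sW[? _] /sW'[_ ?]].
- by move=> x [Wx W'x]; rewrite eW ?eW'.
Qed.

Canonical bir_eqv_equiv :=
  EquivRel bir_eqv bir_eqv_refl bir_eqv_sym bir_eqv_trans.

Definition bir : Type := {eq_quot bir_eqv}.
HB.instance Definition _ := Choice.on bir.

Definition bir_class (f : birmap) : bir := \pi_({eq_quot bir_eqv}) f.

(* The birational map of T * X is (t, x) |-> (t, pa_fun (t, x)), on pa_dom. *)
Record pseudo_aut (T : fun_space K) := PseudoAut {
  pa_dom : set (prod_space T X);
  pa_fun : prod_space T X -> X;
  pa_bir : birational_on pa_dom
             ((fun p => (p.1, pa_fun p)) : prod_space T X -> prod_space T X);
  pa_mor : morphism_on pa_dom setT pa_fun;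
  pa_fib : forall t : T,
    birational_on [set x : X | pa_dom (t, x)] (fun x => pa_fun (t, x))
}.

(* The morphism from T to Bir(X) induced by phi. *)
Definition pa_map (T : fun_space K) (phi : pseudo_aut T) (t : T) : bir :=
  bir_class (BirMap (pa_fib phi t)).

Definition bir_op (F : set bir) : Prop :=
  forall (T : fun_space K), is_variety T ->
  forall phi : pseudo_aut T, open (pa_map phi @^-1` F).

Fact bir_opT : bir_op setT.
Proof. by move=> T _ phi; rewrite preimage_setT; apply: openT. Qed.

Fact bir_opI : setI_closed bir_op.
Proof.
by move=> F G oF oG T vT phi; rewrite preimage_setI;
  apply: openI; [apply: oF|apply: oG].
Qed.

Fact bir_op_bigU (I : Type) (F : I -> set bir) :
  (forall i, bir_op (F i)) -> bir_op (\bigcup_i F i).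
Proof.
move=> oF T vT phi; rewrite preimage_bigcup.
by apply: bigcup_open => i _; apply: oF.
Qed.

HB.instance Definition _ :=
  isOpenTopological.Build bir bir_opT bir_opI bir_op_bigU.

Lemma closed_birE (F : set bir) :
  closed F <-> forall T : fun_space K, is_variety T ->
               forall phi : pseudo_aut T, closed (pa_map phi @^-1` F).
Proof.
have oE (G : set bir) : open G = bir_op G by [].
rewrite -openC oE; split=> H T vT phi; have := H T vT phi.
  by rewrite preimage_setC openC.
by rewrite preimage_setC openC.
Qed.

End Bir.

Section Degree.
Variables (K : closedFieldType) (n : nat).

(* The equality of lines in the last clause also says that the p_i do not
   vanish simultaneously at x, since <[0]> is not a line. *)
Definition has_degree (f : bir (projective_space K n)) (d : nat) : Prop :=
  exists p : 'I_n.+1 -> {mpoly K[n.+1]},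
    [/\ forall i, p i \is d.-homog,
        forall q, (forall i, exists r, p i = r * q) ->
          exists2 c : K, c != 0 & q = c%:MP
      & exists2 g : birmap (projective_space K n), f = bir_class g &
          forall x : proj_pt K n, bdom g x ->
            val (bfun g x : proj_pt K n) =
              <[ \row_i (p i).@[hcoord x] ]>%VS].

(* Every f has exactly one degree; 0 is only a default value. *)
Definition deg (f : bir (projective_space K n)) : nat :=
  xget 0%N (has_degree f).

End Degree.

Definition noetherian (T : topologicalType) : Prop :=
  forall F : nat -> set T,
    (forall i, closed (F i)) -> (forall i, F i.+1 `<=` F i) ->
    exists m, forall i, (m <= i)%N -> F i = F m.

(* Main.v *)
From HB Require Import structures.
From mathcomp Require Import all_boot all_order all_algebra.
From mathcomp Require Import generic_quotient mpoly ring zify finmap.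
From mathcomp Require Import boolp classical_sets functions cardinality filter.
From mathcomp Require Import topology_structure nat_topology subspace_topology.
Require Import Defs.

(** Closedness may be tested locally on the parameter variety. Near a parameter
    [t0], a family of birational maps is given, around a point where it is
    defined, by homogeneous polynomials of a fixed degree whose coefficients are
    regular in [t]. So degrees are locally bounded, and differing from a given
    map is an open condition. If the degrees of the [f m] tend to infinity, only
    finitely many [f m] matter locally, and their range is closed.

    Conversely, let infinitely many [f m] have degree [d]. The degrees of their
    inverses are bounded: counting dimensions gives a relation
    [sum_b A_b(p) x_0^(k-b) x_i^b = 0] with [A_b] of bounded degree, and by unique
    factorization the reduced denominator of [x_i / x_0], seen as a function of
    [p], divides some [A_b]. Hence these maps, together with inverses, are points
    of a single closed subvariety of an affine space that carries a family of
    birational maps. Over an uncountable algebraically closed field, countably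
    many polynomial equations each of which holds at almost all terms of a
    sequence have a common solution: a countably generated algebra
    has countable dimension, so its residue fields are trivial extensions. Take
    the equations of the family, those of the closed preimage of the range and,
    for each [k], equations in additional variables stating that the map differs
    from [f k]: a solution is a map that is in the range but is no [f k].

    The maps [(x_0^(m+1) : x_1 x_0^m : ... : x_n x_0^m + x_1^(m+1))] have degree
    [m + 1], so the tails of this sequence form a strictly decreasing sequence of
    closed sets. *)

Set Implicit Arguments.
Unset Strict Implicit.
Unset Printing Implicit Defensive.

Import GRing.Theory.

Local Open Scope classical_set_scope.
Local Open Scope ring_scope.

(** * Unique factorization in polynomial rings *)

(** Uncountability of the field enters only the converse, and there it is essential: over a
    countable field the translations of one coordinate can be enumerated by a single sequence, whose
    degrees are all 1 and whose range is closed. A pseudo-automorphism must be birational on the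
    whole product, so an inverse that is regular in the parameter is required. Storing the
    coefficients of [p] together with those of an inverse [q] provides it and turns invertibility
    into polynomial equations; a degree bound for [q] that depends only on [n] and [d] makes
    finitely many unknowns enough. Conditions of nonvanishing become equations [sum u_i v_i = 1] in
    new unknowns [u_i], because only equations pass to a common solution. The product topology is
    generated by nonvanishing loci of sums of products, not by boxes alone. Morphisms between
    projective space, closed affine sets and their products are therefore all handled through one
    notion of graded form. *)

Section Factorial.
Variable R : idomainType.
Implicit Types a b c p u : R.

Definition divides a b := exists r, b = r * a.

Definition prime_elt p :=
  [/\ p != 0, ~ divides p 1 & forall a b, divides p (a * b) -> divides p a \/ divides p b].

(** The factors are prime rather than irreducible, so uniqueness up to units is built in. *)
Definition prime_product a :=
  exists u (s : seq R), [/\ divides u 1, forall p, p \in s -> prime_elt p & a = u * \prod_(p <- s) p].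

Definition factorial_ring := forall a, a != 0 -> prime_product a.

Lemma divides_mull a b c : divides a b -> divides a (c * b).
Proof. by case=> r ->; exists (c * r); rewrite mulrA. Qed.

Lemma divides_mulr a b c : divides a b -> divides a (b * c).
Proof. by rewrite mulrC; apply: divides_mull. Qed.

Lemma prime_product_unit u : divides u 1 -> prime_product u.
Proof. by move=> u1; exists u, [::]; split; rewrite ?big_nil ?mulr1. Qed.

Lemma prime_product_prime p : prime_elt p -> prime_product p.
Proof.
move=> pp; exists 1, [:: p]; split; rewrite ?big_seq1 ?mul1r //.
  by exists 1; rewrite mulr1.
by move=> q; rewrite inE => /eqP ->.
Qed.

Lemma prime_productM a b : prime_product a -> prime_product b -> prime_product (a * b).
Proof.
move=> [u [s [[u' u1] sp ->]]] [v [t [[v' v1] tp ->]]]; exists (u * v), (s ++ t); split.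
- by exists (u' * v'); rewrite mulrACA -u1 -v1 mulr1.
- by move=> p; rewrite mem_cat => /orP[/sp|/tp].
- by rewrite big_cat mulrACA.
Qed.

(* Gauss' lemma: a prime factor of [c] divides every [s * f i] but not every
   [f i], so that it can be cancelled. *)
Lemma coprime_divides (I : Type) (f : I -> R) c s :
  prime_product c -> c != 0 ->
  (forall p, prime_elt p -> divides p c -> exists i, ~ divides p (f i)) ->
  (forall i, divides c (s * f i)) -> divides c s.
Proof.
move=> [u [t [[u' u1] tp ->]]] nz; elim: t => [|p t IH] in s tp nz *.
  rewrite big_nil mulr1 => _ _; exists (s * u').
  by rewrite -mulrA -u1 mulr1.
rewrite big_cons => cop dv.
have pp : prime_elt p by apply: tp; rewrite inE eqxx.
have pc : divides p (u * (p * \prod_(j <- t) j)).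
  by apply/divides_mull/divides_mulr; exists 1; rewrite mul1r.
have [i ndi] := cop p pp pc.
have [p0 _ pM] := pp.
have [r sE] : divides p s.
  have [//|/ndi//] : divides p s \/ divides p (f i).
  apply: pM; have [r ->] := dv i; exact: divides_mull.
suff [r' rE] : divides (u * \prod_(j <- t) j) r by exists r'; rewrite sE rE; ring.
apply: IH.
- by move=> q qt; apply: tp; rewrite inE qt orbT.
- by apply: contraNneq nz => z; rewrite big_cons mulrCA z mulr0.
- move=> q qp qd; apply: cop qp _; rewrite mulrCA; exact: divides_mull.
- move=> j; have [w] := dv j; rewrite sE => e; exists w; apply: (mulfI p0).
  by rewrite mulrA [p * r]mulrC e; ring.
Qed.

End Factorial.

Lemma divides_trans (R : idomainType) (a b c : R) : divides a b -> divides b c -> divides a c.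
Proof. by case=> r -> [s ->]; exists (s * r); rewrite mulrA. Qed.

(** A prime [p] dividing a product of primes is associated to one of them, so removing [p] shortens
    the list. The strict decrease of the size is the measure of the inner induction in
    [factorial_ring_poly]. *)
Lemma prime_product_cancel (R : idomainType) (p b u : R) (s : seq R) :
  prime_elt p -> divides u 1 -> (forall q, q \in s -> prime_elt q) ->
  u * \prod_(q <- s) q = p * b ->
  exists v t, [/\ divides v 1, forall q, q \in t -> prime_elt q,
                  b = v * \prod_(q <- t) q & (size t < size s)%N].
Proof.
move=> pp; have [p0 pN1 pM] := pp; elim: s u b => [|q s IH] u b uU sp.
  rewrite big_nil mulr1 => ub; case: pN1; apply: divides_trans uU.
  by exists b; rewrite ub mulrC.
rewrite big_cons => e.
have [q0 qN1 qM] : prime_elt q by apply: sp; rewrite inE eqxx.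
have sp' r : r \in s -> prime_elt r by move=> rs; apply: sp; rewrite inE rs orbT.
have [[w qw]|[b' eb']] : divides p q \/ divides p (u * \prod_(j <- s) j).
- by apply: pM; exists b; rewrite mulrCA e mulrC.
- have [[r pE]|[r wE]] : divides q p \/ divides q w.
  + by apply: qM; exists 1; rewrite mul1r qw mulrC.
  + exists (u * w), s; split=> //.
    * have [u' u1] := uU; exists (u' * r); have wr : w * r = 1.
        by apply: (mulfI q0); rewrite mulr1 {2}qw pE; ring.
      by rewrite mulrACA -u1 mul1r mulrC.
    * by apply: (mulfI p0); rewrite -e qw; ring.
  + case: pN1; exists r; apply: (mulfI q0); rewrite mulr1 {1}qw wE; ring.
have [v [t [vU tp bE st]]] := IH _ b' uU sp' (etrans eb' (mulrC _ _)).
exists v, (q :: t); split=> //.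
- move=> r; rewrite inE => /orP[/eqP ->|/tp //]; exact: sp (mem_head _ _).
- apply: (mulfI p0); rewrite -e big_cons mulrCA eb' bE; ring.
Qed.

Section PolyFactorial.
Import Pdiv.CommonIdomain Pdiv.Idomain.
Variable R : idomainType.
Hypothesis factR : factorial_ring R.
Implicit Types (p c u : R) (f g h : {poly R}).

Lemma divides_polyCP p f : divides p%:P f <-> forall i, divides p f`_i.
Proof.
split=> [[g ->] i|/choice[g gE]]; first by exists g`_i; rewrite coefMC.
exists (\poly_(i < size f) g i); apply/polyP => i; rewrite coefMC coef_poly.
by case: ltnP => [_|si]; [exact: gE|rewrite mul0r nth_default].
Qed.

Lemma divides_polyC p c : divides p%:P c%:P <-> divides p c.
Proof.
split=> [/divides_polyCP/(_ 0)|]; first by rewrite coefC.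
by case=> r ->; exists r%:P; rewrite polyCM.
Qed.

(** If [i] and [j] are the least indices at which [f] and [g] have a coefficient not divisible by
    [p], every other summand of the coefficient [i + j] of [f * g] is divisible by [p]; so [p] would
    divide the product of those two coefficients. *)
Lemma prime_elt_polyC p : prime_elt p -> prime_elt p%:P.
Proof.
move=> [p0 pN1 pM]; split; first by rewrite polyC_eq0.
  by rewrite -polyC1 => /divides_polyC.
move=> f g dfg; apply: contrapT => /not_orP[].
move=> nf ng.
have exf' : exists i, `[< ~ divides p f`_i >].
  by have /existsNP[i ni] := contra_not (divides_polyCP p f).2 nf; exists i; apply/asboolP.
have exg' : exists i, `[< ~ divides p g`_i >].
  by have /existsNP[i ni] := contra_not (divides_polyCP p g).2 ng; exists i; apply/asboolP.
case: (ex_minnP exf') => i /asboolP fi mi; case: (ex_minnP exg') => j /asboolP gj mj.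
have /divides_polyCP/(_ (i + j)%N) := dfg.
rewrite coefM.
have ij : (i < (i + j).+1)%N by rewrite ltnS leq_addr.
rewrite (bigD1 (Ordinal ij)) //= addKn => ds.
suff : divides p (f`_i * g`_j) by case/pM.
set S := (X in _ + X) in ds.
have [s SE] : divides p S.
  rewrite /S; elim/big_rec: _ => [|k x ki [y ->]]; first by exists 0; rewrite mul0r.
  have [ltki|leik] := ltnP k i.
    have [z ->] : divides p f`_k.
      by apply: contrapT => /asboolP /mi; rewrite leqNgt ltki.
    by exists (z * g`_(i + j - k) + y); ring.
  have ltik : (i < k)%N.
    by rewrite ltn_neqAle leik andbT eq_sym.
  have [z ->] : divides p g`_(i + j - k).
    apply: contrapT => /asboolP /mj; rewrite leq_subRL; last by rewrite -ltnS.
    by rewrite leq_add2r leqNgt ltik.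
  by exists (f`_k * z + y); ring.
have [r rE] := ds; exists (r - s).
by rewrite mulrBl -rE SE addrK.
Qed.

Lemma prime_product_polyC c : prime_product c -> prime_product c%:P.
Proof.
move=> [u [s [[v vu] sp ->]]]; exists u%:P, (map polyC s); split.
- by exists v%:P; rewrite -polyCM -vu.
- by move=> _ /mapP[q /sp /prime_elt_polyC qp ->].
- by rewrite polyCM rmorph_prod big_map.
Qed.

(** Each prime factor of [c] is still prime as a constant polynomial, so it divides [g] or [h] and
    is cancelled there without changing the degree. *)
Lemma clear_constant c f g h : c != 0 -> f != 0 -> c *: f = g * h ->
  exists g' h', [/\ f = g' * h', size g' = size g & size h' = size h].
Proof.
move=> c0; have [u [s [[v vu] sp cE]]] := factR c0.
move: c0; rewrite {}cE; elim: s sp f g h => [|p s IH] sp f g h.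
  rewrite big_nil mulr1 => u0 f0 e; exists (v *: g), h; split=> //.
    by rewrite -scalerAl -e scalerA -vu scale1r.
  by rewrite size_scale //; apply: contraNneq (oner_neq0 R) => v0; rewrite vu v0 mul0r.
rewrite big_cons => nz f0 e.
have pp : prime_elt p by apply: sp; rewrite inE eqxx.
have [p0 _ _] := pp.
have pP0 : p%:P != 0 :> {poly R} by rewrite polyC_eq0.
have nz' : u * \prod_(j <- s) j != 0 by apply: contraNneq nz => z; rewrite mulrCA z mulr0.
have sp' q : q \in s -> prime_elt q by move=> qs; apply: sp; rewrite inE qs orbT.
have [_ _ /(_ g h)] := prime_elt_polyC pp; case.
- exists ((u * \prod_(j <- s) j) *: f); rewrite -e -!mul_polyC mulrAC -polyCM.
  by congr (_%:P * _); ring.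
- move=> [g1 gE]; have [|g' [h' [-> sg <-]]] := IH sp' f g1 h nz' f0.
    apply: (mulfI pP0); rewrite mulrA [_ * g1]mulrC -gE -e -!mul_polyC [LHS]mulrA -polyCM.
    by congr (_%:P * _); ring.
  by exists g', h'; split=> //; rewrite sg gE mulrC mul_polyC size_scale.
- move=> [h1 hE]; have [|g' [h' [-> <- sh]]] := IH sp' f g h1 nz' f0.
    apply: (mulfI pP0); rewrite mulrCA [_ * h1]mulrC -hE -e -!mul_polyC [LHS]mulrA -polyCM.
    by congr (_%:P * _); ring.
  by exists g', h'; split=> //; rewrite sh hE mulrC mul_polyC size_scale.
Qed.

Lemma dvdp_scale f g : g %| f -> exists c (q : {poly R}), c != 0 /\ c *: f = q * g.
Proof. by move=> /dvdpP[[c q] /= c0 cfE]; exists c, q. Qed.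

(** Induction on the degree, then on the number of primes in the leading coefficient. Extracting a
    constant prime shortens the leading coefficient, a proper factorization lowers the degree; when
    neither exists, [f] itself is prime. *)
Lemma factorial_ring_poly : factorial_ring {poly R}.
Proof.
move=> f; have [n] := ubnP (size f); elim: n f => // n IHn f /ltnSE sfn f0.
have l0 : lead_coef f != 0 by rewrite lead_coef_eq0.
have [u [s [uU sp lE]]] := factR l0.
have [k] := ubnP (size s); elim: k => // k IHk in f f0 sfn {l0} u s uU sp lE * => /ltnSE ssk.
have [sf1|sf1] := leqP (size f) 1.
  have fE := size1_polyC sf1; rewrite fE; apply: prime_product_polyC; apply: factR.
  by rewrite -polyC_eq0 -fE.
have [[p [pp [g fE]]]|nprim] := pselect (exists p, prime_elt p /\ divides p%:P f).
  have [p0 _ _] := pp; have g0 : g != 0 by apply: contraNneq f0 => g0; rewrite fE g0 mul0r.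
  have fpg : f = p *: g by rewrite fE mulrC mul_polyC.
  have lpg : u * \prod_(q <- s) q = p * lead_coef g by rewrite -lE fpg lead_coefZ.
  have [v [t [vU tp gE st]]] := prime_product_cancel pp uU sp lpg.
  rewrite fE; apply: prime_productM; last exact/prime_product_prime/prime_elt_polyC.
  apply: (IHk g g0 _ v t) => //; last exact: leq_trans st ssk.
  by rewrite -(size_scale g p0) -fpg.
have [[g [h [fE sg sh]]]|irr] := pselect (exists g h, [/\ f = g * h, (1 < size g)%N & (1 < size h)%N]).
  have [g0 h0] : g != 0 /\ h != 0.
    by split; rewrite -size_poly_gt0 ltnW.
  have sgh : size f = (size g + size h).-1 by rewrite fE size_mul.
  rewrite fE; apply: prime_productM; apply: IHn => //; apply: leq_trans sfn.
    by rewrite sgh -(prednK (ltnW sh)) addnS /= -addn1 leq_add2l -ltnS prednK // ltnW.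
  by rewrite sgh -(prednK (ltnW sg)) addSn /= -addn1 addnC leq_add2r -ltnS prednK // ltnW.
apply: prime_product_prime; split=> //.
  case=> r rE; have := congr1 (fun p : {poly R} => size p) rE.
  have r0 : r != 0 by apply: contra_eq_neq rE => ->; rewrite mul0r oner_neq0.
  rewrite size_poly1 size_mul // -(prednK (ltnW sf1)) addnS /= => /eqP.
  have : (0 < size r)%N by rewrite size_poly_gt0.
  case: (size r) => // m _; rewrite addSn eqSS eq_sym addn_eq0 => /andP[_].
  by case: (size f) sf1 => [|[]].
(* Here [%|] is divisibility up to a nonzero constant, that is, over the fraction field. A proper
   factorization there would give one over [R] by [clear_constant]. *)
have irrf : irreducible_poly f.
  split=> // g sg1 /dvdp_scale[c [q [c0 cfE]]].
  have cf0 : c *: f != 0 by rewrite -mul_polyC mulf_neq0 // polyC_eq0.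
  have g0 : g != 0 by apply: contraNneq cf0 => z; rewrite cfE z mulr0.
  have q0 : q != 0 by apply: contraNneq cf0 => z; rewrite cfE z mul0r.
  have [sq|sq] := leqP (size q) 1.
    have qE := size1_polyC sq; apply/eqpP; exists (q`_0, c) => /=.
      by rewrite c0 andbT -polyC_eq0 -qE.
    by rewrite cfE {2}qE mul_polyC.
  case: irr; have [q' [g' [fE sq' sg']]] := clear_constant c0 f0 cfE.
  exists q', g'; split=> //; first by rewrite sq'.
  by rewrite sg' ltn_neqAle eq_sym sg1 size_poly_gt0.
(* Having no constant prime factor, [f] divides over [R] whatever it divides over the fraction
   field; primality then comes from Euclid's lemma for [%|]. *)
suff dvdpf g : f %| g -> divides f g.
  move=> a b [r abE]; have dab : f %| a * b by apply/dvdpP; exists (1, r); rewrite ?oner_neq0 ?scale1r.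
  have [cop|ncop] := boolP (coprimep f a).
    by right; apply: dvdpf; rewrite -(Gauss_dvdpr _ cop).
  left; apply: dvdpf; have /eqp_dvdl <- : gcdp f a %= f.
    by apply: irrf.2; [|exact: dvdp_gcdl].
  exact: dvdp_gcdr.
move=> /dvdp_scale[c [q [c0 cg]]].
have cP0 : c%:P != 0 :> {poly R} by rewrite polyC_eq0.
have [r qE] : divides c%:P q.
  apply: (coprime_divides (f := fun _ : unit => f)) => //.
  - exact/prime_product_polyC/factR.
  - move=> P PP dP; exists tt => df.
    have [P0 PN1 PM] := PP; have [Q cE] := dP.
    have Q0 : Q != 0 by apply: contraNneq cP0 => z; rewrite cE z mul0r.
    have sP : (size P <= 1)%N.
      have := congr1 (fun p : {poly R} => size p) cE; rewrite size_polyC c0 size_mul //.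
      have : (0 < size Q)%N by rewrite size_poly_gt0.
      by case: (size Q) => // m _; rewrite addSn /= => ->; rewrite leq_addl.
    have PE := size1_polyC sP; case: nprim; exists P`_0; split; last by rewrite -PE.
    split; first by rewrite -polyC_eq0 -PE.
      by move=> /divides_polyC; rewrite -PE polyC1.
    by move=> a b /divides_polyC; rewrite -PE polyCM => /PM; rewrite PE !divides_polyC -PE.
  - by move=> _; exists g; rewrite -cg -mul_polyC mulrC.
by exists r; apply: (mulfI cP0); rewrite mul_polyC cg qE; ring.
Qed.
End PolyFactorial.

Lemma factorial_ring_iso (R S : idomainType) (f : {rmorphism R -> S}) (g : {rmorphism S -> R}) :
  cancel f g -> cancel g f -> factorial_ring S -> factorial_ring R.
Proof.
move=> fK gK factS a a0; have fa0 : f a != 0.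
  by apply: contraNneq a0 => fa0; rewrite -[a]fK fa0 rmorph0.
have divg x y : divides x y -> divides (g x) (g y).
  by case=> r ->; exists (g r); rewrite rmorphM.
have divf x y : divides x y -> divides (f x) (f y).
  by case=> r ->; exists (f r); rewrite rmorphM.
have [u [s [uU sp fE]]] := factS _ fa0; exists (g u), (map g s); split.
- by rewrite -(rmorph1 g); apply: divg.
- move=> _ /mapP[p /sp[p0 pN1 pM] ->]; split.
  + by apply: contraNneq p0 => gp0; rewrite -[p]gK gp0 rmorph0.
  + by move=> /divf; rewrite gK rmorph1.
  + move=> x y /divf; rewrite gK rmorphM => /pM[] /divg; rewrite fK; by [left|right].
- by rewrite -[a]fK fE rmorphM rmorph_prod big_map.
Qed.

Lemma factorial_ring_field (F : fieldType) : factorial_ring F.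
Proof. by move=> a a0; apply: prime_product_unit; exists a^-1; rewrite mulVf. Qed.

Lemma mpoly_hom_ext n (R S : nzRingType) (f g : {rmorphism {mpoly R[n]} -> S}) :
  (forall c, f c%:MP = g c%:MP) -> (forall i, f 'X_i = g 'X_i) -> f =1 g.
Proof.
move=> fgC fgX p; rewrite [p]mpolyE !rmorph_sum /=; apply: eq_bigr => m _.
rewrite -mul_mpolyC !rmorphM /= fgC; congr (_ * _).
rewrite mpolyXE_id !rmorph_prod; apply: eq_bigr => i _; by rewrite !rmorphXn /= fgX.
Qed.

Section MPolyPoly.
Variables (n : nat) (K : idomainType).
Local Notation widen := (widen_ord (leqnSn _)).

(** Inverse of [muni]: the polynomial variable is read as the last variable. *)
Definition poly_mpoly (q : {poly {mpoly K[n]}}) : {mpoly K[n.+1]} :=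
  (map_poly (@mwiden n K) q).['X_ord_max].

Fact poly_mpoly_comm : commr_rmorph (@mwiden n K) ('X_ord_max : {mpoly K[n.+1]}).
Proof. by move=> x; rewrite /GRing.comm mulrC. Qed.

HB.instance Definition _ := GRing.RMorphism.copy poly_mpoly (horner_morph poly_mpoly_comm).

Lemma muniXwiden (i : 'I_n) : muni ('X_(widen i) : {mpoly K[n.+1]}) = ('X_i)%:P.
Proof.
rewrite muniE msuppX big_seq1 mcoeffX eqxx scale1r.
have -> : [multinom U_(widen i)%MM (widen i0) | i0 < n] = U_(i)%MM.
  by apply/mnmP => j; rewrite mnmE !mnm1E -val_eqE.
rewrite mnm1E -val_eqE /= ltn_eqF //= alg_polyC //.
Qed.

Lemma muniXmax : muni ('X_ord_max : {mpoly K[n.+1]}) = 'X.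
Proof.
rewrite muniE msuppX big_seq1 mcoeffX eqxx scale1r.
have -> : [multinom U_(ord_max)%MM (widen i0) | i0 < n] = 0%MM.
  by apply/mnmP => j; rewrite mnmE mnm1E mnm0E -val_eqE /= gtn_eqF.
by rewrite mpolyX0 scale1r mnm1E eqxx expr1.
Qed.

Lemma ord_maxVwiden (i : 'I_n.+1) : i = ord_max \/ exists j : 'I_n, i = widen j.
Proof.
have [->|ni] := eqVneq i ord_max; first by left.
have lt : (i < n)%N by rewrite ltn_neqAle -ltnS ltn_ord andbT; exact: ni.
by right; exists (Ordinal lt); apply: val_inj.
Qed.

Lemma muniK : cancel (@muni n K) poly_mpoly.
Proof.
apply: (@mpoly_hom_ext _ _ _ (poly_mpoly \o @muni n K) idfun) => [c|i] /=.
  by rewrite muniC /poly_mpoly map_polyC hornerC /= mwidenC.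
have [->|[j ->]] := ord_maxVwiden i.
  by rewrite muniXmax /poly_mpoly map_polyX hornerX.
by rewrite muniXwiden /poly_mpoly map_polyC hornerC /= mwidenX mnmwiden1.
Qed.

Lemma poly_mpolyK : cancel poly_mpoly (@muni n K).
Proof.
have wE c : muni (mwiden c) = c%:P :> {poly {mpoly K[n]}}.
  move: c; apply: (@mpoly_hom_ext _ _ _ (@muni n K \o @mwiden n K) polyC) => [c|i] /=.
    by rewrite mwidenC muniC.
  by rewrite mwidenX mnmwiden1 muniXwiden.
elim/poly_ind => [|q c IH]; first by rewrite rmorph0 muni0.
have -> : poly_mpoly (q * 'X + c%:P) = poly_mpoly q * 'X_ord_max + mwiden c.
  by rewrite rmorphD rmorphM /= /poly_mpoly map_polyX hornerX map_polyC hornerC.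
by rewrite muniD muniM IH muniXmax wE.
Qed.

End MPolyPoly.

Lemma factorial_ring_mpoly (n : nat) (F : fieldType) : factorial_ring {mpoly F[n]}.
Proof.
elim: n => [|n IH].
  apply: (@factorial_ring_iso _ _ (@mcoeff 0 F 0%MM) (@mpolyC 0 F)); last exact: factorial_ring_field.
    exact: mpolyKC.
  by move=> c; rewrite /= mcoeffC eqxx mulr1.
apply: (@factorial_ring_iso _ _ (@muni n F) (@poly_mpoly n F)).
- exact: muniK.
- exact: poly_mpolyK.
- exact: factorial_ring_poly.
Qed.

(** As a polynomial in its last variable, [p] has a leading coefficient that is nonzero at some [v]
    by induction; what remains is a nonzero polynomial in one variable, which has a nonroot since
    the field is infinite. *)
Lemma mpoly_nonroot (n : nat) (K : closedFieldType) (p : {mpoly K[n]}) :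
  p != 0 -> exists v, p.@[v] != 0.
Proof.
elim: n p => [|n IH] p p0.
  exists (fun=> 0); apply: contraNneq p0 => pv.
  have pE : p = (p@_0%MM)%:MP by rewrite [LHS](esym (mpolyKC p)).
  by move: pv; rewrite pE mevalC => ->; rewrite mpolyC0.
have q0 : muni p != 0 by apply: contraNneq p0 => z; rewrite -[p]muniK z rmorph0.
have [v lv] := IH _ (etrans (congr1 negb (lead_coef_eq0 (muni p))) q0).
have r0 : map_poly (meval v) (muni p) != 0.
  by apply: contraNneq lv => z; rewrite /lead_coef -coef_map z coef0.
have [a na] := closed_nonrootP _ r0.
pose w (i : 'I_n.+1) := if insub (val i) is Some j then v j else a.
exists w; suff -> : p.@[w] = (map_poly (meval v) (muni p)).[a] by exact: na.
have com : commr_rmorph (meval v) a by move=> x; rewrite /GRing.comm mulrC.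
apply: (@mpoly_hom_ext _ _ _ (meval w) (horner_morph com \o @muni n K)) => [c|i] /=.
  by rewrite mevalC muniC /horner_morph map_polyC hornerC /= mevalC.
rewrite mevalXU /horner_morph; have [->|[j ->]] := ord_maxVwiden i.
  by rewrite muniXmax map_polyX hornerX /w insubF //= ltnn.
rewrite muniXwiden map_polyC hornerC /= mevalXU /w; case: insubP => [k _ kj|]; last by rewrite /= ltn_ord.
by congr v; apply: val_inj.
Qed.

(** * Homogeneous polynomials *)

(** Once the powers of [X] are split off, both cofactors are nonzero at 0. Comparing orders at 0
    shows that their product is the constant [c], so each of them is constant. *)
Lemma monomial_factor (R : idomainType) (p q : {poly R}) (c : R) d :
  c != 0 -> p * q = c%:P * 'X^d -> exists a k, p = a%:P * 'X^k.
Proof.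
move=> c0 pqE; have pq0 : p * q != 0.
  by rewrite pqE mulf_neq0 ?polyC_eq0 // -size_poly_gt0 size_polyXn.
have [p0 q0] : p != 0 /\ q != 0 by apply/andP; rewrite -negb_or -mulf_eq0.
have [a [p' rp pE]] := multiplicity_XsubC p 0.
have [b [q' rq qE]] := multiplicity_XsubC q 0.
rewrite p0 /= subr0 in rp pE; rewrite q0 /= subr0 in rq qE.
have X0 : 'X != 0 :> {poly R} by rewrite polyX_eq0.
have pq'0 : (p' * q').[0] != 0 by rewrite hornerM mulf_neq0.
have eX : (p' * q') * 'X^(a + b) = c%:P * 'X^d by rewrite -pqE pE qE exprD; ring.
have dab : d = (a + b)%N.
  have [lt|lt|//] := ltngtP d (a + b).
    have e : (p' * q') * 'X^(a + b - d) = c%:P.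
      have h : 'X^(a + b) = 'X^(a + b - d) * 'X^d :> {poly R} by rewrite -exprD subnK // ltnW.
      by apply: (mulIf (expf_neq0 d X0)); rewrite -eX h [RHS]mulrA.
    move: (congr1 (horner^~ 0) e); rewrite hornerM hornerXn hornerC expr0n.
    by rewrite subn_eq0 leqNgt lt mulr0 => /esym/eqP; rewrite (negPf c0).
  have e : p' * q' = c%:P * 'X^(d - (a + b)).
    have h : 'X^d = 'X^(d - (a + b)) * 'X^(a + b) :> {poly R} by rewrite -exprD subnK // ltnW.
    by apply: (mulIf (expf_neq0 (a + b) X0)); rewrite eX h [LHS]mulrA.
  by move: pq'0; rewrite e hornerM hornerXn expr0n subn_eq0 leqNgt lt mulr0 eqxx.
have e : p' * q' = c%:P by apply: (mulIf (expf_neq0 (a + b) X0)); rewrite eX dab.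
have [p'0 q'0] : p' != 0 /\ q' != 0.
  by apply/andP; rewrite -negb_or -mulf_eq0 e polyC_eq0.
exists p'`_0, a; rewrite pE -size1_polyC //.
have := size_mul p'0 q'0; rewrite e size_polyC c0.
have : (0 < size q')%N by rewrite size_poly_gt0.
by case: (size q') => // m _; rewrite addnS /= => ->; rewrite leq_addr.
Qed.

Section Homogeneous.
Variables (n : nat) (K : idomainType).
Implicit Types (p q : {mpoly K[n]}).

Lemma meval_dhomog d p c v : p \is d.-homog ->
  p.@[fun i => c * v i] = c ^+ d * p.@[v].
Proof.
move=> /dhomogP hp; rewrite !mevalE mulr_sumr; apply: eq_big_seq => m mp.
have dE : d = (\sum_i m i)%N by rewrite -mdegE -(hp m mp).
rewrite mulrCA; congr (_ * _); rewrite dE -prodrXr.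
by rewrite -big_split; apply: eq_bigr => i _; rewrite exprMn.
Qed.

(** The substitution of [T x_i] for [x_i], with [T] a new variable. The coefficient of [T^k] is the
    homogeneous component of degree [k], so homogeneous polynomials become monomials in [T]. *)
Definition scale_vars (p : {mpoly K[n]}) : {poly {mpoly K[n]}} :=
  mmap (polyC \o @mpolyC n K) (fun i => ('X_i)%:P * 'X) p.

HB.instance Definition _ := GRing.RMorphism.copy scale_vars
  (mmap (polyC \o @mpolyC n K) (fun i => ('X_i)%:P * 'X : {poly {mpoly K[n]}})).

Lemma scale_varsX m : scale_vars 'X_[m] = 'X_[m]%:P * 'X^(mdeg m).
Proof.
rewrite /scale_vars mmapX /mmap1 mdegE -prodrXr.
rewrite [in RHS]mpolyXE_id rmorph_prod -big_split; apply: eq_bigr => i _.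
by rewrite exprMn rmorphXn.
Qed.

Lemma scale_vars_homog d p : p \is d.-homog -> scale_vars p = p%:P * 'X^d.
Proof.
move=> /dhomogP hp; have -> : p%:P = \sum_(m <- msupp p) (p@_m *: 'X_[m])%:P by rewrite -rmorph_sum -mpolyE.
rewrite mulr_suml [p in LHS]mpolyE rmorph_sum /=.
apply: eq_big_seq => m mp; rewrite -mul_mpolyC rmorphM /= polyCM scale_varsX.
by rewrite /scale_vars mmapC /= mulrA (hp m mp).
Qed.

Lemma coef_scale_vars k p : (scale_vars p)`_k = pihomog mdeg k p.
Proof.
rewrite pihomogE [p in LHS]mpolyE rmorph_sum coef_sum [RHS]big_mkcond.
apply: eq_bigr => m _; rewrite -mul_mpolyC rmorphM /= {1}/scale_vars mmapC /=.
rewrite scale_varsX mulrA -polyCM coefMXn coefC; case: ltngtP => [|lt|->].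
- by [].
- by rewrite subn_eq0 leqNgt lt.
- by rewrite subnn eqxx.
Qed.

(** A factor of a monomial in [T] is again a monomial in [T]; hence [p] has a single homogeneous
    component. *)
Lemma homog_factor d p q : p * q != 0 -> p * q \is d.-homog ->
  exists e, p \is e.-homog.
Proof.
move=> pq0 hpq; have := scale_vars_homog hpq; rewrite rmorphM /= => e.
have [a [k pE]] := monomial_factor pq0 e; exists k.
have [k0 kp] := ubnP (mmeasure mdeg p).
rewrite (pihomog_partitionE (ltnW kp)) rpred_sum // => i _.
rewrite -coef_scale_vars pE coefCM coefXn; case: eqP => [ik|_]; last by rewrite mulr0 rpred0.
have -> : a * (true : nat)%:R = pihomog mdeg i p.
  by rewrite -coef_scale_vars pE coefCM coefXn ik eqxx.
by rewrite -ik; apply: pihomogP.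
Qed.

Lemma homog_factors d p q : p * q != 0 -> p * q \is d.-homog ->
  exists k l, [/\ (k + l = d)%N, p \is k.-homog & q \is l.-homog].
Proof.
move=> pq0 hpq; have [k hp] := homog_factor pq0 hpq.
have [l hq] : exists l, q \is l.-homog by apply: (@homog_factor d q p); rewrite mulrC.
by exists k, l; split=> //; apply: dhomog_uniq pq0 _ hpq; apply: dhomogM.
Qed.

Lemma homog0_const p : p \is 0.-homog -> exists c, p = c%:MP.
Proof.
move=> hp; exists p@_0; apply/mpolyP => m; rewrite mcoeffC.
have [->|m0] := eqVneq m 0%MM; first by rewrite mulr1.
rewrite mulr0; apply: (dhomog_nemf_coeff hp).
by rewrite mdeg_eq0.
Qed.
End Homogeneous.

(** * Families of polynomials without common factor *)

Section CoprimeFamily.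
Variables (n : nat) (K : fieldType) (I : Type).
Implicit Types (p : I -> {mpoly K[n]}).

Definition coprime_family p := forall q, (forall i, exists r, p i = r * q) ->
  exists2 c : K, c != 0 & q = c%:MP.

(** Take the least degree [k] of a family that yields [p] after multiplication by some [s]. A common
    divisor of this family could be moved into [s], lowering [k] by its degree, so it is
    constant. *)
Lemma coprime_reduction d p i0 : (forall i, p i \is d.-homog) -> p i0 != 0 ->
  exists d' p' e s, [/\ (d' <= d)%N, forall i, p' i \is d'.-homog, coprime_family p',
    s != 0 /\ s \is e.-homog & forall i, p i = s * p' i].
Proof.
move=> hp pi0.
pose Q k := `[< exists p' s, (forall i, p' i \is k.-homog) /\ forall i, p i = s * p' i >].
have exQ : exists k, Q k.
  by exists d; apply/asboolP; exists p, 1; split=> // i; rewrite mul1r.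
case: (ex_minnP exQ) => k /asboolP[p' [s [hp' pE]]] kmin.
have [s0 p'i0] : s != 0 /\ p' i0 != 0 by apply/andP; rewrite -negb_or -mulf_eq0 -pE.
have [e hs] : exists e, s \is e.-homog.
  by apply: (@homog_factor _ _ d s (p' i0)); rewrite -pE.
exists k, p', e, s; split=> //.
  by apply: kmin; apply/asboolP; exists p, 1; split=> // i; rewrite mul1r.
move=> q /choice[r rE].
have rq0 : r i0 * q != 0 by rewrite -rE.
have hrq i : r i * q \is k.-homog by rewrite -rE.
have [k1 [l [kl _ hq]]] := homog_factors rq0 (hrq i0).
have q0 : q != 0 by apply: contraNneq rq0 => ->; rewrite mulr0.
have hr i : r i \is k1.-homog.
  have [-> |ri0] := eqVneq (r i) 0; first exact: rpred0.
  have [k2 [l2 [kl2 hr' hq']]] := homog_factors (mulf_neq0 ri0 q0) (hrq i).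
  by have -> : k1 = k2 by apply: (@addIn l); rewrite kl (dhomog_uniq q0 hq hq') kl2.
have kk1 : (k <= k1)%N.
  apply: kmin; apply/asboolP; exists r, (s * q); split=> // i.
  by rewrite pE rE; ring.
have b0 : l = 0%N by apply/eqP; rewrite -leqn0 -(leq_add2l k1) kl addn0.
move: hq; rewrite b0 => /homog0_const[c qE]; exists c => //.
by apply: contraNneq q0 => c0; rewrite qE c0 mpolyC0.
Qed.

Lemma coprime_family_prime p P : coprime_family p -> prime_elt P -> exists i, ~ divides P (p i).
Proof.
move=> cop [P0 PN1 _]; apply: contrapT => /forallNP H; apply: PN1.
have [i|c c0 ->] := cop P; first by have [] := contrapT (H i); move=> r; exists r.
by exists (c^-1)%:MP; rewrite -mpolyCM mulVf.
Qed.

(** [p i0] divides every [p' i0 * p i], and no prime divides all the [p i]; so Gauss' lemma makes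
    [p i0] divide [p' i0], and the quotient serves all indices. *)
Lemma coprime_family_proportional p p' i0 : coprime_family p -> p i0 != 0 ->
  (forall i j, p i * p' j = p j * p' i) -> exists s, forall i, p' i = s * p i.
Proof.
move=> cop pi0 pp'.
have [s sE] : divides (p i0) (p' i0).
  apply: (coprime_divides (f := p)) => //.
  - exact: factorial_ring_mpoly.
  - by move=> P PP _; apply: coprime_family_prime.
  - by move=> i; exists (p' i); rewrite mulrC pp' mulrC.
exists s => i; apply: (mulfI pi0).
by rewrite pp' sE; ring.
Qed.
End CoprimeFamily.

Lemma mpolyX_neq0 (k : nat) (K : nzRingType) (i : 'I_k) : ('X_i : {mpoly K[k]}) != 0.
Proof. by rewrite -msupp_eq0 msuppX. Qed.

(** * Points of projective space and spaces with graded forms *)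

Lemma within_continuousP (S T : topologicalType) (A : set S) (f : S -> T) :
  {within A, continuous f} <->
  forall O, open O -> exists2 O', open O' & O' `&` A = f @^-1` O `&` A.
Proof.
split=> [/continuousP cf O /cf /open_subspaceP //|H].
by apply/continuousP => O /H; apply: (open_subspaceP A _).2.
Qed.

Lemma within_open_continuousP (S T : topologicalType) (A : set S) (f : S -> T) : open A ->
  {within A, continuous f} <-> forall O, open O -> open (f @^-1` O `&` A).
Proof.
move=> oA; rewrite within_continuousP; split=> H O oO.
  by have [O' oO' <-] := H O oO; apply: openI.
by exists (f @^-1` O `&` A); [exact: H|rewrite -setIA setIid].
Qed.

Lemma open_local (T : topologicalType) (U : set T) :
  (forall x, U x -> exists O, [/\ open O, O x & O `<=` U]) -> open U.
Proof.
move=> /(_ _ _)/cid H; rewrite openE => x Ux; have [O [oO Ox OU]] := H x Ux.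
by rewrite /interior; apply: filterS OU _; apply: open_nbhs_nbhs.
Qed.

Section Proportional.
Variables (K : fieldType) (I : Type).
Implicit Types u v w : I -> K.

(** The zero vector is proportional to everything. Nonvanishing is therefore always carried
    separately, and transitivity asks for a nonzero middle vector. *)
Definition proportional u v := forall i j, u i * v j = u j * v i.

Lemma proportional_sym u v : proportional u v -> proportional v u.
Proof. by move=> uv i j; rewrite mulrC -uv mulrC. Qed.

Lemma proportionalP u v i j : u i != 0 -> v j != 0 -> proportional u v ->
  exists2 c, c != 0 & forall k, u k = c * v k.
Proof.
move=> ui vj uv; have uj : u j != 0.
  have : u i * v j != 0 by rewrite mulf_neq0.
  by rewrite uv; apply: contraNneq => ->; rewrite mul0r.
exists (u j / v j); first by rewrite mulf_neq0 ?invr_eq0.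
by move=> k; rewrite mulrAC -uv mulfK.
Qed.

Lemma scaled_proportional c v w : (forall i, w i = c * v i) -> proportional w v.
Proof. by move=> wE i j; rewrite !wE; ring. Qed.

Lemma proportional_trans v u w i : v i != 0 -> proportional u v -> proportional v w -> proportional u w.
Proof.
move=> vi uv vw j k; apply: (mulfI vi); apply: (mulfI vi).
rewrite [RHS](_ : _ = (u k * v i) * (v i * w j)); last by ring.
rewrite [LHS](_ : _ = (u j * v i) * (v i * w k)); last by ring.
by rewrite (vw i k) (vw i j) (uv j i) (uv k i); ring.
Qed.
End Proportional.

Section ProjectivePoints.
Variables (K : closedFieldType) (n : nat).
Implicit Types (x y : proj_pt K n) (v : 'I_n.+1 -> K).

Lemma proj_neq0 x : vpick (val x) != 0.
Proof. by rewrite vpick0 -dimv_eq0 (eqP (valP x)). Qed.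

Lemma vpick_hcoord x : vpick (val x) = \row_i hcoord x i.
Proof. by apply/rowP => i; rewrite mxE. Qed.

Lemma hcoord_neq0 x : exists i, hcoord x i != 0.
Proof.
apply: contrapT => /forallNP H; have /eqP[] := proj_neq0 x.
by apply/rowP => i; rewrite mxE; apply/eqP; apply: contrapT => /negP; apply: H.
Qed.

Lemma val_hcoord x : val x = <[\row_i hcoord x i]>%VS.
Proof.
rewrite -vpick_hcoord; apply/esym/eqP; rewrite eqEdim -memvE memv_pick /=.
by rewrite (eqP (valP x)) dim_vline proj_neq0.
Qed.

Lemma line_proportional x v : val x = <[\row_i v i]>%VS <->
  (exists i, v i != 0) /\ proportional (hcoord x) v.
Proof.
split=> [xv|[[j vj] xv]].
  split.
    apply: contrapT => /forallNP H; have := proj_neq0 x; rewrite vpick0 xv => /eqP[].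
    have -> : \row_i v i = 0 :> 'rV[K]_n.+1.
      by apply/rowP => i; rewrite !mxE; apply/eqP; apply: contrapT => /negP; apply: H.
    by apply/eqP; rewrite -dimv_eq0 dim_vline eqxx.
  have /vlineP[c xc] : vpick (val x) \in <[\row_i v i]>%VS by rewrite -xv memv_pick.
  have hc i : hcoord x i = c * v i by rewrite /hcoord xc !mxE.
  exact: scaled_proportional hc.
have [i xi] := hcoord_neq0 x; have [c c0 xE] := proportionalP xi vj xv.
rewrite val_hcoord; have -> : \row_k hcoord x k = c *: \row_k v k.
  by apply/rowP => k; rewrite !mxE xE.
apply/eqP; rewrite eqEsubv; apply/andP; split; rewrite -memvE; apply/vlineP.
  by exists c.
by exists c^-1; rewrite scalerA mulVf // scale1r.
Qed.

Lemma proj_eq x y : proportional (hcoord x) (hcoord y) -> x = y.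
Proof.
move=> xy; apply: val_inj; rewrite [RHS]val_hcoord.
by apply/line_proportional; split=> //; exact: hcoord_neq0.
Qed.

Fact proj_default : \dim <[\row_(i < n.+1) (1 : K)]>%VS == 1%N.
Proof.
rewrite dim_vline eqb1; apply/negP => /eqP/matrixP/(_ ord0 ord0)/eqP.
by rewrite !mxE oner_eq0.
Qed.

(* The point with homogeneous coordinates [v]; a default point if [v = 0]. *)
Definition mkproj v : proj_pt K n :=
  let P (L : {vspace 'rV[K]_n.+1}) : bool := \dim L == 1%N in
  if pselect (P <[\row_i v i]>%VS) is left p then exist P _ p else exist P _ proj_default.

Lemma mkprojE v i : v i != 0 -> val (mkproj v) = <[\row_i v i]>%VS.
Proof.
move=> vi; rewrite /mkproj; case: pselect => // -[].
rewrite dim_vline eqb1; apply/negP => /eqP/matrixP/(_ ord0 i)/eqP.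
by rewrite !mxE (negPf vi).
Qed.

Lemma hcoord_mkproj v i : v i != 0 -> exists2 c, c != 0 & forall k, hcoord (mkproj v) k = c * v k.
Proof.
move=> vi; have /line_proportional[[j vj] xv] := mkprojE vi.
have [k xk] := hcoord_neq0 (mkproj v); exact: proportionalP xk vj xv.
Qed.

Lemma mkproj_hcoord x v i : v i != 0 -> proportional (hcoord x) v -> mkproj v = x.
Proof.
move=> vi xv; apply: val_inj; rewrite (mkprojE vi); apply/esym/line_proportional.
by split=> //; exists i.
Qed.
End ProjectivePoints.

(** * Graded forms and morphisms *)

Section Formed.
Variables (K : closedFieldType) (S : fun_space K).
Implicit Types (V U : set S) (f g h G H : S -> K) (Fm : nat -> set (S -> K)).

Definition form_quotient V Fm (z : S) f := exists d G H,
  [/\ Fm d G, Fm d H, H z != 0 & forall y, V y -> H y != 0 -> f y = G y / H y].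

(* The common features of homogeneous forms on projective space, of polynomials
   on an affine variety (with the same forms in every degree) and of their
   products: they control the topology and the regular functions on [V]. *)
Record has_forms V Fm : Prop := HasForms {
  form_cst : forall c, Fm 0 (fun=> c);
  formD : forall d G H, Fm d G -> Fm d H -> Fm d (fun z => G z + H z);
  formM : forall d e G H, Fm d G -> Fm e H -> Fm (d + e) (fun z => G z * H z);
  form_nbhs : forall U z, open U -> U z -> V z ->
    exists d G, [/\ Fm d G, G z != 0 & forall y, V y -> G y != 0 -> U y];
  form_reg : forall U f z, open U -> reg U f -> U z -> V z -> form_quotient V Fm z f
}.

(** Complements [has_forms], by which open sets and regular functions come locally from forms: here
    forms yield open sets and regular functions. [pullback_morphism] asks this of the source. *)
Record forms_generate V Fm : Prop := FormsGenerate {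
  form_open : forall d G, Fm d G -> open [set z | V z /\ G z != 0];
  quotient_reg : forall d G H, Fm d G -> Fm d H ->
    reg [set z | V z /\ H z != 0] (fun z => G z / H z)
}.

Section Theory.
Variables (V : set S) (Fm : nat -> set (S -> K)).
Hypothesis fm : has_forms V Fm.
Variable z : S.

(** Multiplying numerator and denominator by [N] confines the nonvanishing locus of the denominator
    to that of [N]. *)
Lemma form_quotient_restrict f g e N : Fm e N -> N z != 0 ->
  (forall y, V y -> N y != 0 -> f y = g y) -> form_quotient V Fm z g -> form_quotient V Fm z f.
Proof.
move=> FN Nz fg [d [G [H [FG FH Hz gE]]]].
exists (d + e), (fun y => G y * N y), (fun y => H y * N y); split.
- exact: (formM fm).
- exact: (formM fm).
- by rewrite mulf_neq0.
- move=> y Vy; rewrite mulf_eq0 negb_or => /andP[Hy Ny].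
  by rewrite fg // gE // -mulf_div divff // mulr1.
Qed.

Lemma form_common_denominator (m : nat) (f : nat -> S -> K) e N :
  (forall i, (i < m)%N -> form_quotient V Fm z (f i)) -> Fm e N -> N z != 0 ->
  exists d H (G : nat -> S -> K), [/\ Fm d H, H z != 0, forall i, (i < m)%N -> Fm d (G i) &
    forall y, V y -> H y != 0 -> N y != 0 /\ forall i, (i < m)%N -> f i y = G i y / H y].
Proof.
move=> + FN Nz; elim: m => [|m IH] qf.
  (* Starting from the denominator [N] makes every later denominator a multiple of [N]. *)
  by exists e, N, (fun _ => N); split.
have [i im|d [H [G [FH Hz FG fE]]]] := IH; first by apply: qf; apply: ltnW.
have [d' [G' [H' [FG' FH' Hz' fE']]]] := qf m (leqnn _).
exists (d + d'), (fun y => H y * H' y),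
  (fun i y => if (i < m)%N then G i y * H' y else H y * G' y); split.
- exact: (formM fm).
- by rewrite mulf_neq0.
- by move=> i _; case: ltnP => [im|_]; apply: (formM fm) => //; apply: FG.
- move=> y Vy; rewrite mulf_eq0 negb_or => /andP[Hy Hy'].
  have [Ny fEy] := fE y Vy Hy; split=> // i; rewrite ltnS leq_eqVlt.
  have [im _|mi] := ltnP i m.
    by rewrite fEy // -mulf_div divff // mulr1.
  by rewrite orbF => /eqP ->; rewrite fE' // -mulf_div divff // mul1r.
Qed.

End Theory.
End Formed.

(** Homogeneous coordinates of [f x] are picked by [hcoord] and known only up to a scalar. [scale]
    absorbs this choice and cancels in quotients of forms of equal degree; [e] is the degree of the
    forms that define [f]. *)
Lemma pullback_morphism (K : closedFieldType) (S S' : fun_space K)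
    (V : set S) (Fm : nat -> set (S -> K)) (V' : set S') (Fm' : nat -> set (S' -> K))
    (A : set S) (B : set S') (f : S -> S') (scale : S -> K) (e : nat) :
  has_forms V Fm -> forms_generate V Fm -> has_forms V' Fm' ->
  open A -> A `<=` V -> (forall x, A x -> V' (f x)) -> (forall x, A x -> B (f x)) ->
  (forall x, A x -> scale x != 0) ->
  (forall d G', Fm' d G' -> exists2 G, Fm (e * d)%N G &
     forall x, A x -> G' (f x) = scale x ^+ d * G x) ->
  morphism_on A B f.
Proof.
move=> fm fg fm' oA AV AV' AB sc0 pull; split=> //.
  apply/within_open_continuousP => // O oO; apply: open_local => x [/= Ox Ax].
  have [d [G' [FG' G'x G'O]]] := form_nbhs fm' oO Ox (AV' _ Ax).
  have [G FG GE] := pull d G' FG'.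
  exists (A `&` [set z | V z /\ G z != 0]); split.
  - by apply: openI => //; exact: (form_open fg FG).
  - split=> //; split; first exact: AV.
    by apply: contraNneq G'x => Gx; rewrite GE // Gx mulr0.
  - move=> y [Ay [_ Gy]]; split=> //; apply: G'O; first exact: AV'.
    by rewrite GE // mulf_neq0 ?expf_neq0 ?sc0.
move=> U g oU rg x Ax Ux.
have [d [G' [H' [FG' FH' H'x gE]]]] := form_reg fm' oU rg Ux (AV' _ Ax).
have [G FG GE] := pull d G' FG'; have [H FH HE] := pull d H' FH'.
exists [set z | V z /\ H z != 0], (fun z => G z / H z); split.
- exact: (form_open fg FH).
- split; first exact: AV.
  by apply: contraNneq H'x => Hx; rewrite HE // Hx mulr0.
- exact: (quotient_reg fg FG FH).
- move=> y Ay [Vy Hy]; rewrite gE ?HE ?GE //; last 2 first.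
  + exact: AV'.
  + by rewrite mulf_neq0 ?expf_neq0 ?sc0.
  by rewrite -mulf_div divff ?mul1r // expf_neq0 // sc0.
Qed.

Section ProjectiveForms.
Variables (K : closedFieldType) (n : nat).
Local Notation Pn := (projective_space K n).

Definition proj_form (d : nat) : set (Pn -> K) :=
  [set G | exists2 p : {mpoly K[n.+1]}, p \is d.-homog & G = fun x => p.@[hcoord x]].

Lemma proj_form_nbhs (U : set Pn) x : open U -> U x ->
  exists d (p : {mpoly K[n.+1]}), [/\ p \is d.-homog, p.@[hcoord x] != 0 &
    forall y : Pn, p.@[hcoord y] != 0 -> U y].
Proof.
move=> [P [hP UP]] Ux; have : ~ proj_zeros P x by rewrite -UP.
move=> /existsNP[p /not_implyP[Pp px]]; have [d hp] := hP p Pp.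
exists d, p; split=> // [|y py]; first exact/eqP.
apply: contrapT => Uy; have : proj_zeros P y by rewrite -UP.
by move=> /(_ p Pp) /eqP; rewrite (negPf py).
Qed.

Lemma proj_has_forms : has_forms setT proj_form.
Proof.
split.
- move=> c; exists c%:MP; last by apply/funext => x; rewrite mevalC.
  by rewrite -[c%:MP]mulr1 mul_mpolyC rpredZ // dhomog1.
- move=> d _ _ [p hp ->] [q hq ->]; exists (p + q); first exact: rpredD.
  by apply/funext => x; rewrite mevalD.
- move=> d e _ _ [p hp ->] [q hq ->]; exists (p * q); first exact: dhomogM.
  by apply/funext => x; rewrite mevalM.
- move=> U x oU Ux _; have [d [p [hp px pU]]] := proj_form_nbhs oU Ux.
  by exists d, (fun x => p.@[hcoord x]); split=> //; [exists p|move=> y _; apply: pU].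
- move=> U f x oU rf Ux _; have [d [p [q [hp hq qx fE]]]] := rf x Ux.
  have [e [N [hN Nx NU]]] := proj_form_nbhs oU Ux.
  exists (d + e), (fun x => (p * N).@[hcoord x]), (fun x => (q * N).@[hcoord x]); split.
  + by exists (p * N) => //; apply: dhomogM.
  + by exists (q * N) => //; apply: dhomogM.
  + by rewrite mevalM mulf_neq0.
  + move=> y _; rewrite !mevalM mulf_eq0 negb_or => /andP[qy Ny].
    by rewrite (fE y (NU y Ny) qy) -mulf_div divff // mulr1.
Qed.

Lemma proj_open_neq0 d (p : {mpoly K[n.+1]}) : p \is d.-homog ->
  open [set x : Pn | p.@[hcoord x] != 0].
Proof.
move=> hp; exists [set p]; split=> [_ ->|]; first by exists d.
apply/seteqP; split=> x /=; first by move=> /negP/negPn/eqP px _ ->.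
by move=> /(_ p erefl) ->; rewrite eqxx.
Qed.

Lemma proj_forms_generate : forms_generate setT proj_form.
Proof.
split.
- move=> d _ [p hp ->]; rewrite (_ : [set z | _] = [set x : Pn | p.@[hcoord x] != 0]).
    exact: proj_open_neq0 hp.
  by apply/seteqP; split=> x //= -[].
- move=> d _ _ [p hp ->] [q hq ->] x [_ qx]; exists d, p, q; split=> //.
Qed.

End ProjectiveForms.

(** For a coordinate [x_j] that is nonzero at [f z], the functions [x_i / x_j] pull back to regular
    functions, hence to quotients of forms. Over a common denominator, the numerators are
    homogeneous coordinates of the map. *)
Lemma local_projective_rep (K : closedFieldType) (n : nat) (S : fun_space K) (V A : set S)
    (Fm : nat -> set (S -> K)) (f : S -> projective_space K n) z :
  has_forms V Fm -> open A -> morphism_on A setT f -> A z -> V z ->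
  exists d (F : 'I_n.+1 -> S -> K) e N, [/\ forall i, Fm d (F i), Fm e N, N z != 0 &
    forall y, V y -> N y != 0 -> A y /\ val (f y : proj_pt K n) = <[\row_i F i y]>%VS].
Proof.
move=> fm oA [_ cf pull] Az Vz.
have [j zj] := hcoord_neq0 (f z).
have hX i : ('X_i : {mpoly K[n.+1]}) \is 1.-homog by rewrite dhomogX /= mdeg1.
pose W := [set x : projective_space K n | ('X_j : {mpoly K[n.+1]}).@[hcoord x] != 0].
have oW : open W by apply: proj_open_neq0 (hX j).
pose g i (x : projective_space K n) :=
  ('X_i : {mpoly K[n.+1]}).@[hcoord x] / ('X_j : {mpoly K[n.+1]}).@[hcoord x].
have rg i : reg W (g i) by move=> x Wx; exists 1%N, 'X_i, 'X_j; split.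
have Wz : W (f z) by rewrite /W /= mevalXU.
have oAW : open (f @^-1` W `&` A) by apply: (within_open_continuousP _ oA).1.
have [e [N [FN Nz NAW]]] := form_nbhs fm oAW (conj Wz Az) Vz.
have qg i : form_quotient V Fm z (fun y => g i (f y)).
  have [O [h [oO Oz rh hE]]] := pull W (g i) oW (rg i) z Az Wz.
  have [e' [N' [FN' N'z N'O]]] := form_nbhs fm oO Oz Vz.
  apply: (form_quotient_restrict (g := h) fm (formM fm FN FN') (mulf_neq0 Nz N'z)).
    move=> y Vy /=; rewrite mulf_eq0 negb_or => /andP[Ny N'y].
    by rewrite hE //; [exact: (NAW _ Vy Ny).2|exact: N'O].
  exact: (form_reg fm oO rh Oz Vz).
have qg' i : (i < n.+1)%N -> form_quotient V Fm z (fun y => g (inord i) (f y)) by [].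
have [d [H [G [FH Hz FG GE]]]] := form_common_denominator fm qg' FN Nz.
exists d, (fun i : 'I_n.+1 => G (val i)), d, H; split=> // [i|y Vy Hy]; first exact: FG (ltn_ord i).
have [Ny gE] := GE y Vy Hy; have [Wy Ay] := NAW y Vy Ny; split=> //.
rewrite /W /= mevalXU in Wy.
have GiE i : G (val i) y = (H y / hcoord (f y) j) * hcoord (f y) i.
  have := gE (val i) (ltn_ord i); rewrite inord_val /g !mevalXU => e1.
  by rewrite mulrAC -mulrA e1 mulrC divfK.
apply/line_proportional; split.
  by exists j; rewrite GiE divfK.
exact/proportional_sym/scaled_proportional/GiE.
Qed.

(** * Products *)

Section ProductTopology.
Variables (K : closedFieldType) (S T : fun_space K).

Lemma prod_open_ind (z : prod_space S T) (Q : set (prod_space S T) -> Prop) :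
  Q setT -> (forall A B, Q A -> Q B -> Q (A `&` B)) ->
  (forall A B, A `<=` B -> Q A -> Q B) ->
  (forall W, prod_basic W -> W z -> Q W) ->
  forall U, open U -> U z -> Q U.
Proof.
move=> QT QI QS Qb U [D sD <-] [W DW Wz]; apply: (QS W); first by move=> y Wy; exists W.
have [F sF WE] := sD W DW.
have {sF} Fb i : i \in F -> prod_basic i by move=> /sF; rewrite inE.
have {}Wz i : i \in F -> i z by move=> iF; move: Wz; rewrite -WE; apply.
suff H (s : seq (set (prod_pt S T))) : (forall i, i \in s -> prod_basic i /\ i z) ->
    Q [set y | forall i, i \in s -> i y].
  apply: QS (H F _) => [y Hy|i iF]; last by split; [exact: Fb|exact: Wz].
  by rewrite -WE => i; apply: Hy.
elim: s => [_|B s IH Hs]; first by apply: QS QT => y _ i.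
apply: (QS (B `&` [set y | forall i, i \in s -> i y])).
  by move=> y [By Iy] i; rewrite inE => /orP[/eqP ->|/Iy].
apply: QI; first by have [] := Hs B (mem_head _ _); apply: Qb.
by apply: IH => i iS; apply: Hs; rewrite inE iS orbT.
Qed.

Lemma prod_basic_open (W : set (prod_space S T)) : prod_basic W -> open W.
Proof.
move=> bW; exists [set W]; last by rewrite bigcup_set1.
move=> _ ->; exists [fset W]%fset; first by move=> i /fset1P ->; rewrite inE.
apply/seteqP; split=> y; first by apply; rewrite /= inE.
by move=> Wy i; rewrite /= inE => /eqP ->.
Qed.

Lemma tensor_regD (A : set S) (B : set T) (h k : prod_space S T -> K) :
  tensor_reg A B h -> tensor_reg A B k -> tensor_reg A B (fun z => h z + k z).
Proof.
move=> [m [f [g [rfg ->]]]] [m' [f' [g' [rfg' ->]]]].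
exists (m + m')%N, (fun i => match fintype.split i with inl j => f j | inr j => f' j end),
  (fun i => match fintype.split i with inl j => g j | inr j => g' j end); split.
  by move=> i; case: fintype.split.
apply/funext => z; rewrite big_split_ord /=; congr (_ + _); apply: eq_bigr => i _.
  by case: split_ordP => [j /lshift_inj <-|j /eqP] //; rewrite eq_lrshift.
by case: split_ordP => [j /eqP|j /rshift_inj <-] //; rewrite eq_rlshift.
Qed.

Lemma tensor_reg_tensor (A : set S) (B : set T) f g : reg A f -> reg B g ->
  tensor_reg A B (fun z => f z.1 * g z.2).
Proof.
move=> rf rg; exists 1, (fun=> f), (fun=> g); split=> //.
by apply/funext => z; rewrite big_ord1.
Qed.

End ProductTopology.

Section ProductForms.
Variables (K : closedFieldType) (S T : fun_space K).
Variables (V : set S) (P : set (S -> K)) (V' : set T) (Fm : nat -> set (T -> K)).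

(** The tensor product of [P] with the forms of degree [d]. The first factor is affine, so only the
    second one carries a degree. *)
Inductive prod_form (d : nat) : set (prod_space S T -> K) :=
| prod_form_tensor f g : P f -> Fm d g -> prod_form d (fun z => f z.1 * g z.2)
| prod_formD G H : prod_form d G -> prod_form d H -> prod_form d (fun z => G z + H z).

Definition prod_region : set (prod_space S T) := [set z | V z.1 /\ V' z.2].

Hypothesis fmS : has_forms V (fun=> P).
Hypothesis fmT : has_forms V' Fm.

Lemma prod_formM d e G H : prod_form d G -> prod_form e H ->
  prod_form (d + e) (fun z => G z * H z).
Proof.
elim=> [f g Pf Fg|G1 G2 _ IH1 _ IH2].
  elim=> [f' g' Pf' Fg'|H1 H2 _ IH1 _ IH2].
    rewrite (_ : (fun z => _) = fun z : prod_space S T => (f z.1 * f' z.1) * (g z.2 * g' z.2)).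
      exact: (prod_form_tensor (formM fmS (d := 0) (e := 0) Pf Pf') (formM fmT Fg Fg')).
    by apply/funext => z; rewrite mulrACA.
  rewrite (_ : (fun z => _) = fun z => f z.1 * g z.2 * H1 z + f z.1 * g z.2 * H2 z).
    exact: prod_formD.
  by apply/funext => z; rewrite mulrDr.
move=> FH; rewrite (_ : (fun z => _) = fun z => G1 z * H z + G2 z * H z).
  by apply: prod_formD; [exact: IH1|exact: IH2].
by apply/funext => z; rewrite mulrDl.
Qed.

Lemma prod_form_left f : P f -> prod_form 0 (fun z => f z.1).
Proof.
move=> Pf; rewrite (_ : (fun z => _) = fun z : prod_space S T => f z.1 * 1).
  exact: (prod_form_tensor Pf (form_cst fmT 1)).
by apply/funext => z; rewrite mulr1.
Qed.

Lemma prod_form_right d g : Fm d g -> prod_form d (fun z => g z.2).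
Proof.
move=> Fg; rewrite (_ : (fun z => _) = fun z : prod_space S T => 1 * g z.2).
  exact: (prod_form_tensor (form_cst fmS 1) Fg).
by apply/funext => z; rewrite mul1r.
Qed.

Lemma prod_form_slice_left d G s : prod_form d G -> Fm d (fun y => G (s, y)).
Proof.
elim=> [f g Pf Fg|G1 G2 _ IH1 _ IH2]; last exact: (formD fmT).
by have := formM fmT (form_cst fmT (f s)) Fg.
Qed.

Lemma prod_form_slice_right d G t : prod_form d G -> P (fun x => G (x, t)).
Proof.
elim=> [f g Pf Fg|G1 G2 _ IH1 _ IH2]; last exact: (formD fmS (d := 0)).
by have := formM fmS (d := 0) (e := 0) Pf (form_cst fmS (g t)).
Qed.

Local Notation quot := (form_quotient prod_region prod_form).

Let quot_left f z : form_quotient V (fun=> P) z.1 f -> quot z (fun y => f y.1).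
Proof.
move=> [d [G [H [PG PH Hz fE]]]].
exists 0, (fun y => G y.1), (fun y => H y.1); split=> //; try exact: prod_form_left.
by move=> y [Vy _]; apply: fE.
Qed.

Let quot_right g z : form_quotient V' Fm z.2 g -> quot z (fun y => g y.2).
Proof.
move=> [d [G [H [PG PH Hz gE]]]].
exists d, (fun y => G y.2), (fun y => H y.2); split=> //; try exact: prod_form_right.
by move=> y [_ Vy]; apply: gE.
Qed.

Let quotD z h k : quot z h -> quot z k -> quot z (fun y => h y + k y).
Proof.
move=> [d [G [H [FG FH Hz hE]]]] [d' [G' [H' [FG' FH' Hz' kE]]]].
exists (d + d')%N, (fun y => G y * H' y + H y * G' y), (fun y => H y * H' y); split.
- by apply: prod_formD; apply: prod_formM.
- exact: prod_formM.
- by rewrite mulf_neq0.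
- move=> y Vy; rewrite mulf_eq0 negb_or => /andP[Hy H'y].
  by rewrite hE // kE // addf_div // [H y * G' y]mulrC.
Qed.

Let quotM z h k : quot z h -> quot z k -> quot z (fun y => h y * k y).
Proof.
move=> [d [G [H [FG FH Hz hE]]]] [d' [G' [H' [FG' FH' Hz' kE]]]].
exists (d + d')%N, (fun y => G y * G' y), (fun y => H y * H' y); split.
- exact: prod_formM.
- exact: prod_formM.
- by rewrite mulf_neq0.
- move=> y Vy; rewrite mulf_eq0 negb_or => /andP[Hy H'y].
  by rewrite hE // kE // mulf_div.
Qed.

Let prod_form_cst c : prod_form 0 (fun=> c).
Proof. exact: (prod_form_left (form_cst fmS c)). Qed.

Let quot_tensor z (A : set S) (B : set T) h : open A -> open B -> A z.1 -> B z.2 ->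
  prod_region z -> tensor_reg A B h -> quot z h.
Proof.
move=> oA oB Az Bz [Vz V'z] [m [f [g [rfg ->]]]].
elim: m => [|m IH] in f g rfg *.
  rewrite (_ : (fun p => _) = fun=> 0); last by apply/funext => p; rewrite big_ord0.
  by exists 0, (fun=> 0), (fun=> 1); split=> [||//|y _ _]; rewrite ?oner_neq0 ?mul0r //; exact: prod_form_cst.
rewrite (_ : (fun p => _) = fun p : prod_space S T =>
    f ord0 p.1 * g ord0 p.2 + \sum_(i < m) f (lift ord0 i) p.1 * g (lift ord0 i) p.2).
  apply: quotD; last first.
    exact: (IH (fun i => f (lift ord0 i)) (fun i => g (lift ord0 i)) (fun i => rfg _)).
  have [rf rg] := rfg ord0; apply: quotM.
    by apply: quot_left; exact: (form_reg fmS oA rf Az Vz).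
  by apply: quot_right; exact: (form_reg fmT oB rg Bz V'z).
by apply/funext => p; rewrite big_ord_recl.
Qed.

Let nbhs_box z (A : set S) (B : set T) : open A -> open B -> A z.1 -> B z.2 ->
  prod_region z -> exists d N, [/\ prod_form d N, N z != 0 &
     forall y, prod_region y -> N y != 0 -> A y.1 /\ B y.2].
Proof.
move=> oA oB Az Bz [Vz V'z].
have [d [f [Pf fz fA]]] := form_nbhs fmS oA Az Vz.
have [e [g [Fg gz gB]]] := form_nbhs fmT oB Bz V'z.
exists e, (fun y => f y.1 * g y.2); split.
- exact: (prod_form_tensor Pf Fg).
- by rewrite mulf_neq0.
- move=> y [Vy V'y]; rewrite mulf_eq0 negb_or => /andP[fy gy].
  by split; [exact: fA|exact: gB].
Qed.

Let prod_form_nbhs U z : open U -> U z -> prod_region z ->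
  exists d N, [/\ prod_form d N, N z != 0 & forall y, prod_region y -> N y != 0 -> U y].
Proof.
move=> oU Uz Vz; move: U oU Uz; apply: prod_open_ind.
- by exists 0, (fun=> 1); split; rewrite ?oner_neq0 //; exact: prod_form_cst.
- move=> A B [d [N [FN Nz NA]]] [e [M [FM Mz MB]]].
  exists (d + e)%N, (fun y => N y * M y); split; [exact: prod_formM|by rewrite mulf_neq0|].
  move=> y Vy; rewrite mulf_eq0 negb_or => /andP[Ny My].
  by split; [exact: NA|exact: MB].
- by move=> A B AB [d [N [FN Nz NA]]]; exists d, N; split=> // y Vy Ny; apply/AB/NA.
move=> _ [A [B [h [oA oB th ->]]]] /= [Az Bz hz].
have [d [N [FN Nz NAB]]] := nbhs_box oA oB Az Bz Vz.
have [e [G [H [FG FH Hz hE]]]] := quot_tensor oA oB Az Bz Vz th.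
(* [h] is known to equal [G / H] only where [H] is nonzero, and is nonzero there exactly where [G]
   is; so both enter the equation of the neighbourhood. *)
exists (d + (e + e))%N, (fun y => N y * (G y * H y)); split.
- by do 2?apply: prod_formM.
- by rewrite !mulf_neq0 //; apply: contraNneq hz => Gz; rewrite hE // Gz mul0r.
- move=> y Vy; rewrite !mulf_eq0 !negb_or => /and3P[Ny Gy Hy].
  have [Ay By] := NAB y Vy Ny.
  by split=> //; rewrite hE // mulf_neq0 // invr_eq0.
Qed.

Lemma prod_has_forms : has_forms prod_region prod_form.
Proof.
split.
- exact: prod_form_cst.
- by move=> d G H; apply: prod_formD.
- exact: prod_formM.
- exact: prod_form_nbhs.
move=> U f z oU rf Uz Vz.
have [A [B [h [k [[oA oB Az Bz] th tk kz fE]]]]] := rf z Uz.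
have [d [N [FN Nz NU]]] := prod_form_nbhs oU Uz Vz.
have [e [M [FM Mz MAB]]] := nbhs_box oA oB Az Bz Vz.
have [d1 [G [H [FG FH Hz hE]]]] := quot_tensor oA oB Az Bz Vz th.
have [d2 [G' [H' [FG' FH' Hz' kE]]]] := quot_tensor oA oB Az Bz Vz tk.
have Gz' : G' z != 0 by apply: contraNneq kz => Gz; rewrite kE // Gz mul0r.
(* [L] multiplies numerator and denominator alike. It confines the formula to the region where [f]
   is [h / k], and its factor [H' * G'] makes the expression for [k] defined and nonzero. *)
pose L y := N y * M y * (H' y * G' y).
have FL : prod_form (d + e + (d2 + d2)) L by do 2?apply: prod_formM.
exists (d + e + (d2 + d2) + (d1 + d2))%N, (fun y => L y * (G y * H' y)), (fun y => L y * (H y * G' y)).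
split.
- by apply: prod_formM => //; apply: prod_formM.
- by apply: prod_formM => //; apply: prod_formM.
- by rewrite /L !mulf_neq0.
move=> y Vy; rewrite /L !mulf_eq0 !negb_or => /and3P[/and3P[/andP[Ny My] H'y G'y] Hy _].
have [Ay By] := MAB y Vy My.
rewrite fE ?hE ?kE //; last 2 first.
- exact: NU.
- by rewrite mulf_neq0 // invr_eq0.
have Ly : N y * M y * (H' y * G' y) != 0 by rewrite !mulf_neq0.
by rewrite -[RHS]mulf_div divff // mul1r invf_div mulf_div.
Qed.

Hypothesis fgS : forms_generate V (fun=> P).
Hypothesis fgT : forms_generate V' Fm.
Hypothesis oV : open V.

(** A form of positive degree is not a function on its own. Near a point it is divided by a form [l]
    of the second factor, of the same degree and nonzero there, which leaves a sum of products of
    regular functions. If a form is nonzero at the point, such an [l] occurs in one of its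
    summands. *)
Lemma prod_forms_generate : forms_generate prod_region prod_form.
Proof.
have regP f : P f -> reg V f.
  move=> Pf; have := quotient_reg fgS Pf (form_cst fmS 1) (d := 0).
  rewrite (_ : [set _ | _] = V); last first.
    by apply/seteqP; split=> [y []|y Vy] //; split=> //; exact: oner_neq0.
  by rewrite (_ : (fun _ => _) = f) //; apply/funext => y; rewrite divr1.
have denom d G z : prod_form d G -> G z != 0 -> exists2 l, Fm d l & l z.2 != 0.
  elim=> [f g Pf Fg|G1 G2 _ IH1 _ IH2].
    by rewrite mulf_eq0 negb_or => /andP[_ gz]; exists g.
  have [->|G1z _] := eqVneq (G1 z) 0; last exact: IH1.
  by rewrite add0r => /IH2.
have tens d G l : prod_form d G -> Fm d l ->
    tensor_reg V [set y | V' y /\ l y != 0] (fun z => G z / l z.2).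
  move=> FG Fl; elim: FG => [f g Pf Fg|G1 G2 _ IH1 _ IH2]; last first.
    rewrite (_ : (fun _ => _) = fun z : prod_space S T => G1 z / l z.2 + G2 z / l z.2).
      exact: tensor_regD.
    by apply/funext => z; rewrite mulrDl.
  rewrite (_ : (fun _ => _) = fun z : prod_space S T => f z.1 * (g z.2 / l z.2)).
    exact: (tensor_reg_tensor (regP _ Pf) (quotient_reg fgT Fg Fl)).
  by apply/funext => z; rewrite mulrA.
split=> [d G FG|d G H FG FH].
  apply: open_local => z [[Vz V'z] Gz]; have [l Fl lz] := denom d G z FG Gz.
  exists [set y | [/\ V y.1, V' y.2 /\ l y.2 != 0 & G y / l y.2 != 0]]; split.
  - apply: prod_basic_open; exists V, [set y | V' y /\ l y != 0], (fun z => G z / l z.2).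
    by split; [exact: oV|exact: (form_open fgT Fl)|exact: (tens _ _ _ FG Fl)|].
  - by split=> //; rewrite mulf_neq0 // invr_eq0.
  - by move=> y [Vy [V'y ly]]; rewrite mulf_eq0 negb_or => /andP[Gy _].
move=> z [[Vz V'z] Hz]; have [l Fl lz] := denom d H z FH Hz.
exists V, [set y | V' y /\ l y != 0], (fun z => G z / l z.2), (fun z => H z / l z.2).
split.
- by split=> //; exact: (form_open fgT Fl).
- exact: (tens _ _ _ FG Fl).
- exact: (tens _ _ _ FH Fl).
- by rewrite mulf_neq0 // invr_eq0.
- move=> y [_ Hy] _ [_ ly] _.
  by rewrite invf_div mulrA divfK.
Qed.

End ProductForms.

(** * Birational maps of projective space and their degree *)

Lemma morphism_on_sub (K : closedFieldType) (S T : fun_space K) (A A' : set S) (B B' : set T) f : morphism_on A B f ->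
  A' `<=` A -> (forall x, A' x -> B' (f x)) -> morphism_on A' B' f.
Proof.
move=> [_ cf pull] A'A fB; split=> //; first exact: continuous_subspaceW cf.
move=> V g oV rg x A'x Vx; have [O [h [oO Ox rh hE]]] := pull V g oV rg x (A'A _ A'x) Vx.
by exists O, h; split=> // y /A'A; apply: hE.
Qed.

Lemma iso_via_sub (K : closedFieldType) (S T : fun_space K) (A A' : set S) (B : set T) f : iso_via A B f -> A' `<=` A -> open A' -> open B ->
  exists2 B', open B' /\ iso_via A' B' f & B' = [set y | B y /\ exists2 x, A' x & f x = y].
Proof.
move=> [mf [g [mg gf fg]]] A'A oA' oB.
have [_ cg _] := mg; have [fB _ _] := mf; have [gA _ _] := mg.
exists [set y | B y /\ exists2 x, A' x & f x = y] => //.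
have BE : [set y | B y /\ exists2 x, A' x & f x = y] = g @^-1` A' `&` B.
  apply/seteqP; split=> y /=; last by move=> [A'y By]; split=> //; exists (g y) => //; apply: fg.
  by move=> [By [x A'x <-]]; rewrite (gf _ (A'A _ A'x)); split=> //; apply/fB/A'A.
split; first by rewrite BE; apply: (within_open_continuousP _ oB).1.
split; first by apply: (morphism_on_sub mf A'A _) => x A'x; split; [apply/fB/A'A|exists x].
exists g; split.
- by rewrite BE; apply: (morphism_on_sub mg) => [y []|y []].
- by move=> x /A'A; apply: gf.
- by move=> y []; move=> By _; apply: fg.
Qed.

Section ProjectiveSpace.
Variables (K : closedFieldType) (n : nat).
Local Notation Pn := (projective_space K n).
Implicit Types (U W O : set Pn) (p : {mpoly K[n.+1]}).

Lemma proj_nonroot d p : p \is d.-homog -> p != 0 -> exists x : Pn, p.@[hcoord x] != 0.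
Proof.
(* The extra factor [X_0] forces [v] to be a nonzero vector even if [p] is constant; the same device
   recurs below. *)
move=> hp p0; have [v] := mpoly_nonroot (mulf_neq0 p0 (mpolyX_neq0 K (ord0 : 'I_n.+1))).
rewrite mevalM mevalXU mulf_eq0 negb_or => /andP[pv v0].
have [c c0 cE] := hcoord_mkproj v0; exists (mkproj v).
rewrite (_ : hcoord _ = fun i => c * v i); last exact/funext.
by rewrite (meval_dhomog _ _ hp) mulf_neq0 // expf_neq0.
Qed.

Lemma proj_open_meet U W : open U -> open W -> U !=set0 -> W !=set0 -> U `&` W !=set0.
Proof.
move=> oU oW [x Ux] [y Wy].
have [d [p [hp px pU]]] := proj_form_nbhs oU Ux.
have [e [q [hq qy qW]]] := proj_form_nbhs oW Wy.
have p0 : p != 0 by apply: contraNneq px => ->; rewrite meval0.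
have q0 : q != 0 by apply: contraNneq qy => ->; rewrite meval0.
have [z] := proj_nonroot (dhomogM hp hq) (mulf_neq0 p0 q0).
rewrite mevalM mulf_eq0 negb_or => /andP[pz qz].
by exists z; split; [exact: pU|exact: qW].
Qed.

Lemma proj_dense U : open U -> U !=set0 -> dense U.
Proof. by move=> oU U0 O O0 oO; apply: proj_open_meet. Qed.

Lemma proj_dense_neq0 U : dense U -> U !=set0.
Proof.
move=> dU; have [x [_ Ux]] := dU setT (ex_intro _ (mkproj (fun=> 1)) I) openT.
by exists x.
Qed.

Lemma proj_vanish d p U : p \is d.-homog -> open U -> U !=set0 ->
  (forall x, U x -> p.@[hcoord x] = 0) -> p = 0.
Proof.
move=> hp oU U0 pU; apply/eqP; apply: contrapT => /negP p0.
have [x px] := proj_nonroot hp p0.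
have [y [/= py Uy]] := proj_open_meet (proj_open_neq0 hp) oU (ex_intro _ x px) U0.
by move: py; rewrite pU // eqxx.
Qed.

Definition rep_on (f : Pn -> Pn) O d (P : 'I_n.+1 -> {mpoly K[n.+1]}) :=
  (forall i, P i \is d.-homog) /\
  forall x, O x -> val (f x : proj_pt K n) = <[\row_i (P i).@[hcoord x]]>%VS.

Lemma morphism_rep A f x : open A -> morphism_on A setT f -> A x ->
  exists O d P, [/\ open O, O x, O `<=` A & rep_on f O d P].
Proof.
move=> oA mf Ax.
have [d [F [e [N [FF [q hq ->] Nx NE]]]]] := local_projective_rep (proj_has_forms K n) oA mf Ax I.
have /choice[P PE] : forall i, exists p : {mpoly K[n.+1]}, p \is d.-homog /\ F i = fun x => p.@[hcoord x].
  by move=> i; have [p hp FE] := FF i; exists p.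
exists [set y : Pn | q.@[hcoord y] != 0], d, P; split=> //.
- exact: proj_open_neq0 hq.
- by move=> y qy; have [] := NE y I qy.
split=> [i|y qy]; first by have [] := PE i.
have [_ ->] := NE y I qy; congr (<[_]>)%VS; apply/rowP => i; rewrite !mxE.
by have [_ ->] := PE i.
Qed.

(** The minors are forms that vanish on a nonempty open set, hence they are zero. *)
Lemma rep_proportional f f' O O' W d d' P P' : rep_on f O d P -> rep_on f' O' d' P' ->
  open W -> W !=set0 -> W `<=` O -> W `<=` O' -> (forall x, W x -> f x = f' x) ->
  forall i j, P i * P' j = P j * P' i.
Proof.
move=> [hP fP] [hP' fP'] oW W0 WO WO' ff' i j.
apply/eqP; rewrite -subr_eq0; apply/eqP.
apply: (@proj_vanish (d + d') _ W) => //; first by apply: rpredB; apply: dhomogM.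
move=> x Wx; rewrite mevalB !mevalM.
have /line_proportional[[k Pk] hx] := fP x (WO _ Wx).
have /line_proportional[[l Pl] hx'] := fP' x (WO' _ Wx); rewrite -ff' // in hx'.
have [m fm] := hcoord_neq0 (f x).
have prop := proportional_trans fm (proportional_sym hx) hx'.
by rewrite (prop i j) subrr.
Qed.

Lemma rep_nonzero f O d P x : rep_on f O d P -> O x -> exists i, P i != 0.
Proof.
move=> [_ fP] Ox; have /line_proportional[[i Pi] _] := fP x Ox; exists i.
by apply: contraNneq Pi => ->; rewrite meval0.
Qed.

(** Near a common point of the domains both maps have polynomial representations. Agreement on a
    dense open set makes all their minors vanish identically, so the maps agree at that point
    too. *)
Lemma bir_class_eq (f g : birmap Pn) :
  bir_class f = bir_class g <-> forall x, bdom f x -> bdom g x -> bfun f x = bfun g x.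
Proof.
have [oF df mf _] := bfunP f; have [og dg mg _] := bfunP g.
split=> [/eqmodP/asboolP[W [oW dW sW eW]] x fx gx|H].
  have [O [d [P [oO Ox OA rf]]]] := morphism_rep oF mf fx.
  have [O' [d' [P' [oO' Ox' OA' rg]]]] := morphism_rep og mg gx.
  have W0 : O `&` O' `&` W !=set0.
    by apply: proj_open_meet => //; [exact: openI|exists x|exact: proj_dense_neq0].
  have PP' := rep_proportional rf rg (openI (openI oO oO') oW) W0
    (fun _ H => H.1.1) (fun _ H => H.1.2) (fun x H => eW x H.2).
  have /line_proportional[[k Pk] hx] := rf.2 x Ox.
  have /line_proportional[[l Pl] hx'] := rg.2 x Ox'.
  apply: proj_eq; apply: (@proportional_trans _ _ (fun i => (P i).@[hcoord x]) _ _ k Pk hx).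
  apply: (@proportional_trans _ _ (fun i => (P' i).@[hcoord x]) _ _ l Pl _ (proportional_sym hx')) => i j.
  by rewrite -!mevalM PP'.
apply/eqmodP/asboolP; exists (bdom f `&` bdom g); split=> //.
- exact: openI.
- exact: denseI.
- by move=> x [fx gx]; apply: H.
Qed.

Lemma birational_on_sub U O f : birational_on U (f : Pn -> Pn) -> open O -> O !=set0 -> O `<=` U ->
  birational_on O f.
Proof.
move=> [oU dU mf [U' [V' [oU' dU' oV' dV' [U'U iso]]]]] oO O0 OU; split=> //.
- exact: proj_dense.
- exact: (morphism_on_sub mf OU (fun _ _ => I)).
have [x [U'x Ox]] := proj_open_meet oU' oO (proj_dense_neq0 dU') O0.
have [V'' [oV'' iso''] VE] := iso_via_sub iso (@subIsetl _ U' O) (openI oU' oO) oV'.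
exists (U' `&` O), V''; split=> //.
- exact: openI.
- by apply: proj_dense; [exact: openI|exists x].
- by apply: proj_dense => //; exists (f x); have [[fB _ _] _] := iso''; apply: fB.
Qed.

(** A common factor [s] of the [P i] is divided out, which can only lower the degree. The class is
    then represented by the restriction of the map to the open set where [s] is nonzero. *)
Lemma has_degree_rep (f : birmap Pn) O d P : open O -> O !=set0 -> O `<=` bdom f ->
  rep_on (bfun f) O d P -> exists2 d', (d' <= d)%N & has_degree (bir_class f) d'.
Proof.
move=> oO [x Ox] Of rf; have [i0 Pi0] := rep_nonzero rf Ox.
have [d' [p [e [s [d'd hp cop [s0 hs] PE]]]]] := coprime_reduction rf.1 Pi0.
exists d' => //; exists p; split=> //.
pose O' := O `&` [set x : Pn | s.@[hcoord x] != 0].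
have oO' : open O' by apply: openI => //; apply: proj_open_neq0 hs.
have O'0 : O' !=set0.
  apply: proj_open_meet => //; first exact: proj_open_neq0 hs.
    by exists x.
  exact: proj_nonroot hs s0.
have fO' : birational_on O' (bfun f).
  by apply: (birational_on_sub (bfunP f) oO' O'0 _) => y [Oy _]; apply: Of.
exists (BirMap fO').
  by apply/bir_class_eq.
move=> y [Oy /= sy]; rewrite rf.2 //.
have -> : \row_i (P i).@[hcoord y] = s.@[hcoord y] *: \row_i (p i).@[hcoord y].
  by apply/rowP => i; rewrite !mxE PE mevalM.
apply/eqP; rewrite eqEsubv; apply/andP; split; rewrite -memvE; apply/vlineP.
  by exists s.@[hcoord y].
by exists (s.@[hcoord y])^-1; rewrite scalerA mulVf // scale1r.
Qed.

(** Two representations are proportional, so coprimality of the one makes the other a multiple of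
    it, of at least the same degree; then exchange the roles. *)
Lemma has_degree_unique (f : bir Pn) d d' : has_degree f d -> has_degree f d' -> d = d'.
Proof.
suff H e e' : has_degree f e -> has_degree f e' -> (e <= e')%N.
  by move=> fd fd'; apply/eqP; rewrite eqn_leq !H.
move=> [p [hp cop [g fg pg]]] [p' [hp' cop' [g' fg' pg']]].
have gg' : bir_class g = bir_class g' by rewrite -fg.
have [og dg _ _] := bfunP g; have [og' dg' _ _] := bfunP g'.
have rg : rep_on (bfun g) (bdom g) e p by [].
have rg' : rep_on (bfun g') (bdom g') e' p' by [].
have W0 := proj_open_meet og og' (proj_dense_neq0 dg) (proj_dense_neq0 dg').
have pp' := rep_proportional rg rg' (openI og og') W0 (fun _ H => H.1) (fun _ H => H.2)
  (fun x H => (bir_class_eq g g').1 gg' x H.1 H.2).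
have [x [gx g'x]] := W0.
have [i pi] := rep_nonzero rg gx; have [j p'j] := rep_nonzero rg' g'x.
have [s sE] := coprime_family_proportional cop pi pp'.
have nz : s * p j != 0 by rewrite -sE.
have hsp : s * p j \is e'.-homog by rewrite -sE.
have [k [l [<- _ hpj]]] := homog_factors nz hsp.
have pj : p j != 0 by apply: contraNneq nz => ->; rewrite mulr0.
by rewrite (dhomog_uniq pj (hp j) hpj) leq_addl.
Qed.

Lemma degE (f : bir Pn) d : has_degree f d -> deg f = d.
Proof.
move=> fd; apply: (has_degree_unique (f := f)) => //.
by rewrite /deg; case: xgetP => [y _ //|/(_ d)].
Qed.

Lemma birP (f : bir Pn) : exists g, f = bir_class g.
Proof. by exists (repr f); rewrite /bir_class reprK. Qed.

Lemma deg_has_degree (f : bir Pn) : has_degree f (deg f).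
Proof.
have [g ->] := birP f; have [og dg mg _] := bfunP g; have [x gx] := proj_dense_neq0 dg.
have [O [d [P [oO Ox OA rf]]]] := morphism_rep og mg gx.
have [d' _ hd'] := has_degree_rep oO (ex_intro _ x Ox) OA rf.
by rewrite (degE hd').
Qed.

End ProjectiveSpace.

(** * Families of birational maps *)

Section AffineSpace.
Variables (K : closedFieldType) (N : nat).
Local Notation AN := (affine_space K N).

Lemma aff_open_nbhs (O : set AN) x : open O -> O x ->
  exists2 p : {mpoly K[N]}, p.@[x 0] != 0 & forall y : AN, p.@[y 0] != 0 -> O y.
Proof.
move=> [P OP] Ox; have : ~ aff_zeros P x by rewrite -OP.
move=> /existsNP[p /not_implyP[Pp px]]; exists p; first exact/eqP.
move=> y py; apply: contrapT => Oy; have : aff_zeros P y by rewrite -OP.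
by move=> /(_ p Pp) /eqP; rewrite (negPf py).
Qed.

Lemma aff_open_neq0 (p : {mpoly K[N]}) : open [set x : AN | p.@[x 0] != 0].
Proof.
exists [set p]; apply/seteqP; split=> x /=; first by move=> /negP/negPn/eqP px _ ->.
by move=> /(_ p erefl) ->; rewrite eqxx.
Qed.

End AffineSpace.

Section Charts.
Variables (K : closedFieldType) (T : fun_space K).

Lemma variety_chart (t : T) : is_variety T ->
  exists (V : set T) (P : set (T -> K)), [/\ open V, V t, has_forms V (fun=> P) &
    forall G, P G -> open [set z | V z /\ G z != 0]].
Proof.
move=> [_ [m [Vs [aV cV]] _]].
have [i _ Vt] : (\bigcup_i Vs i) t by rewrite cV.
have [oV [N [Z [cZ [phi [mphi [psi [mpsi psiK phiK]]]]]]]] := aV i.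
have [phiZ cphi _] := mphi; have [psiV cpsi pullpsi] := mpsi.
pose P := [set G | exists p : {mpoly K[N]}, G = fun z => p.@[phi z 0]].
exists (Vs i), P; split=> //; last first.
  move=> _ [p ->]; rewrite (_ : [set z | _] = phi @^-1` [set x : affine_space K N | p.@[x 0] != 0] `&` Vs i).
    by apply: (within_open_continuousP _ oV).1 => //; apply: aff_open_neq0.
  by rewrite setIC.
have nbhsP U z : open U -> U z -> Vs i z ->
    exists2 p : {mpoly K[N]}, p.@[phi z 0] != 0 & forall y, Vs i y -> p.@[phi y 0] != 0 -> U y.
  move=> oU Uz Vz; have [O oO OE] := (within_continuousP _ _).1 cpsi U oU.
  have [Opz _] : (O `&` Z) (phi z) by rewrite OE; split; [rewrite /= psiK|exact: phiZ].
  have [p pz pO] := aff_open_nbhs oO Opz; exists p => // y Vy py.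
  have [] : (psi @^-1` U `&` Z) (phi y) by rewrite -OE; split; [exact: pO|exact: phiZ].
  by rewrite /= psiK.
split.
- by move=> c; exists c%:MP; apply/funext => z; rewrite mevalC.
- by move=> _ _ _ [p ->] [q ->]; exists (p + q); apply/funext => z; rewrite mevalD.
- by move=> _ _ _ _ [p ->] [q ->]; exists (p * q); apply/funext => z; rewrite mevalM.
- move=> U z oU Uz Vz; have [p pz pU] := nbhsP U z oU Uz Vz.
  by exists 0, (fun z => p.@[phi z 0]); split=> //; exists p.
move=> U f z oU rf Uz Vz.
have [O [h [oO Oz rh hE]]] : exists O h, [/\ open O, O (phi z), reg O h &
    forall y, Z y -> O y -> h y = f (psi y)].
  by apply: (pullpsi U f oU rf (phi z)); [exact: phiZ|rewrite psiK].
have [p [q [qz hpq]]] := rh _ Oz.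
have [r rz rO] := aff_open_nbhs oO Oz.
exists 0, (fun z => (p * r).@[phi z 0]), (fun z => (q * r).@[phi z 0]); split.
- by exists (p * r).
- by exists (q * r).
- by rewrite mevalM mulf_neq0.
move=> y Vy; rewrite !mevalM mulf_eq0 negb_or => /andP[qy ry].
have Oy := rO _ ry.
rewrite -[y in LHS]psiK // -hE //; last exact: phiZ.
by rewrite hpq // -mulf_div divff // mulr1.
Qed.
End Charts.

Section Families.
Variables (K : closedFieldType) (n : nat) (T : fun_space K).
Local Notation Pn := (projective_space K n).
Hypothesis vT : is_variety T.
Variable phi : pseudo_aut Pn T.

(** [N] is an equation for a neighbourhood on which the [F i] represent the family. Both of its
    slices are used: with [x] fixed it shrinks the parameter space, with [t] fixed it gives the open
    set of points where the map at [t] is represented. *)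
Lemma family_local_rep t0 x0 : pa_dom phi (t0, x0) ->
  exists (V : set T) (P : set (T -> K)) d (F : 'I_n.+1 -> prod_space T Pn -> K) N,
  [/\ [/\ V t0, has_forms V (fun=> P) & forall G, P G -> open [set z | V z /\ G z != 0]],
      forall i, prod_form P (@proj_form K n) d (F i),
      (forall x, P (fun t => N (t, x))) /\ (forall t, open [set x : Pn | N (t, x) != 0]),
      N (t0, x0) != 0 &
      forall t x, V t -> N (t, x) != 0 -> pa_dom phi (t, x) /\
         val (pa_fun phi (t, x) : proj_pt K n) = <[\row_i F i (t, x)]>%VS].
Proof.
move=> dom0; have [V [P [oV Vt fT oP]]] := variety_chart t0 vT.
have [oD dD _ _] := pa_bir phi.
have fm := prod_has_forms fT (proj_has_forms K n).
have [d [F [e [N [FF FN Nz NE]]]]] :=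
  local_projective_rep fm oD (pa_mor phi) dom0 (conj Vt I).
exists V, P, d, F, N; split=> //.
- split=> [x|t]; first exact: (prod_form_slice_right fT x FN).
  have [q hq NtE] := prod_form_slice_left (proj_has_forms K n) t FN.
  rewrite (_ : [set x | _] = [set x : Pn | q.@[hcoord x] != 0]); first exact: proj_open_neq0 hq.
  by apply/seteqP; split=> x /=; rewrite -(congr1 (fun f => f x) NtE).
- by move=> t x Vt' Nt; apply: NE.
Qed.

(** Fix one point [x0]. As long as [N (t, x0)] is nonzero, forms of the fixed degree [d] represent
    the map at [t] on a nonempty open set. *)
Lemma family_degree_bound t0 : exists D O,
  [/\ open O, O t0 & forall t, O t -> (deg (pa_map phi t) <= D)%N].
Proof.
have [od dd _ _] := pa_fib phi t0.
have [x0 dom0] := proj_dense_neq0 dd.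
have [V [P [d [F [N [[Vt fT oP] FF [Nx Nt] N0 NE]]]]]] := family_local_rep dom0.
exists d, [set t | V t /\ N (t, x0) != 0]; split=> //; first exact: (oP _ (Nx x0)).
move=> t [Vt' Nt0].
have /choice[Q QE] : forall i, exists p : {mpoly K[n.+1]}, p \is d.-homog /\
    (fun x => F i (t, x)) = fun x => p.@[hcoord x].
  move=> i; have [p hp FE] := prod_form_slice_left (proj_has_forms K n) t (FF i).
  by exists p.
have rep : rep_on (bfun (BirMap (pa_fib phi t))) [set x : Pn | N (t, x) != 0] d Q.
  split=> [i|x Nx0]; first by have [] := QE i.
  have [_ /= ->] := NE t x Vt' Nx0; congr (<[_]>)%VS; apply/rowP => i; rewrite !mxE.
  by have [_ /(congr1 (fun f => f x))] := QE i.
have [||d' d'd hd'] := has_degree_rep (Nt t) _ _ rep.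
- by exists x0.
- by move=> x Nx0; have [] := NE t x Vt' Nx0.
by rewrite (degE hd').
Qed.

(** Different classes differ at some common point [x1] of their domains, so a minor of the two image
    vectors is nonzero. With [x1] fixed, this minor depends on [t] through [P] and stays nonzero
    near [t0]. *)
Lemma family_neq_nbhs t0 (g : bir Pn) : pa_map phi t0 <> g ->
  exists O, [/\ open O, O t0 & forall t, O t -> pa_map phi t <> g].
Proof.
have [g0 ->] := birP g => /bir_class_eq/existsNP[x1 /not_implyP[/= dom1 /not_implyP[gx1 neq]]].
have [V [P [d [F [N [[Vt fT oP] FF [Nx Nt] N0 NE]]]]]] := family_local_rep dom1.
pose y := hcoord (bfun g0 x1).
have [dom0 val0] := NE t0 x1 Vt N0.
have /line_proportional[[k Fk] h0] := val0.
have [i [j nij]] : exists i j, F i (t0, x1) * y j - F j (t0, x1) * y i != 0.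
  apply: contrapT => nij; apply: neq; apply: proj_eq.
  apply: (@proportional_trans _ _ (fun i => F i (t0, x1)) _ _ k Fk h0) => i j.
  apply/eqP; rewrite -subr_eq0; apply: contrapT => /negP ij.
  by apply: nij; exists i, j.
pose G t := N (t, x1) * (F i (t, x1) * y j + F j (t, x1) * - y i).
have PG : P G.
  apply: (formM fT (d := 0) (e := 0)); first exact: Nx.
  by apply: (formD fT (d := 0)); apply: (formM fT (d := 0) (e := 0));
    [exact: (prod_form_slice_right fT x1 (FF _))|exact: (form_cst fT)|
     exact: (prod_form_slice_right fT x1 (FF _))|exact: (form_cst fT)].
exists [set t | V t /\ G t != 0]; split; first exact: oP.
  by split=> //; rewrite /G mulrN mulf_neq0.
move=> t [Vt' Gt] /bir_class_eq/(_ x1) /=.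
move: Gt; rewrite /G mulf_eq0 negb_or mulrN => /andP[Nt1 nt].
have [domt valt] := NE t x1 Vt' Nt1.
move=> /(_ domt gx1) eqt; rewrite eqt in valt.
have /line_proportional[_ ht] := valt.
by move: nt; rewrite [X in X - _]mulrC (ht j i) mulrC subrr eqxx.
Qed.

End Families.

Lemma closed_of_deg_to_infty (K : closedFieldType) (n : nat) (f : nat -> bir (projective_space K n)) :
  deg (f m) @[m --> \oo] --> \oo -> closed (range f).
Proof.
move=> degf; apply/closed_birE => T vT phi; rewrite -openC; apply: open_local => t0 nf.
have [D [O [oO Ot0 OD]]] := family_degree_bound vT phi t0.
have /degf[M _ MD] : nbhs \oo [set d | (D < d)%N] by exists D.+1.
have neq m : pa_map phi t0 <> f m by move=> e; apply: nf; exists m.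
have /choice[W WE] : forall m, exists W, [/\ open W, W t0 & forall t, W t -> pa_map phi t <> f m].
  by move=> m; apply: family_neq_nbhs vT _ _ _ (neq m).
have [B [oB Bt BE]] : exists B, [/\ open B, B t0 & forall t m, B t -> (m < M)%N -> pa_map phi t <> f m].
  elim: M {MD} => [|M [B [oB Bt BE]]]; first by exists setT; split=> //; exact: openT.
  have [oW Wt Wneq] := WE M.
  exists (B `&` W M); split=> //; first exact: openI.
  move=> t m [Bt' Wt']; rewrite ltnS leq_eqVlt => /orP[/eqP ->|]; first exact: Wneq.
  exact: BE.
exists (O `&` B); split=> //; first exact: openI.
move=> t [Ot Bt'] [m _ fm]; have [mM|Mm] := ltnP m M; first exact: (BE t m Bt' mM).
have := OD t Ot; rewrite -fm leqNgt => /negP; apply; exact: MD.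
Qed.

(** * Closed subvarieties of affine space *)

Section ClosedSubvariety.
Variables (K : closedFieldType) (N : nat) (Z : set (affine_space K N)).
Local Notation AN := (affine_space K N).

Definition closed_pt : Type := {x : AN | Z x}.
HB.instance Definition _ := gen_eqMixin closed_pt.
HB.instance Definition _ := gen_choiceMixin closed_pt.

Definition closed_op (U : set closed_pt) : Prop :=
  exists2 O : set AN, open O & U = [set x | O (sval x)].

Fact closed_opT : closed_op setT.
Proof. by exists setT; [exact: openT|]. Qed.

Fact closed_opI : setI_closed closed_op.
Proof. by move=> _ _ [O oO ->] [O' oO' ->]; exists (O `&` O') => //; exact: openI. Qed.

Fact closed_op_bigU (I : Type) (U : I -> set closed_pt) :
  (forall i, closed_op (U i)) -> closed_op (\bigcup_i U i).
Proof.
move=> H; have /choice[O OE] : forall i, exists O : set AN, open O /\ U i = [set x | O (sval x)].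
  by move=> i; have [O oO ->] := H i; exists O.
exists (\bigcup_i O i); first by apply: bigcup_open => i _; have [] := OE i.
apply/seteqP; split=> x [i _ xi]; exists i => //.
  by move: xi; have [_ ->] := OE i.
by have [_ ->] := OE i.
Qed.

HB.instance Definition _ :=
  isOpenTopological.Build closed_pt closed_opT closed_opI closed_op_bigU.

Definition closed_reg (U : set closed_pt) : set (closed_pt -> K) :=
  [set f | forall x, U x -> exists p q : {mpoly K[N]}, q.@[sval x 0] != 0 /\
     forall y, U y -> q.@[sval y 0] != 0 -> f y = p.@[sval y 0] / q.@[sval y 0]].

Definition closed_subspace : fun_space K := Space closed_reg.

Definition closed_form : set (closed_subspace -> K) :=
  [set G | exists p : {mpoly K[N]}, G = fun z : closed_subspace => p.@[sval z 0]].

Lemma closed_pt_inj (x y : closed_subspace) : sval x = sval y -> x = y.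
Proof. by case: x y => [x Zx] [y Zy] /= e; apply: eq_exist. Qed.

Lemma closed_open_nbhs (U : set closed_subspace) x : open U -> U x ->
  exists2 p : {mpoly K[N]}, p.@[sval x 0] != 0 & forall y : closed_subspace, p.@[sval y 0] != 0 -> U y.
Proof.
by move=> [O oO ->] /(aff_open_nbhs oO)[p px pO]; exists p => // y; apply: pO.
Qed.

Lemma closed_subspace_has_forms : has_forms setT (fun=> closed_form).
Proof.
split.
- by move=> c; exists c%:MP; apply/funext => z; rewrite mevalC.
- by move=> _ _ _ [p ->] [q ->]; exists (p + q); apply/funext => z; rewrite mevalD.
- by move=> _ _ _ _ [p ->] [q ->]; exists (p * q); apply/funext => z; rewrite mevalM.
- move=> U z oU Uz _; have [p pz pU] := closed_open_nbhs oU Uz.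
  by exists 0, (fun z : closed_subspace => p.@[sval z 0]); split=> //; [exists p|move=> y _; apply: pU].
move=> U f z oU rf Uz _; have [p [q [qz fE]]] := rf z Uz.
have [r rz rU] := closed_open_nbhs oU Uz.
exists 0, (fun z : closed_subspace => (p * r).@[sval z 0]), (fun z : closed_subspace => (q * r).@[sval z 0]); split.
- by exists (p * r).
- by exists (q * r).
- by rewrite mevalM mulf_neq0.
move=> y _; rewrite !mevalM mulf_eq0 negb_or => /andP[qy ry].
by rewrite (fE y (rU _ ry) qy) -mulf_div divff // mulr1.
Qed.

Lemma closed_subspace_forms_generate : forms_generate setT (fun=> closed_form).
Proof.
split=> [_ _ [p ->]|_ _ _ [p ->] [q ->] x [_ qx]]; last by exists p, q; split=> // y [].
exists [set x : AN | p.@[x 0] != 0]; first exact: aff_open_neq0.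
by apply/seteqP; split=> x //= -[].
Qed.

Lemma closed_subspace_is_variety (z0 : closed_subspace) : closed Z -> is_variety closed_subspace.
Proof.
move=> cZ; split.
- move=> U f oU; split=> [rf x Ux|H x Ux].
    by exists U, f; split.
  have [V [g [oV Vx rg fg]]] := H x Ux.
  have [p [q [qx gE]]] := rg x Vx; have [r rx rV] := closed_open_nbhs oV Vx.
  exists (p * r), (q * r); split; first by rewrite mevalM mulf_neq0.
  move=> y Uy; rewrite !mevalM mulf_eq0 negb_or => /andP[qy ry].
  have Vy := rV _ ry.
  by rewrite fg // gE // -mulf_div divff // mulr1.
- exists 1, (fun=> setT); split; last by apply/seteqP; split=> // x _; exists ord0.
  move=> _; split; first exact: openT.
  exists N, Z; split=> //; exists (fun z : closed_subspace => (sval z : AN)); split.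
    split.
    + by move=> x _; apply: (svalP x).
    + apply/within_continuousP => O oO; exists [set x : closed_subspace | O (sval x)] => //.
      by exists O.
    move=> V g oV rg x _ Vx.
    exists [set x : closed_subspace | V (sval x)], (fun x => g (sval x)); split=> //.
      by exists V.
    by move=> y Vy; have [p [q [qy gE]]] := rg _ Vy; exists p, q; split=> // w; apply: gE.
  (* Maps are total functions, so the inverse takes the default value [z0] off [Z]. *)
  pose psi (y : AN) : closed_subspace := if pselect (Z y) is left p then exist _ y p else z0.
  have psiE y : Z y -> sval (psi y) = y by rewrite /psi; case: pselect.
  exists psi; split.
  + split=> //.
    * apply/within_continuousP => _ [O oO ->]; exists O => //.
      by apply/seteqP; split=> y [Oy Zy]; split=> //; move: Oy; rewrite /= psiE.
    * move=> V g oV rg x Zx Vx; have [p [q [qx gE]]] := rg _ Vx.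
      have [r rx rV] := closed_open_nbhs oV Vx; rewrite psiE // in qx rx.
      exists [set y : AN | (q * r).@[y 0] != 0], (fun y : AN => p.@[y 0] / q.@[y 0]); split.
      - exact: aff_open_neq0.
      - by rewrite /= mevalM mulf_neq0.
      - move=> y /=; rewrite mevalM mulf_eq0 negb_or => /andP[qy _].
        by exists p, q; split.
      - move=> y Zy /=; rewrite mevalM mulf_eq0 negb_or => /andP[qy ry].
        by rewrite gE ?psiE //; apply: rV; rewrite psiE.
  + move=> x _; apply: closed_pt_inj; exact/psiE/svalP.
  + exact: psiE.
rewrite -openC; apply: open_local => z /= nz.
have [i ni] : exists i, sval z.1 0 i != sval z.2 0 i.
  apply: contrapT => /forallNP H; apply: nz; apply: closed_pt_inj; apply/rowP => i.
  by apply/eqP; apply: contrapT => /negP; apply: H.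
have fm := closed_subspace_has_forms; have fg := closed_subspace_forms_generate.
pose X : {mpoly K[N]} := 'X_i.
have FG : prod_form closed_form (fun=> closed_form) 0
    (fun z : prod_space closed_subspace closed_subspace => X.@[sval z.1 0] + (- X).@[sval z.2 0]).
  apply: prod_formD.
    by apply: (prod_form_left fm (f := fun z : closed_subspace => X.@[sval z 0])); exists X.
  by apply: (prod_form_right fm (g := fun z : closed_subspace => (- X).@[sval z 0])); exists (- X).
have oG := form_open (prod_forms_generate fm fg fg openT) FG.
eexists; split; first exact: oG.
  by split=> //=; rewrite mevalN !mevalXU subr_eq0.
move=> y [_]; rewrite mevalN !mevalXU subr_eq0 => + /= e.
by rewrite e eqxx.
Qed.
End ClosedSubvariety.

(** * Pairs of inverse polynomial maps *)

Section FormComposition.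
Variables (K : closedFieldType) (S : fun_space K) (V : set S) (Fm : nat -> set (S -> K)).
Hypothesis fm : has_forms V Fm.
Hypothesis form0 : forall d, Fm d (fun=> 0).

Lemma formX d w k : Fm d w -> Fm (d * k)%N (fun z => w z ^+ k).
Proof.
move=> Fw; elim: k => [|k IH].
  by rewrite muln0 (_ : (fun z => _) = fun=> 1); [exact: form_cst fm 1|apply/funext].
rewrite mulnS (_ : (fun z => _) = fun z => w z * w z ^+ k); first exact: (formM fm).
by apply/funext => z; rewrite exprS.
Qed.

Lemma form_monomial k (w : 'I_k -> S -> K) d (m : 'X_{1..k}) : (forall i, Fm d (w i)) ->
  Fm (d * mdeg m)%N (fun z => \prod_i w i z ^+ m i).
Proof.
move=> Fw; rewrite mdegE.
elim: (index_enum _) => [|i r IH].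
  rewrite big_nil muln0 (_ : (fun z => _) = fun=> 1); first exact: form_cst fm 1.
  by apply/funext => z; rewrite big_nil.
rewrite big_cons mulnDr (_ : (fun z => _) = fun z => w i z ^+ m i * \prod_(j <- r) w j z ^+ m j).
  by apply: (formM fm) => //; apply: formX.
by apply/funext => z; rewrite big_cons.
Qed.

Lemma form_sum (I : Type) (r : seq I) (Q : pred I) (G : I -> S -> K) d :
  (forall i, Q i -> Fm d (G i)) -> Fm d (fun z => \sum_(i <- r | Q i) G i z).
Proof.
move=> FG; elim: r => [|i r IH].
  by rewrite (_ : (fun z => _) = fun=> 0) //; apply/funext => z; rewrite big_nil.
have [Qi|nQi] := boolP (Q i); last first.
  by rewrite (_ : (fun z => _) = fun z => \sum_(j <- r | Q j) G j z) //;
    apply/funext => z; rewrite big_cons (negPf nQi).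
rewrite (_ : (fun z => _) = fun z => G i z + \sum_(j <- r | Q j) G j z).
  by apply: (formD fm) => //; apply: FG.
by apply/funext => z; rewrite big_cons Qi.
Qed.

Lemma form_comp k (w : 'I_k -> S -> K) d e (G : {mpoly K[k]}) : (forall i, Fm d (w i)) ->
  G \is e.-homog -> Fm (d * e)%N (fun z => G.@[w^~ z]).
Proof.
move=> Fw /dhomogP hG.
rewrite (_ : (fun z => _) = fun z => \sum_(m <- msupp G | m \in msupp G) G@_m * \prod_i w i z ^+ m i).
  apply: form_sum => m /hG <-.
  exact: (formM fm (form_cst fm G@_m) (form_monomial m Fw)).
by apply/funext => z; rewrite mevalE big_seq.
Qed.
End FormComposition.

Section InversePair.
Variables (K : closedFieldType) (n : nat).
Local Notation Pn := (projective_space K n).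
Local Notation vec := ('I_n.+1 -> K).
Local Notation polys := ('I_n.+1 -> {mpoly K[n.+1]}).

Definition evals (p : polys) (v : vec) : vec := fun i => (p i).@[v].

Lemma evals_scale p d c (v : vec) : (forall i, p i \is d.-homog) ->
  evals p (fun i => c * v i) = fun i => c ^+ d * evals p v i.
Proof. by move=> hp; apply/funext => i; apply: meval_dhomog. Qed.

(** The set where [p] and the composite of [q] after [p] are nonzero. It is chosen so that [p] and
    [q] exchange [inverse_dom p q] and [inverse_dom q p]. *)
Definition inverse_dom (p q : polys) (x : Pn) : Prop :=
  (exists i, evals p (hcoord x) i != 0) /\ (exists j, evals q (evals p (hcoord x)) j != 0).

(** A system of polynomial equations in the coefficients, satisfied trivially where the composite
    vanishes; [inverse_dom] supplies the nonvanishing. *)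
Definition left_inverse (q p : polys) := forall v, proportional (evals q (evals p v)) v.

Definition proj_map (p : polys) (x : Pn) : Pn := mkproj (evals p (hcoord x)).

(** From [q (p x) = r x] with [r] nonzero, homogeneity gives [p (q (p x)) = r^d p x], which is
    nonzero as well. *)
Lemma inverse_domP p q d e x : (forall i, p i \is d.-homog) -> (forall i, q i \is e.-homog) ->
  left_inverse q p -> inverse_dom p q x ->
  inverse_dom q p (proj_map p x) /\ proj_map q (proj_map p x) = x.
Proof.
move=> hp hq qp [[i pi] [j qj]].
have [c c0 yE] := hcoord_mkproj pi; have {}yE := funext yE.
have qE : evals q (hcoord (proj_map p x)) = fun i => c ^+ e * evals q (evals p (hcoord x)) i.
  by rewrite yE (evals_scale _ _ hq).
have [k xk] := hcoord_neq0 x.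
have [r r0 rE] := proportionalP qj xk (qp (hcoord x)).
have qj' : evals q (hcoord (proj_map p x)) j != 0 by rewrite qE mulf_neq0 // expf_neq0.
split; last first.
  apply: (mkproj_hcoord qj') => a b; rewrite qE !rE; ring.
split; first by exists j.
exists i; rewrite qE (evals_scale _ _ hp) (funext rE) (evals_scale _ _ hp).
by rewrite !mulf_neq0 // !expf_neq0.
Qed.

Lemma birational_of_inverse (S : fun_space K) (A B : set S) (f g : S -> S) :
  open A -> dense A -> open B -> dense B -> morphism_on A B f -> morphism_on B A g ->
  (forall x, A x -> g (f x) = x) -> (forall x, B x -> f (g x) = x) -> birational_on A f.
Proof.
move=> oA dA oB dB mf mg gf fg; split=> //; first exact: (morphism_on_sub mf).
by exists A, B; split=> //; split=> //; split=> //; exists g.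
Qed.

Lemma proj_form0 d : @proj_form K n d (fun=> 0).
Proof. by exists 0; [exact: rpred0|apply/funext => x; rewrite meval0]. Qed.

Lemma evals_form p d i : (forall i, p i \is d.-homog) -> proj_form d (fun x : Pn => evals p (hcoord x) i).
Proof. by move=> hp; exists (p i). Qed.

Lemma inverse_dom_open p q d e : (forall i, p i \is d.-homog) -> (forall i, q i \is e.-homog) ->
  open (inverse_dom p q).
Proof.
move=> hp hq; apply: open_local => x [[i pi] [j qj]].
have FG := formM (proj_has_forms K n) (evals_form i hp)
  (form_comp (proj_has_forms K n) proj_form0 (fun i => evals_form i hp) (hq j)).
eexists; split; first exact: (form_open (proj_forms_generate K n) FG).
  by split=> //=; rewrite mulf_neq0.
move=> y [_]; rewrite /= mulf_eq0 negb_or => /andP[pi' qj'].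
by split; [exists i|exists j].
Qed.

Lemma proj_map_morphism p q d e : (forall i, p i \is d.-homog) -> (forall i, q i \is e.-homog) ->
  left_inverse q p -> morphism_on (inverse_dom p q) (inverse_dom q p) (proj_map p).
Proof.
move=> hp hq qp.
have /choice[c cE] : forall x : Pn, exists c, inverse_dom p q x ->
    c != 0 /\ hcoord (proj_map p x) = fun i => c * evals p (hcoord x) i.
  move=> x; have [[[i pi] _]|nx] := pselect (inverse_dom p q x); last by exists 0.
  by have [c c0 cE] := hcoord_mkproj pi; exists c => _; split=> //; apply/funext.
apply: (@pullback_morphism K Pn Pn setT (@proj_form K n) setT (@proj_form K n) _ _ _ c d) => //.
- exact: proj_has_forms.
- exact: proj_forms_generate.
- exact: proj_has_forms.
- exact: inverse_dom_open hp hq.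
- by move=> x /(inverse_domP hp hq qp)[].
- by move=> x /cE[].
move=> m _ [G hG ->]; exists (fun x : Pn => G.@[evals p (hcoord x)]).
  exact: (form_comp (proj_has_forms K n) proj_form0 (fun i => evals_form i hp) hG).
by move=> x /cE[_ ->]; rewrite (meval_dhomog _ _ hG).
Qed.

Lemma proj_map_birational p q d e : (forall i, p i \is d.-homog) -> (forall i, q i \is e.-homog) ->
  left_inverse q p -> left_inverse p q -> inverse_dom p q !=set0 ->
  birational_on (inverse_dom p q) (proj_map p).
Proof.
move=> hp hq qp pq [x dx].
have [dy _] := inverse_domP hp hq qp dx.
apply: (@birational_of_inverse _ _ (inverse_dom q p) _ (proj_map q)).
- exact: inverse_dom_open hp hq.
- by apply: proj_dense; [exact: inverse_dom_open hp hq|exists x].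
- exact: inverse_dom_open hq hp.
- by apply: proj_dense; [exact: inverse_dom_open hq hp|exists (proj_map p x)].
- exact: proj_map_morphism hp hq qp.
- exact: proj_map_morphism hq hp pq.
- by move=> z /(inverse_domP hp hq qp)[].
- by move=> z /(inverse_domP hq hp pq)[].
Qed.

Lemma proj_map_rep p d (O : set Pn) : (forall i, p i \is d.-homog) ->
  (forall x, O x -> exists i, evals p (hcoord x) i != 0) -> rep_on (proj_map p) O d p.
Proof. by move=> hp Op; split=> // x /Op[i pi]; rewrite (mkprojE pi). Qed.

End InversePair.

(** * Families of maps whose coefficients are polynomial in the parameter *)

Section CoefficientFamilies.
Variables (K : closedFieldType) (n N : nat) (Z : set (affine_space K N)).
Local Notation Pn := (projective_space K n).
Local Notation T := (closed_subspace Z).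
Local Notation S := (prod_space T Pn).
Local Notation PF := (prod_form (@closed_form K N Z) (@proj_form K n)).
Local Notation region := (prod_region [set: T] [set: Pn]).

Definition coef_family d (p : 'rV[K]_N -> {mpoly K[n.+1]}) :=
  exists a : 'X_{1..n.+1 < d.+1} -> {mpoly K[N]},
    forall t, p t = \sum_(m : 'X_{1..n.+1 < d.+1} | mdeg m == d) (a m).@[t 0] *: 'X_[m].

Lemma coef_family_homog d p t : coef_family d p -> p t \is d.-homog.
Proof.
move=> [a ->]; apply: rpred_sum => m md; apply: rpredZ.
by rewrite dhomogX.
Qed.

Let fm : has_forms region PF :=
  prod_has_forms (closed_subspace_has_forms Z) (proj_has_forms K n).

Let fg : forms_generate region PF :=
  prod_forms_generate (closed_subspace_has_forms Z) (closed_subspace_forms_generate Z)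
    (proj_forms_generate K n) openT.

Let PF0 d : PF d (fun=> 0).
Proof.
rewrite (_ : (fun=> 0) = fun z : S => 0 * 0); last by apply/funext => z; rewrite mulr0.
apply: (prod_form_tensor (f := fun=> 0) (g := fun=> 0)); last exact: proj_form0.
by exists 0; apply/funext => z; rewrite meval0.
Qed.

Lemma coef_family_comp e q (w : 'I_n.+1 -> S -> K) d : coef_family e q ->
  (forall i, PF d (w i)) -> PF (d * e)%N (fun z => (q (sval z.1)).@[w^~ z]).
Proof.
move=> [b qE] Fw.
rewrite (_ : (fun z => _) = fun z : S => \sum_(m : 'X_{1..n.+1 < e.+1} | mdeg m == e)
    (b m).@[(sval z.1 : 'rV[K]_N) 0] * \prod_i w i z ^+ m i).
  apply: (form_sum fm PF0) => m /eqP me.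
  apply: (@formM _ _ _ _ fm 0); last by have := form_monomial fm m Fw; rewrite me.
  apply: (prod_form_left (proj_has_forms K n) (f := fun z : T => (b m).@[(sval z : 'rV[K]_N) 0])).
  by exists (b m).
apply/funext => z; rewrite qE rmorph_sum /=; apply: eq_bigr => m _.
by rewrite mevalZ mevalX.
Qed.

Lemma coef_family_form d p : coef_family d p -> PF d (fun z => (p (sval z.1)).@[hcoord z.2]).
Proof.
move=> pF; have Fw i : PF 1 (fun z => hcoord z.2 i).
  apply: (prod_form_right (closed_subspace_has_forms Z) (g := fun x : Pn => hcoord x i)).
  exists 'X_i; first by rewrite dhomogX /= mdeg1.
  by apply/funext => x; rewrite mevalXU.
by have := coef_family_comp pF Fw; rewrite mul1n.
Qed.

Implicit Types (p q : 'rV[K]_N -> 'I_n.+1 -> {mpoly K[n.+1]}).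

Definition family_dom p q : set S := [set z | inverse_dom (p (sval z.1)) (q (sval z.1)) z.2].

Lemma family_dom_open p q d e : (forall i, coef_family d (p^~ i)) ->
  (forall i, coef_family e (q^~ i)) -> open (family_dom p q).
Proof.
move=> hp hq; apply: open_local => z [[i pi] [j qj]].
have Fw i := coef_family_form (hp i).
have FG := formM fm (Fw i) (coef_family_comp (hq j) Fw).
eexists; split; first exact: (form_open fg FG).
  by split=> //=; rewrite mulf_neq0.
move=> y [_]; rewrite /= mulf_eq0 negb_or => /andP[pi' qj'].
by split; [exists i|exists j].
Qed.

Lemma family_scale p q : exists c : S -> K, forall z, family_dom p q z ->
  c z != 0 /\ hcoord (proj_map (p (sval z.1)) z.2) = fun i => c z * evals (p (sval z.1)) (hcoord z.2) i.
Proof.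
suff H (z : S) : exists c, family_dom p q z ->
    c != 0 /\ hcoord (proj_map (p (sval z.1)) z.2) = fun i => c * evals (p (sval z.1)) (hcoord z.2) i.
  by have [c cE] := choice H; exists c.
have [[[i pi] _]|nz] := pselect (family_dom p q z); last by exists 0.
by have [c c0 cE] := hcoord_mkproj pi; exists c => _; split=> //; apply/funext.
Qed.

Lemma family_map_morphism p q d e : (forall i, coef_family d (p^~ i)) ->
  (forall i, coef_family e (q^~ i)) ->
  morphism_on (family_dom p q) setT (fun z : S => proj_map (p (sval z.1)) z.2).
Proof.
move=> hp hq; have [c cE] := family_scale p q.
apply: (@pullback_morphism K S Pn region PF setT (@proj_form K n) _ _ _ c d) => //.
- exact: proj_has_forms.
- exact: family_dom_open hp hq.
- by move=> z /cE[].
move=> m _ [G hG ->]; exists (fun z => G.@[evals (p (sval z.1)) (hcoord z.2)]).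
  exact: (form_comp fm PF0 (fun i => coef_family_form (hp i)) hG).
by move=> z /cE[_ ->]; rewrite (meval_dhomog _ _ hG).
Qed.

Lemma family_morphism p q d e : (forall i, coef_family d (p^~ i)) ->
  (forall i, coef_family e (q^~ i)) -> (forall t : T, left_inverse (q (sval t)) (p (sval t))) ->
  morphism_on (family_dom p q) (family_dom q p) (fun z : S => (z.1, proj_map (p (sval z.1)) z.2) : S).
Proof.
move=> hp hq qp; have [c cE] := family_scale p q.
apply: (@pullback_morphism K S S region PF region PF _ _ _ c d) => //.
- exact: family_dom_open hp hq.
- move=> z dz; have [] // := inverse_domP (fun i => coef_family_homog (sval z.1) (hp i))
    (fun i => coef_family_homog (sval z.1) (hq i)) (qp z.1) dz.
- by move=> z /cE[].
move=> m G'; elim=> [f g Pf [G hG ->]|G1 G2 _ [H1 FH1 E1] _ [H2 FH2 E2]]; last first.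
  exists (fun z => H1 z + H2 z); first exact: (formD fm).
  by move=> z dz; rewrite E1 // E2 // mulrDr.
exists (fun z => f z.1 * G.@[evals (p (sval z.1)) (hcoord z.2)]).
  apply: (@formM _ _ _ _ fm 0); first exact: (prod_form_left (proj_has_forms K n) Pf).
  exact: (form_comp fm PF0 (fun i => coef_family_form (hp i)) hG).
by move=> z /cE[_ /= ->]; rewrite (meval_dhomog _ _ hG) mulrCA.
Qed.

(** Density is checked in one fibre: an open set around [z] contains a nonempty open part of the
    fibre through [z], which meets the domain there because projective space is irreducible. *)
Lemma family_dom_dense p q d e : (forall i, coef_family d (p^~ i)) ->
  (forall i, coef_family e (q^~ i)) ->
  (forall t : T, inverse_dom (p (sval t)) (q (sval t)) !=set0) -> dense (family_dom p q).
Proof.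
move=> hp hq ne O [z Oz] oO.
have [k [G [FG Gz GO]]] := form_nbhs fm oO Oz (conj I I).
have [g hg gE] := prod_form_slice_left (proj_has_forms K n) z.1 FG.
have gEx x : G (z.1, x) = g.@[hcoord x] := congr1 (fun f => f x) gE.
have oD := inverse_dom_open (fun i => coef_family_homog (sval z.1) (hp i))
  (fun i => coef_family_homog (sval z.1) (hq i)).
have [|x [gx dx]] := proj_open_meet (proj_open_neq0 hg) oD _ (ne z.1).
  by exists z.2; rewrite /= -gEx; case: (z) Gz.
by exists (z.1, x); split=> //; apply: GO; rewrite ?gEx.
Qed.

Lemma family_pseudo_aut p q d e : (forall i, coef_family d (p^~ i)) ->
  (forall i, coef_family e (q^~ i)) ->
  (forall t : T, left_inverse (q (sval t)) (p (sval t))) ->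
  (forall t : T, left_inverse (p (sval t)) (q (sval t))) ->
  (forall t : T, inverse_dom (p (sval t)) (q (sval t)) !=set0) ->
  exists phi : pseudo_aut Pn T, forall t : T,
    rep_on (bfun (BirMap (pa_fib phi t))) (bdom (BirMap (pa_fib phi t))) d (p (sval t)).
Proof.
move=> hp hq qp pq ne.
have hpt t i := coef_family_homog t (hp i); have hqt t i := coef_family_homog t (hq i).
have ne' (t : T) : inverse_dom (q (sval t)) (p (sval t)) !=set0.
  have [x dx] := ne t; exists (proj_map (p (sval t)) x).
  by have [] := inverse_domP (hpt _) (hqt _) (qp t) dx.
have bir : birational_on (family_dom p q) (fun z : S => (z.1, proj_map (p (sval z.1)) z.2) : S).
  apply: (@birational_of_inverse _ _ _ (family_dom q p) _
    (fun z : S => (z.1, proj_map (q (sval z.1)) z.2) : S)).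
  - exact: family_dom_open hp hq.
  - exact: family_dom_dense hp hq ne.
  - exact: family_dom_open hq hp.
  - exact: family_dom_dense hq hp ne'.
  - exact: family_morphism hp hq qp.
  - exact: family_morphism hq hp pq.
  - by move=> [t x] /= dz; have [_ ->] := inverse_domP (hpt _) (hqt _) (qp t) dz.
  - by move=> [t x] /= dz; have [_ ->] := inverse_domP (hqt _) (hpt _) (pq t) dz.
have fib (t : T) : birational_on [set x : Pn | family_dom p q (t, x)]
    (fun x => proj_map (p (sval (t, x).1)) (t, x).2).
  exact: (proj_map_birational (hpt (sval t)) (hqt (sval t)) (qp t) (pq t) (ne t)).
exists (PseudoAut bir (family_map_morphism hp hq) fib) => t.
by apply: proj_map_rep => [i|x []] //; exact: hpt.
Qed.

End CoefficientFamilies.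

(** * A sequence of maps whose degrees tend to infinity *)

Lemma deg_cvg_succ (T : Type) (d : T -> nat) (g : nat -> T) i :
  (forall m, d (g m) = (i + m).+1) -> d (g m) @[m --> \oo] --> \oo.
Proof.
move=> dg A [N _ NA]; exists N => // m /= Nm; rewrite dg; apply: NA => /=.
by rewrite -addSn; apply: leq_trans Nm (leq_addl _ _).
Qed.

Section ElementaryMaps.
Variables (K : closedFieldType) (n : nat).
Hypothesis n_ge2 : (2 <= n)%N.
Local Notation Pn := (projective_space K n).
Local Notation i1 := (inord 1 : 'I_n.+1).
Local Notation X i := ('X_i : {mpoly K[n.+1]}).

Let i1_neq0 : i1 != ord0.
Proof. by rewrite -val_eqE /= inordK // ltnS ltnW. Qed.

Let i1_neqn : i1 != ord_max.
Proof. by rewrite -val_eqE /= inordK ?ltn_eqF // ltnS ltnW. Qed.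

Let in_neq0 : (ord_max : 'I_n.+1) != ord0.
Proof. by rewrite -val_eqE /= -lt0n ltnW. Qed.

(** In the chart [x_0 = 1] this adds [s x_1^(m+1)] to the last coordinate, so [- s] gives the
    inverse. As [n >= 2], the coordinates [x_1] and [x_n] are different. *)
Definition elementary (s : K) m (i : 'I_n.+1) : {mpoly K[n.+1]} :=
  X i * X ord0 ^+ m + (if i == ord_max then s *: X i1 ^+ m.+1 else 0).

Let hX i : X i \is 1.-homog.
Proof. by rewrite dhomogX /= mdeg1. Qed.

Lemma elementary_homog s m i : elementary s m i \is m.+1.-homog.
Proof.
have hXn j k : X j ^+ k \is k.-homog by rewrite -[Y in Y.-homog]mul1n; apply: dhomogMn.
apply: rpredD; first by rewrite -[m.+1]add1n; apply: dhomogM.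
by case: ifP => _; [apply: rpredZ|apply: rpred0].
Qed.

Lemma evals_elementary s m v i : evals (elementary s m) v i =
  v i * v ord0 ^+ m + (if i == ord_max then s * v i1 ^+ m.+1 else 0).
Proof.
rewrite /evals mevalD mevalM rmorphXn /= !mevalXU; congr (_ + _).
by case: ifP => _; rewrite ?meval0 // mevalZ rmorphXn /= mevalXU.
Qed.

Lemma elementary_inverse s m : left_inverse (elementary (- s) m) (elementary s m).
Proof.
(* The first map contributes the scalar [x_0^m] and the second one [(x_0^(m+1))^m]. *)
move=> v; apply: (@scaled_proportional _ _ (v ord0 ^+ (m.+1 * m + m))) => i.
rewrite !evals_elementary (negPf i1_neqn) [ord0 == _]eq_sym (negPf in_neq0) !addr0.
have -> : v ord0 ^+ (m.+1 * m + m) = v ord0 ^+ m * (v ord0 ^+ m) ^+ m * v ord0 ^+ m.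
  by rewrite exprD exprM exprS exprMn.
rewrite !exprMn [(v ord0 ^+ m) ^+ m.+1]exprS; case: ifP => _; ring.
Qed.

Lemma elementary_dom s m : inverse_dom (elementary s m) (elementary (- s) m) !=set0.
Proof.
pose v (i : 'I_n.+1) : K := (i == ord0)%:R.
have v0 : v ord0 != 0 by rewrite /v eqxx oner_neq0.
exists (mkproj v); have [c c0 cE] := hcoord_mkproj v0.
have x0 : hcoord (mkproj v) ord0 != 0 by rewrite cE mulf_neq0.
have E s' w : evals (elementary s' m) w ord0 = w ord0 * w ord0 ^+ m.
  by rewrite evals_elementary eq_sym (negPf in_neq0) addr0.
by split; exists ord0; rewrite !E !mulf_neq0 // !expf_neq0 // mulf_neq0 // expf_neq0.
Qed.

Let elementary_birational m :
  birational_on (inverse_dom (elementary 1 m) (elementary (- 1) m)) (proj_map (elementary 1 m)).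
Proof.
apply: proj_map_birational (elementary_homog 1 m) (elementary_homog (-1) m) _ _ _.
- exact: elementary_inverse.
- by have := @elementary_inverse (- 1) m; rewrite opprK.
- exact: elementary_dom.
Qed.

Definition elementary_map m : bir Pn := bir_class (BirMap (elementary_birational m)).

(* Restrictions of [q] to the lines [(z : 1 : 0 : ...)] and [(1 : z : 0 : ...)]. *)
Let line (b : bool) (q : {mpoly K[n.+1]}) : {poly K} :=
  mmap polyC (fun i => if i == ord0 then if b then 'X else 1
                       else if i == i1 then if b then 1 else 'X else 0) q.

Let pt b (z : K) (i : 'I_n.+1) : K := if i == ord0 then if b then z else 1
  else if i == i1 then if b then 1 else z else 0.

Let lineM b q r : line b (q * r) = line b q * line b r.
Proof. exact: rmorphM. Qed.

Let line_eval b q z : (line b q).[z] = q.@[pt b z].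
Proof.
have com : commr_rmorph (idfun : K -> K) z by move=> x; rewrite /GRing.comm mulrC.
rewrite /line /mmap horner_sum /meval /mmap; apply: eq_bigr => m _.
rewrite hornerM hornerC horner_prod; congr (_ * _); apply: eq_bigr => i _.
rewrite horner_exp /pt; congr (_ ^+ _).
by do 2?[case: ifP => _]; case: b; rewrite ?hornerX ?hornerC.
Qed.

Let unit_const (f g : {poly K}) : f * g = 1 -> exists2 c, c != 0 & f = c%:P.
Proof.
move=> fg; have [f0 g0] : f != 0 /\ g != 0.
  by apply/andP; rewrite -negb_or -mulf_eq0 fg oner_neq0.
have s1 : (size f <= 1)%N.
  have := size_mul f0 g0; rewrite fg size_poly1.
  have : (0 < size g)%N by rewrite size_poly_gt0.
  by case: (size g) => // m _; rewrite addnS /= => e; rewrite [leqRHS]e leq_addr.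
by exists f`_0; rewrite -?size1_polyC // -polyC_eq0 -size1_polyC.
Qed.

(** A common divisor [q] divides [x_0^(m+1)], which is 1 on the line [(1 : z : 0 : ...)], and the
    last component, which is 1 on [(z : 1 : 0 : ...)]; so [q] is constant on both. If [q] has degree
    [l], homogeneity gives [c1 = w^l c2] for all nonzero [w], whence [l = 0]. *)
Let elementary_coprime m : coprime_family (elementary 1 m).
Proof.
move=> q dvq; have [r rE] := dvq ord0; have [t tE] := dvq ord_max.
have e0 : elementary 1 m ord0 = X ord0 ^+ m.+1.
  by rewrite /elementary eq_sym (negPf in_neq0) addr0 exprS.
have X0 : X ord0 ^+ m.+1 != 0.
  by rewrite expf_neq0 // mpolyX_neq0.
have rq0 : r * q != 0 by rewrite -rE e0.
have hrq : r * q \is m.+1.-homog by rewrite -rE elementary_homog.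
have [k [l [_ _ hq]]] := homog_factors rq0 hrq.
have peq (f g : {poly K}) : (forall z, f.[z] = g.[z]) -> f = g.
  move=> fg; apply/eqP; rewrite -subr_eq0; apply: contrapT => /negP/closed_nonrootP[z].
  by rewrite /root hornerD hornerN fg subrr eqxx.
have [c1 c1_0 q1] : exists2 c, c != 0 & line false q = c%:P.
  apply: (@unit_const _ (line false r)); rewrite mulrC -lineM -rE e0.
  apply: peq => z; rewrite line_eval rmorphXn /= mevalXU hornerC /pt eqxx.
  by rewrite expr1n.
have [c2 c2_0 q2] : exists2 c, c != 0 & line true q = c%:P.
  apply: (@unit_const _ (line true t)); rewrite mulrC -lineM -tE.
  apply: peq => z; rewrite line_eval -/(evals (elementary 1 m) (pt true z) ord_max).
  rewrite evals_elementary eqxx hornerC /pt eqxx (negPf in_neq0) (negPf i1_neq0).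
  by rewrite eqxx eq_sym (negPf i1_neqn) mul0r add0r mul1r expr1n.
have qw w : w != 0 -> c1 = w ^+ l * c2.
  move=> w0; have := line_eval false q w; rewrite q1 hornerC => ->.
  have := line_eval true q w^-1; rewrite q2 hornerC => ->.
  rewrite -(meval_dhomog _ _ hq); apply: meval_eq => i; rewrite /pt.
  by do 2?[case: ifP => _]; rewrite ?mulfV ?mulr1 ?mulr0.
have l0 : l = 0%N.
  apply/eqP; rewrite eqn0Ngt; apply/negP => lgt0.
  have nz : 'X * ('X^l - 1) != 0 :> {poly K}.
    rewrite mulf_neq0 ?polyX_eq0 // -size_poly_gt0 size_addl ?size_polyXn //.
    by rewrite size_opp size_poly1.
  have [w] := closed_nonrootP _ nz; rewrite /root hornerM hornerX mulf_eq0 negb_or => /andP[w0].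
  rewrite hornerD hornerN hornerXn hornerC subr_eq0 => /eqP[]; apply: (mulIf c2_0).
  by rewrite -qw // (qw 1) ?oner_neq0 // expr1n.
have [c qc] : exists c, q = c%:MP by move: hq; rewrite l0 => /homog0_const.
exists c => //; apply: contraNneq rq0 => c0.
by rewrite qc c0 mpolyC0 mulr0.
Qed.

Lemma deg_elementary_map m : deg (elementary_map m) = m.+1.
Proof.
apply: degE; exists (elementary 1 m); split.
- by move=> i; apply: elementary_homog.
- exact: elementary_coprime.
exists (BirMap (elementary_birational m)) => // x dx.
have [_ H] := proj_map_rep (O := inverse_dom (elementary 1 m) (elementary (- 1) m))
  (elementary_homog 1 m) (fun x H => proj1 H).
exact: H.
Qed.

Lemma bir_not_noetherian : ~ noetherian (bir Pn).
Proof.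
move=> noeth; pose F i := range (fun m => elementary_map (i + m)).
have [i|i|m mE] := noeth F.
- apply: closed_of_deg_to_infty; apply: (@deg_cvg_succ _ _ _ i) => m.
  exact: deg_elementary_map.
- by move=> _ [m _ <-]; exists m.+1 => //; rewrite addnS.
have : F m.+1 (elementary_map m) by rewrite mE //; exists 0%N => //; rewrite addn0.
move=> [j _ /(congr1 (@deg K n))]; rewrite !deg_elementary_map => -[] /eqP.
by rewrite addSn gtn_eqF // ltnS leq_addr.
Qed.

End ElementaryMaps.

(** * Saturation of an uncountable algebraically closed field *)

(** Polynomial functions in the variables [J], of which there are infinitely many in the
    application; each function involves only finitely many. *)
Inductive polyfun (K : comNzRingType) (J : Type) : ((J -> K) -> K) -> Prop :=
| polyfun_cst c : polyfun (fun=> c)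
| polyfun_var j : polyfun (fun v => v j)
| polyfunD f g : polyfun f -> polyfun g -> polyfun (fun v => f v + g v)
| polyfunM f g : polyfun f -> polyfun g -> polyfun (fun v => f v * g v).

Lemma polyfunZ (K : comNzRingType) (J : Type) (c : K) (f : (J -> K) -> K) :
  polyfun f -> polyfun (fun v => c * f v).
Proof. by move=> pf; exact: (polyfunM (polyfun_cst _ c) pf). Qed.

Lemma polyfunB (K : comNzRingType) (J : Type) (f g : (J -> K) -> K) :
  polyfun f -> polyfun g -> polyfun (fun v => f v - g v).
Proof.
move=> pf pg; rewrite (_ : (fun v => _) = fun v => f v + -1 * g v).
  exact: (polyfunD pf (polyfunZ (-1) pg)).
by apply/funext => v; rewrite mulN1r.
Qed.

Lemma polyfun_sum (K : comNzRingType) (J I : Type) (r : seq I) (Q : pred I) (F : I -> (J -> K) -> K) :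
  (forall i, polyfun (F i)) -> polyfun (fun v => \sum_(i <- r | Q i) F i v).
Proof.
move=> pF; elim: r => [|i r IH].
  by rewrite (_ : (fun v => _) = fun=> 0); [exact: polyfun_cst|apply/funext => v; rewrite big_nil].
have [Qi|nQi] := boolP (Q i); last first.
  by rewrite (_ : (fun v => _) = fun v => \sum_(j <- r | Q j) F j v) //;
    apply/funext => z; rewrite big_cons (negPf nQi).
rewrite (_ : (fun v => _) = fun v => F i v + \sum_(j <- r | Q j) F j v).
  exact: polyfunD.
by apply/funext => z; rewrite big_cons Qi.
Qed.

Lemma polyfun_prod (K : comNzRingType) (J I : Type) (r : seq I) (F : I -> (J -> K) -> K) :
  (forall i, polyfun (F i)) -> polyfun (fun v => \prod_(i <- r) F i v).
Proof.
move=> pF; elim: r => [|i r IH].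
  by rewrite (_ : (fun v => _) = fun=> 1); [exact: polyfun_cst|apply/funext => v; rewrite big_nil].
rewrite (_ : (fun v => _) = fun v => F i v * \prod_(j <- r) F j v); first exact: polyfunM.
by apply/funext => z; rewrite big_cons.
Qed.

Lemma polyfunX (K : comNzRingType) (J : Type) (f : (J -> K) -> K) k :
  polyfun f -> polyfun (fun v => f v ^+ k).
Proof.
move=> pf; elim: k => [|k IH].
  by rewrite (_ : (fun v => _) = fun=> 1); [exact: polyfun_cst|apply/funext].
rewrite (_ : (fun v => _) = fun v => f v * f v ^+ k); first exact: polyfunM.
by apply/funext => z; rewrite exprS.
Qed.

Lemma wide_kernel (F : fieldType) m n (A : 'M[F]_(m, n)) : (n < m)%N ->
  exists2 u : 'rV_m, u != 0 & u *m A = 0.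
Proof.
move=> nm; have k0 : kermx A != 0.
  rewrite kermx_eq0 /row_free; apply: contraTneq nm => <-.
  by rewrite -leqNgt rank_leq_col.
exists (nz_row (kermx A)); first by rewrite nz_row_eq0.
by apply/sub_kermxP; apply: nz_row_sub.
Qed.

Section Saturation.
Variables (K : closedFieldType) (J : countType) (b : J -> nat -> K).
Hypothesis Kunc : ~ countable [set: K].
Local Notation fn := ((J -> K) -> K).
Implicit Types (f g : fn) (I : set fn).

Let tail f := exists M, forall m, (M <= m)%N -> f (fun j => b j m) = 0.

(** The ideal generated by [I] and by all polynomial functions that vanish at almost all terms of
    the sequence. The latter are built in, so every ideal considered contains them. *)
Inductive ideal_gen I : fn -> Prop :=
| ideal_tail f : polyfun f -> tail f -> ideal_gen I f
| ideal_mem f : polyfun f -> I f -> ideal_gen I f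
| idealD f g : ideal_gen I f -> ideal_gen I g -> ideal_gen I (fun v => f v + g v)
| idealM f g : polyfun f -> ideal_gen I g -> ideal_gen I (fun v => f v * g v).

Let ideal_mono I I' f : I `<=` I' -> ideal_gen I f -> ideal_gen I' f.
Proof.
move=> II'; elim=> [g pg tg|g pg Ig|g h _ IH1 _ IH2|g h pg _ IH].
- exact: ideal_tail.
- exact: ideal_mem pg (II' _ Ig).
- exact: idealD.
- exact: idealM.
Qed.

Let ideal_proper I := ~ ideal_gen I (fun=> 1).

Let ideal_maximal : exists I, ideal_proper I /\ forall I', I `<` I' -> ~ ideal_proper I'.
Proof.
apply: Zorn_bigcup => F FP Ftot H.
(* Generating 1 involves finitely many elements of the chain, hence a single member. The second
   alternative, which also covers an empty chain, uses the tail functions alone: what they generate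
   vanishes at almost all terms, and 1 does not. *)
suff [[I FI] /FP|] : (exists2 I, F I & ideal_gen I (fun=> 1)) \/ ideal_gen set0 (fun=> 1).
- by [].
- suff step f : ideal_gen set0 f -> tail f.
    by move=> /step[M /(_ M (leqnn M))/eqP]; rewrite oner_eq0.
  elim=> [g pg tg //|g pg []|g h _ [M gM] _ [M' hM]|g h pg _ [M hM]].
    exists (maxn M M') => m; rewrite geq_max => /andP[Mm M'm].
    by rewrite gM // hM // addr0.
  by exists M => m Mm; rewrite hM // mulr0.
- suff step f : ideal_gen (\bigcup_(X in F) X) f ->
      (exists2 I, F I & ideal_gen I f) \/ ideal_gen set0 f by exact: (step _ H).
  elim=> [g pg tg|g pg [I FI Ig]|g h _ IH1 _ IH2|g h pg _ IH].
  + by right; apply: ideal_tail.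
  + by left; exists I => //; apply: ideal_mem.
  + case: IH1 => [[I FI Ig]|Ig]; case: IH2 => [[I' FI' Ih]|Ih].
    * left; case: (Ftot I I' FI FI') => sub.
        by exists I' => //; apply: idealD => //; apply: ideal_mono Ig.
      by exists I => //; apply: idealD => //; apply: ideal_mono Ih.
    * by left; exists I => //; apply: idealD => //; apply: ideal_mono Ih => ? [].
    * by left; exists I' => //; apply: idealD => //; apply: ideal_mono Ig => ? [].
    * by right; apply: idealD.
  + case: IH => [[I FI Ig]|Ig]; last by right; apply: idealM.
    by left; exists I => //; apply: idealM.
Qed.

(** Finite sequences of variables are enumerated by [pickle], so the monomials form a countable
    family; an index that encodes no sequence gives 0. *)
Let monomial (i : nat) : fn :=
  fun v => if choice.unpickle i is Some s then \prod_(j <- (s : seq J)) v j else 0.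

Let spanned f := exists N (l : nat -> K), f = fun v => \sum_(i < N) l i * monomial i v.

Let spannedD f g : spanned f -> spanned g -> spanned (fun v => f v + g v).
Proof.
move=> [N [l ->]] [N' [l' ->]].
have extend k m (a : nat -> K) v : (k <= m)%N -> \sum_(i < k) a i * monomial i v =
    \sum_(i < m) (if (i < k)%N then a i else 0) * monomial i v.
  move=> km; rewrite (big_ord_widen m (fun i => a i * monomial i v) km) big_mkcond.
  by apply: eq_bigr => i _; case: ifP => // _; rewrite mul0r.
exists (maxn N N'), (fun i => (if (i < N)%N then l i else 0) + (if (i < N')%N then l' i else 0)).
apply/funext => v; rewrite (extend N (maxn N N')) ?leq_maxl // (extend N' (maxn N N')) ?leq_maxr //.
by rewrite -big_split; apply: eq_bigr => i _; rewrite mulrDl.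
Qed.

Let spannedZ c f : spanned f -> spanned (fun v => c * f v).
Proof.
move=> [N [l ->]]; exists N, (fun i => c * l i); apply/funext => v.
by rewrite mulr_sumr; apply: eq_bigr => i _; rewrite mulrA.
Qed.

Let spanned_sum N (F : 'I_N -> fn) : (forall i, spanned (F i)) -> spanned (fun v => \sum_i F i v).
Proof.
elim: N F => [|N IH] F sF.
  by exists 0, (fun=> 0); apply/funext => v; rewrite !big_ord0.
rewrite (_ : (fun v => _) = fun v => F ord0 v + \sum_(i < N) F (lift ord0 i) v).
  by apply: spannedD => //; apply: IH.
by apply/funext => v; rewrite big_ord_recl.
Qed.

Let spanned_seq (s : seq J) : spanned (fun v => \prod_(j <- s) v j).
Proof.
exists (choice.pickle s).+1, (fun i => (i == choice.pickle s)%:R); apply/funext => v.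
rewrite big_ord_recr /= eqxx mul1r [X in _ = X + _]big1 ?add0r => [|i _].
  by rewrite /monomial choice.pickleK.
by rewrite ltn_eqF // mul0r.
Qed.

Let spannedM f g : spanned f -> spanned g -> spanned (fun v => f v * g v).
Proof.
move=> [N [l ->]] [N' [l' ->]].
rewrite (_ : (fun v => _) = fun v => \sum_(i < N) \sum_(j < N') l i * l' j * (monomial i v * monomial j v)).
  apply: spanned_sum => i; apply: spanned_sum => j; apply: spannedZ.
  rewrite /monomial; case: choice.unpickle => [s|]; last first.
    by exists 0, (fun=> 0); apply/funext => v; rewrite big_ord0 mul0r.
  case: choice.unpickle => [t|]; last first.
    by exists 0, (fun=> 0); apply/funext => v; rewrite big_ord0 mulr0.
  have := spanned_seq (s ++ t); rewrite (_ : (fun v => \prod_(j0 <- s ++ t) _) =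
    fun v => (\prod_(j <- s) v j) * (\prod_(j <- t) v j)) //.
  by apply/funext => v; rewrite big_cat.
apply/funext => v; rewrite mulr_suml; apply: eq_bigr => i _; rewrite mulr_sumr.
by apply: eq_bigr => j _; rewrite mulrACA.
Qed.

Let polyfun_spanned f : polyfun f -> spanned f.
Proof.
elim=> [c|j|g h _ Ig _ Ih|g h _ Ig _ Ih].
- have := spannedZ c (spanned_seq [::]); rewrite (_ : (fun v => _) = fun=> c) //.
  by apply/funext => v; rewrite big_nil mulr1.
- have := spanned_seq [:: j]; rewrite (_ : (fun v => _) = fun v => v j) //.
  by apply/funext => v; rewrite big_seq1.
- exact: spannedD.
- exact: spannedM.
Qed.

(* Uncountably many elements of a space of countable dimension: infinitely many
   of the [r c] are combinations of the same [k] monomials. *)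
Let dependent (r : K -> fn) : (forall c, polyfun (r c)) ->
  exists N (cs : 'I_N -> K) (u : 'I_N -> K), [/\ injective cs, exists i, u i != 0 &
    forall v, \sum_i u i * r (cs i) v = 0].
Proof.
move=> pr; have /boolp.choice[N /boolp.choice[l lE]] := fun c => polyfun_spanned (pr c).
have [k kinf] : exists k, infinite_set [set c | N c = k].
  apply: contrapT => /forallNP fin; apply: Kunc.
  rewrite (_ : setT = \bigcup_k [set c | N c = k]); last by apply/seteqP; split=> // c _; exists (N c).
  apply: bigcup_countable => // k _; apply: finite_set_countable.
  exact: contrapT (fin k).
have [B Bk sB] := infinite_set_fset k.+1 kinf.
pose cs (i : 'I_k.+1) := nth 0 (enum_fset B) i.
have csB i : cs i \in B by apply: mem_nth; apply: leq_trans sB.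
have csk i : N (cs i) = k by apply: Bk; apply: csB.
have [u u0 uA] := @wide_kernel K k.+1 k (\matrix_(i, j) l (cs i) j) (leqnn _).
exists k.+1, cs, (fun i => u 0 i); split.
- move=> i j /eqP; rewrite nth_uniq ?fset_uniq //; last 2 first.
  + by apply: leq_trans sB.
  + by apply: leq_trans sB.
  by move=> /eqP/val_inj.
- apply: contrapT => /forallNP H; move/eqP: u0; apply; apply/rowP => i.
  by rewrite mxE; apply/eqP; apply: contrapT => /negP; apply: H.
move=> v; under eq_bigr => i _ do rewrite (lE (cs i)) csk mulr_sumr.
rewrite exchange_big big1 //= => j _.
have e : \sum_i u 0 i * l (cs i) j = 0.
  transitivity ((u *m \matrix_(i, j) l (cs i) j) 0 j); last by rewrite uA mxE.
  by rewrite mxE; apply: eq_bigr => i _; rewrite mxE.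
under eq_bigr => i _ do rewrite mulrA.
by rewrite -mulr_suml e mul0r.
Qed.

(** Modulo a maximal ideal [Id], every polynomial function is congruent to a constant. The constants
    of the coordinate functions form the point [c]; an element of [Id] with nonzero value at [c]
    would put 1 into [Id]. *)
Theorem saturation : exists c : J -> K, forall f, polyfun f ->
  (exists M, forall m, (M <= m)%N -> f (fun j => b j m) = 0) -> f c = 0.
Proof.
have [I [Iprop Imax]] := ideal_maximal.
pose Id f := ideal_gen I f.
have IdB f g : Id f -> Id g -> Id (fun v => f v - g v).
  move=> If Ig; rewrite (_ : (fun v => _) = fun v => f v + -1 * g v).
    by apply: idealD => //; apply: idealM => //; apply: polyfun_cst.
  by apply/funext => v; rewrite mulN1r.
have unitI f : polyfun f -> ~ Id f -> exists m a, [/\ Id m, polyfun a & forall v, 1 = m v + a v * f v].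
  move=> pf nIf.
  have H : ideal_gen (I `|` [set f]) (fun=> 1).
    apply: contrapT => np; apply: (Imax (I `|` [set f])) np.
    split; first by move=> g; left.
    by move=> /(_ f (or_intror erefl)) If; apply: nIf; apply: ideal_mem.
  suff step g : ideal_gen (I `|` [set f]) g ->
      exists m a, [/\ Id m, polyfun a & forall v, g v = m v + a v * f v] by exact: (step _ H).
  have Id0 : Id (fun=> 0).
    by apply: ideal_tail; [exact: polyfun_cst|exists 0].
  elim=> [h ph th|h ph [Ih|->]|h k _ [m [a [Im pa hE]]] _ [m' [a' [Im' pa' kE]]]|h k ph _ [m [a [Im pa kE]]]].
  - exists h, (fun=> 0); split; [exact: ideal_tail|exact: polyfun_cst|].
    by move=> v; rewrite mul0r addr0.
  - exists h, (fun=> 0); split; [exact: ideal_mem|exact: polyfun_cst|].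
    by move=> v; rewrite mul0r addr0.
  - exists (fun=> 0), (fun=> 1); split; [exact: Id0|exact: polyfun_cst|].
    by move=> v; rewrite mul1r add0r.
  - exists (fun v => m v + m' v), (fun v => a v + a' v); split; [exact: idealD|exact: polyfunD|].
    by move=> v; rewrite hE kE; ring.
  - exists (fun v => h v * m v), (fun v => h v * a v); split; [exact: idealM|exact: polyfunM|].
    by move=> v; rewrite kE; ring.
(* Otherwise each [f - c] has an inverse [r c] modulo [Id]. A linear relation among these inverses,
   with denominators cleared, is a nonzero polynomial in [f] lying in [Id], although all its linear
   factors are invertible. *)
have point f : polyfun f -> exists c, Id (fun v => f v - c).
  move=> pf; apply: contrapT => /forallNP nc.
  have pfc c : polyfun (fun v => f v - c) by apply: polyfunB => //; exact: polyfun_cst.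
  have /boolp.choice[r rE] : forall c, exists r, polyfun r /\ Id (fun v => r v * (f v - c) - 1).
    move=> c; have [m [a [Im pa E]]] := unitI _ (pfc c) (nc c); exists a; split=> //.
    rewrite (_ : (fun v => _) = fun v => -1 * m v); first by apply: idealM => //; exact: polyfun_cst.
    by apply/funext => v; rewrite [X in _ - X](E v); ring.
  have [N [cs [u [csI [k uk] dep]]]] := dependent (fun c => (rE c).1).
  (* The numerator of [sum_i u_i / (X - c_i)]. At [c_k] only the summand of [k] survives, so [Q] is
     nonzero. *)
  pose Q : {poly K} := \sum_i u i *: \prod_(j | j != i) ('X - (cs j)%:P).
  have Q0 : Q != 0.
    suff : Q.[cs k] != 0 by apply: contraNneq => ->; rewrite horner0.
    rewrite horner_sum (bigD1 k) //= [X in _ + X]big1 ?addr0 => [|i ik].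
      rewrite hornerZ horner_prod mulf_neq0 //; apply/prodf_neq0 => j jk.
      rewrite hornerXsubC subr_eq0; apply: contra_neq jk => e.
      by apply: csI.
    rewrite hornerZ horner_prod (bigD1 k) 1?eq_sym //= hornerXsubC subrr mul0r mulr0 //.
  have IQ : Id (fun v => Q.[f v]).
    pose D i v := \prod_(j | j != i) (f v - cs j).
    have DE i v : \prod_j (f v - cs j) = (f v - cs i) * D i v by rewrite (bigD1 i).
    (* Since [sum_i u_i r_i = 0], the value of [Q] at [f] is a combination of the elements
       [r_i (f - c_i) - 1] of [Id]. *)
    rewrite (_ : (fun v => _) = fun v => \sum_i (- u i) * D i v * (r (cs i) v * (f v - cs i) - 1)).
      have Isum (s : seq 'I_N) : Id (fun v => \sum_(i <- s) (- u i) * D i v * (r (cs i) v * (f v - cs i) - 1)).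
        elim: s => [|i s IH].
          rewrite (_ : (fun v => _) = fun=> 0); last by apply/funext => v; rewrite big_nil.
          by apply: ideal_tail; [exact: polyfun_cst|exists 0].
        rewrite (_ : (fun v => _) = fun v => (- u i) * D i v * (r (cs i) v * (f v - cs i) - 1) +
           \sum_(i <- s) (- u i) * D i v * (r (cs i) v * (f v - cs i) - 1)).
          apply: idealD => //; apply: (idealM (f := fun v => - u i * D i v)); last exact: (rE _).2.
          apply: polyfunZ; rewrite /D.
          under eq_fun => v do rewrite -big_filter.
          exact: polyfun_prod.
        by apply/funext => v; rewrite big_cons.
      exact: Isum.
    apply/funext => v; rewrite horner_sum.
    transitivity (\sum_i u i * D i v - (\prod_j (f v - cs j)) * \sum_i u i * r (cs i) v).
      rewrite dep mulr0 subr0; apply: eq_bigr => i _; rewrite hornerZ horner_prod; congr (_ * _).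
      by apply: eq_bigr => j _; rewrite hornerXsubC.
    rewrite mulr_sumr -sumrB; apply: eq_bigr => i _.
    by rewrite (DE i); ring.
  have [s QE] := closed_field_poly_normal Q.
  have l0 : lead_coef Q != 0 by rewrite lead_coef_eq0.
  have Is : Id (fun v => \prod_(z <- s) (f v - z)).
    rewrite (_ : (fun v => _) = fun v => (lead_coef Q)^-1 * Q.[f v]).
      by apply: idealM => //; exact: polyfun_cst.
    apply/funext => v; rewrite {2}QE hornerZ mulKf // horner_prod.
    by apply: eq_bigr => z _; rewrite hornerXsubC.
  (* The factors [f - z] are cancelled one at a time by their inverses, until 1 lies in [Id]. *)
  elim: s Is {QE} => [|z s IH] Is.
    by apply: Iprop; move: Is; rewrite (_ : (fun v => _) = fun=> 1) //; apply/funext => v; rewrite big_nil.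
  apply: IH; have [m [a [Im pa E]]] := unitI _ (pfc z) (nc z).
  have pprod : polyfun (fun v => \prod_(z <- s) (f v - z)) by apply: polyfun_prod.
  rewrite (_ : (fun v => _) = fun v => (\prod_(z <- s) (f v - z)) * m v +
      a v * \prod_(z <- z :: s) (f v - z)).
    by apply: idealD; apply: idealM.
  by apply/funext => v; rewrite big_cons mulrA mulrC -mulrDl -E mul1r.
have /boolp.choice[c cE] : forall j, exists c, Id (fun v => v j - c) by move=> j; apply/point/polyfun_var.
have Ieval f : polyfun f -> Id (fun v => f v - f c).
  elim=> [d|j|g h _ Ig _ Ih|g h pg Ig ph Ih].
  - rewrite (_ : (fun v => _) = fun=> 0); last by apply/funext => v; rewrite subrr.
    by apply: ideal_tail; [exact: polyfun_cst|exists 0].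
  - exact: cE.
  - rewrite (_ : (fun v => _) = fun v => (g v - g c) + (h v - h c)); first exact: idealD.
    by apply/funext => v; ring.
  - rewrite (_ : (fun v => _) = fun v => g v * (h v - h c) + h c * (g v - g c)).
      by apply: idealD; apply: idealM => //; exact: polyfun_cst.
    by apply/funext => v; ring.
exists c => f pf tf; apply/eqP; apply: contrapT => /negP fc.
apply: Iprop; have If : Id f by apply: ideal_tail.
rewrite (_ : (fun=> 1) = fun v => (f c)^-1 * (f v - (f v - f c))).
  by apply: idealM; [exact: polyfun_cst|apply: IdB => //; apply: Ieval].
by apply/funext => v; rewrite opprB addrC subrK mulVf.
Qed.
End Saturation.

(** * A bound for the degree of the inverse *)

Section PolynomialFunctions.
Variables (K : closedFieldType) (k : nat).
Implicit Types (P Q : {mpoly K[k]}).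

Lemma mpoly_vanish P : (forall v, P.@[v] = 0) -> P = 0.
Proof.
move=> P0; apply/eqP; apply: contrapT => /negP /mpoly_nonroot[v].
by rewrite P0 eqxx.
Qed.

Lemma mpoly_vanish_on P Q : Q != 0 -> (forall v, Q.@[v] != 0 -> P.@[v] = 0) -> P = 0.
Proof.
move=> Q0 H; apply/eqP; have /eqP : Q * P = 0.
  apply: mpoly_vanish => v; rewrite mevalM.
  by have [->|/H ->] := eqVneq Q.@[v] 0; rewrite ?mul0r ?mulr0.
by rewrite mulf_eq0 (negPf Q0).
Qed.

Definition pcomp l P (p : 'I_k -> {mpoly K[l]}) : {mpoly K[l]} := P \mPo [tuple p i | i < k].

Lemma pcompE l P (p : 'I_k -> {mpoly K[l]}) v : (pcomp P p).@[v] = P.@[fun i => (p i).@[v]].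
Proof.
by rewrite comp_mpoly_meval; apply: meval_eq => i; rewrite tnth_mktuple.
Qed.

Lemma dhomog_monomial l d (p : 'I_k -> {mpoly K[l]}) (m : 'X_{1..k}) :
  (forall i, p i \is d.-homog) -> \prod_i p i ^+ m i \is (d * mdeg m).-homog.
Proof.
move=> hp; rewrite mdegE; elim: (index_enum _) => [|i r IH].
  by rewrite !big_nil muln0 dhomog1.
by rewrite !big_cons mulnDr; apply: dhomogM => //; apply: dhomogMn.
Qed.
End PolynomialFunctions.

(** * An algebraic relation obtained by counting dimensions *)

Section Relation.
Variables (K : closedFieldType) (n : nat).
Local Notation polys := ('I_n.+1 -> {mpoly K[n.+1]}).

(* The monomial of degree [c] with exponents [nu] in the last [n] variables. *)
Definition box_monomial c (nu : 'I_n -> nat) : 'X_{1..n.+1} :=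
  [multinom if unlift ord0 i is Some j then nu j else (c - \sum_j nu j)%N | i < n.+1].

Lemma box_monomial_lift c nu j : box_monomial c nu (lift ord0 j) = nu j.
Proof. by rewrite mnmE liftK. Qed.

Lemma mdeg_box_monomial c nu : (\sum_j nu j <= c)%N -> mdeg (box_monomial c nu) = c.
Proof.
move=> nuc; rewrite mdegE big_ord_recl (eq_bigr nu) => [|i _]; last exact: box_monomial_lift.
by rewrite mnmE unlift_none subnK.
Qed.

Lemma box_monomial_surj m : box_monomial (mdeg m) (fun j => m (lift ord0 j)) = m.
Proof.
apply/mnmP => i; rewrite mnmE; case: unliftP => [j ->//|->].
by rewrite mdegE big_ord_recl addnK.
Qed.

(** With [k = (n d + 1)^n] unknowns outnumber equations. The [(k + 1)^(n+1)] unknowns are indexed by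
    a power of [x_i] and [n] exponents up to [k]; the equations are indexed by [n] exponents up to
    [k + d n k], so there are at most [((n d + 1) (k + 1))^n = k (k + 1)^n] of them. *)
Definition relation_degree d := ((n * d + 1) ^ n)%N.

Lemma box_count d (k := relation_degree d) :
  (#|{: {ffun 'I_n -> 'I_(k + d * (n * k)).+1}}| < #|{: 'I_k.+1 * {ffun 'I_n -> 'I_k.+1}}|)%N.
Proof.
rewrite card_prod !card_ffun !card_ord.
have le : ((k + d * (n * k)).+1 <= (n * d + 1) * k.+1)%N by nia.
apply: leq_ltn_trans (_ : ((n * d + 1) * k.+1) ^ n < _)%N.
  by case: (n) le => // n' le; rewrite leq_exp2r.
by rewrite expnMn ltn_mul2r expn_gt0 /= /k /relation_degree ltnSn.
Qed.

(** The products [V] of a monomial in [p] with [x_0^(k-b) x_i^b] all have degree [D], and a monomial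
    of degree [D] is determined by its last [n] exponents; so [box_count] gives a linear dependence.
    Its terms with the same [b] make up [A b]. *)
Lemma algebraic_relation d (p : polys) i (k := relation_degree d) : (forall j, p j \is d.-homog) ->
  exists A : 'I_k.+1 -> {mpoly K[n.+1]}, [/\ forall b, A b \is (n * k).-homog,
    exists b, A b != 0 &
    forall v, \sum_(b < k.+1) (A b).@[evals p v] * (v ord0 ^+ (k - b) * v i ^+ b) = 0].
Proof.
move=> hp; pose R := ('I_k.+1 * {ffun 'I_n -> 'I_k.+1})%type.
pose D := (k + d * (n * k))%N; pose C := {ffun 'I_n -> 'I_D.+1}.
pose mon (r : R) := box_monomial (n * k) (fun j => r.2 j).
have dmon r : mdeg (mon r) = (n * k)%N.
  apply: mdeg_box_monomial; apply: leq_trans (_ : \sum_(j < n) k <= _)%N.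
    by apply: leq_sum => j _; rewrite -ltnS.
  by rewrite sum_nat_const card_ord.
pose V (r : R) : {mpoly K[n.+1]} :=
  'X_ord0 ^+ (k - r.1) * 'X_i ^+ r.1 * \prod_j p j ^+ mon r j.
have hX j : ('X_j : {mpoly K[n.+1]}) \is 1.-homog by rewrite dhomogX /= mdeg1.
have hV r : V r \is D.-homog.
  rewrite /D -(dmon r); apply: dhomogM; last exact: dhomog_monomial.
  have kE : (1 * (k - r.1) + 1 * r.1)%N = k by rewrite !mul1n subnK // -ltnS.
  by rewrite -[X in X.-homog]kE; apply: dhomogM; apply: dhomogMn.
have [u u0 uM] := @wide_kernel K #|{: R}| #|{: C}|
  (\matrix_(a, c) (V (enum_val a))@_(box_monomial D (fun j => (enum_val c : C) j))) (box_count d).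
have W0 : \sum_a u 0 a *: V (enum_val a) = 0.
  have hW : \sum_a u 0 a *: V (enum_val a) \is D.-homog.
    by apply: rpred_sum => a _; apply: rpredZ.
  apply/mpolyP => m; rewrite mcoeff0; have [mD|mD] := eqVneq (mdeg m) D; last first.
    exact: (dhomog_nemf_coeff hW mD).
  have mj j : (m (lift ord0 j) < D.+1)%N.
    by rewrite ltnS -mD mdegE (bigD1 (lift ord0 j)) //= leq_addr.
  pose c : C := [ffun j => Ordinal (mj j)].
  have mE : m = box_monomial D (fun j => c j).
    by rewrite -{1}(box_monomial_surj m) mD; congr box_monomial; apply/funext => j; rewrite ffunE.
  transitivity ((u *m (\matrix_(a, c) (V (enum_val a))@_(box_monomial D (fun j => (enum_val c : C) j)))) 0 (enum_rank c)).
    rewrite mxE raddf_sum; apply: eq_bigr => a _.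
    by rewrite mxE /= mcoeffZ enum_rankK -mE.
  by rewrite uM mxE.
exists (fun b => \sum_(a : 'I_#|{: R}| | (enum_val a).1 == b) u 0 a *: 'X_[mon (enum_val a)]); split.
- by move=> b; apply: rpred_sum => a _; apply: rpredZ; rewrite dhomogX; apply/eqP/dmon.
- have [a ua] : exists a, u 0 a != 0.
    apply: contrapT => /forallNP H; move/eqP: u0; apply; apply/rowP => a.
    by rewrite mxE; apply/eqP; apply: contrapT => /negP; apply: H.
  (* Indices with the same [b] give different monomials, so nothing cancels within [A b]: the
     coefficient of the monomial of [a] is [u 0 a]. *)
  exists (enum_val a).1; apply: contraNneq ua => A0.
  suff <- : (\sum_(a' : 'I_#|{: R}| | (enum_val a').1 == (enum_val a).1)
      u 0 a' *: 'X_[mon (enum_val a')] : {mpoly K[n.+1]})@_(mon (enum_val a)) = u 0 a.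
    by rewrite A0 mcoeff0.
  rewrite raddf_sum (bigD1 a) //= mcoeffZ mcoeffX eqxx mulr1 big1 ?addr0 // => a' /andP[/eqP e ne].
  rewrite mcoeffZ mcoeffX; case: eqP => [em|]; last by rewrite mulr0.
  case/eqP: ne; apply: enum_val_inj; apply: injective_projections => //.
  apply/ffunP => j; apply: val_inj; move/mnmP/(_ (lift ord0 j)): em.
  by rewrite !box_monomial_lift.
move=> v; transitivity ((\sum_a u 0 a *: V (enum_val a)).@[v]); last by rewrite W0 meval0.
rewrite raddf_sum (partition_big (fun a => (enum_val a).1) predT) //=.
apply: eq_bigr => b _; rewrite raddf_sum mulr_suml; apply: eq_bigr => a /eqP <-.
rewrite /= !mevalZ mevalX /V !mevalM !rmorphXn rmorph_prod /= !mevalXU.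
rewrite -[LHS]mulrA; congr (_ * _); rewrite [LHS]mulrC; congr (_ * _).
by apply: eq_bigr => j _; rewrite rmorphXn.
Qed.
End Relation.

Lemma coprime_cancel_power (n : nat) (K : fieldType) (H G A : {mpoly K[n]}) j :
  coprime_family (fun b : bool => if b then H else G) -> H != 0 ->
  divides H (A * G ^+ j) -> divides H A.
Proof.
move=> cop H0; elim: j => [|j IH]; first by rewrite mulr1.
move=> dv; apply: IH.
apply: (coprime_divides (f := fun b : bool => if b then H else G)) => //.
- exact: factorial_ring_mpoly.
- by move=> P PP _; apply: coprime_family_prime.
- case; first by exists (A * G ^+ j).
  by rewrite -mulrA -exprSr.
Qed.

Section InverseDegree.
Variables (K : closedFieldType) (n : nat).
Local Notation polys := ('I_n.+1 -> {mpoly K[n.+1]}).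
Variables (p q : polys) (d e : nat).
Hypothesis hp : forall i, p i \is d.-homog.
Hypothesis hq : forall i, q i \is e.-homog.
Hypothesis qp : left_inverse q p.
Hypothesis pq : left_inverse p q.
Hypothesis qp_neq0 : exists v j, evals q (evals p v) j != 0.
Hypothesis pq_neq0 : exists v j, evals p (evals q v) j != 0.
Local Notation k := (relation_degree n d).

(** [p (q v)] is a nonzero multiple of [v] for general [v], so a form that vanishes on the image of
    [p] vanishes at general [v]. *)
Let dominant A l : A \is l.-homog -> (forall v, A.@[evals p v] = 0) -> A = 0.
Proof.
move=> hA Ap; have [v0 [j pqj]] := pq_neq0.
have B0 : pcomp (p j) q * 'X_ord0 != 0.
  rewrite mulf_neq0 ?mpolyX_neq0 //; apply: contraNneq pqj => z.
  by rewrite /evals -pcompE z meval0.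
apply: (mpoly_vanish_on B0) => v.
rewrite mevalM pcompE mevalXU mulf_eq0 negb_or => /andP[pj v0'].
have [c c0 cE] := proportionalP (u := evals p (evals q v)) pj v0' (pq v).
apply/eqP; have /eqP := Ap (evals q v).
by rewrite (funext cE) (meval_dhomog _ _ hA) mulf_eq0 expf_eq0 (negPf c0) andbF.
Qed.

Let comp_neq0 i : pcomp (q i) p != 0.
Proof.
have [v0 [j qpj]] := qp_neq0.
have B0 : pcomp (q j) p * 'X_i != 0.
  rewrite mulf_neq0 ?mpolyX_neq0 //; apply: contraNneq qpj => z.
  by rewrite /evals -pcompE z meval0.
have [v] := mpoly_nonroot B0.
rewrite mevalM pcompE mevalXU mulf_eq0 negb_or => /andP[qj vi].
have [c c0 cE] := proportionalP (u := evals q (evals p v)) qj vi (qp v).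
have qi : evals q (evals p v) i != 0 by rewrite cE mulf_neq0.
by apply: contraNneq qi => z; rewrite /evals -pcompE z meval0.
Qed.

Let q_neq0 i : q i != 0.
Proof. by apply: contraNneq (comp_neq0 i) => ->; rewrite /pcomp raddf0. Qed.

(** Write [q_i / q_0] in reduced form [G / H]; the relation becomes [sum_b A_b H^(k-b) G^b = 0]. For
    the largest [b1] with nonzero [A_b1], all other terms contain a higher power of [H], so [H]
    divides [A_b1 G^b1], hence [A_b1], whose degree is [n k]. *)
Let ratio i : exists H G f, [/\ H \is f.-homog, G \is f.-homog, H != 0, (f <= n * k)%N &
  q i * H = q ord0 * G].
Proof.
pose P (b : bool) := if b then q ord0 else q i.
have hP b : P b \is e.-homog by rewrite /P; case: b; exact: hq.
have [f [P' [e' [s [_ hP' cop [s0 hs] PE]]]]] := coprime_reduction hP (q_neq0 ord0 : P true != 0).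
have q0E : q ord0 = s * P' true := PE true.
have qiE : q i = s * P' false := PE false.
pose H := P' true; pose G := P' false.
have H0 : H != 0 by apply: contraNneq (q_neq0 ord0) => z; rewrite q0E -/H z mulr0.
exists H, G, f; split=> //; [exact: (hP' true)|exact: (hP' false)| |]; last first.
  by rewrite q0E qiE -/H -/G; ring.
have [A [hA [b0 Ab0] rel]] := algebraic_relation i hp.
pose C := \sum_(b < k.+1) A b * (q ord0 ^+ (k - b) * q i ^+ b).
have hC : C \is (n * k + e * k).-homog.
  apply: rpred_sum => b _; apply: dhomogM => //.
  have kE : (e * (k - b) + e * b = e * k)%N by rewrite -mulnDr subnK // -ltnS.
  by rewrite -kE; apply: dhomogM; apply: dhomogMn.
(* At [p w] the values of [q_0] and [q_i] are [r w_0] and [r w_i], so [C] takes there the value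
   [r^k] times the relation at [w]; [dominant] concludes. *)
have C0 : C = 0.
  apply: (dominant hC) => v; rewrite -pcompE.
  suff -> : pcomp C p = 0 by rewrite meval0.
  apply: (mpoly_vanish_on (mpolyX_neq0 K (ord0 : 'I_n.+1))) => w; rewrite mevalXU => w0.
  rewrite pcompE -/(evals p w).
  have [r [q0w qiw]] : exists r, (q ord0).@[evals p w] = r * w ord0 /\ (q i).@[evals p w] = r * w i.
    exists ((q ord0).@[evals p w] / w ord0); split; first by rewrite divfK.
    by rewrite mulrAC; apply: (mulIf w0); rewrite divfK //; exact: (qp w).
  transitivity (r ^+ k * \sum_(b < k.+1) (A b).@[evals p w] * (w ord0 ^+ (k - b) * w i ^+ b));
    last by rewrite rel mulr0.
  rewrite /C rmorph_sum mulr_sumr /=; apply: eq_bigr => b _.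
  rewrite !mevalM !rmorphXn /= q0w qiw !exprMn.
  have -> : r ^+ k = r ^+ (k - b) * r ^+ b by rewrite -exprD subnK // -ltnS.
  ring.
have HG0 : \sum_(b < k.+1) A b * (H ^+ (k - b) * G ^+ b) = 0.
  apply: (mulfI (expf_neq0 k s0)); rewrite mulr0 -[RHS]C0 /C mulr_sumr; apply: eq_bigr => b _.
  rewrite q0E qiE -/H -/G !exprMn.
  have -> : s ^+ k = s ^+ (k - b) * s ^+ b by rewrite -exprD subnK // -ltnS.
  ring.
have [b1 Ab1 b1max] : exists2 b1, A b1 != 0 & forall b, A b != 0 -> (b <= b1)%N.
  by case: (@arg_maxnP _ b0 (fun b => A b != 0) val Ab0) => b1 Ab1 b1max; exists b1.
have [W WE] : exists W, A b1 * G ^+ b1 = W * H.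
  (* The terms with [b < b1] divided by [H^(k - b1 + 1)]; those with [b > b1] are zero by the choice
     of [b1]. *)
  pose Rb (b : 'I_k.+1) := if (b < b1)%N then A b * (H ^+ (b1 - b).-1 * G ^+ b) else 0.
  exists (- \sum_(b < k.+1 | b != b1) Rb b).
  apply: (mulfI (expf_neq0 (k - b1) H0)); apply/eqP; rewrite -subr_eq0; apply/eqP.
  transitivity (A b1 * (H ^+ (k - b1) * G ^+ b1) + \sum_(b < k.+1 | b != b1) Rb b * H * H ^+ (k - b1)).
    by rewrite -!mulr_suml; ring.
  rewrite -[RHS]HG0 [in RHS](bigD1 b1) //; congr (_ + _).
  apply: eq_bigr => b bb1; rewrite /Rb.
  have [lt|ge] := ltnP b b1; last first.
    have [->|/b1max le] := eqVneq (A b) 0; first by rewrite !mul0r.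
    by case/eqP: bb1; apply: val_inj; apply/eqP; rewrite eqn_leq le.
  have -> : H ^+ (k - b) = H ^+ (k - b1) * H ^+ (b1 - b).-1 * H.
    rewrite -mulrA -exprSr -exprD; congr (_ ^+ _).
    by have := ltn_ord b1; lia.
  by ring.
have [V VE] : divides H (A b1).
  apply: (@coprime_cancel_power _ _ H G (A b1) b1) => //; last by exists W.
  move=> Q HQ; apply: cop => -[]; [exact: (HQ true)|exact: (HQ false)].
have VH0 : V * H != 0 by rewrite -VE.
have hVH : V * H \is (n * k).-homog by rewrite -VE.
have [k1 [l [<- _ hH]]] := homog_factors VH0 hVH.
by rewrite (dhomog_uniq H0 (hP' true) hH) leq_addl.
Qed.

(** The fractions [q_i / q_0 = G_i / H_i] are brought to the common denominator [prod_l H_l], with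
    [n + 1] factors of degree at most [n k], whence [E]. A power of [x_0] pads the degree to exactly
    [E], so that all inverses are described by the same unknowns. *)
Lemma bounded_inverse (E := (n.+1 * (n * k))%N) : exists q' : polys,
  [/\ forall i, q' i \is E.-homog, left_inverse q' p, left_inverse p q' &
      inverse_dom p q' !=set0].
Proof.
have /choice[H /choice[G /choice[f HG]]] := ratio.
have fE : (\sum_l f l <= E)%N.
  apply: leq_trans (_ : \sum_(l < n.+1) n * k <= _)%N.
    by apply: leq_sum => l _; have [] := HG l.
  by rewrite sum_nat_const card_ord.
pose X : {mpoly K[n.+1]} := 'X_ord0 ^+ (E - \sum_l f l).
have X0 : X != 0 by rewrite expf_neq0 // mpolyX_neq0.
have hX : X \is (E - \sum_l f l).-homog.
  by rewrite /X -[Y in Y.-homog]mul1n; apply: dhomogMn; rewrite dhomogX /= mdeg1.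
have hprod (Q : pred 'I_n.+1) : \prod_(l | Q l) H l \is (\sum_(l | Q l) f l).-homog.
  elim/big_rec2: _ => [|l x y _ hy]; first exact: dhomog1.
  by apply: dhomogM => //; have [] := HG l.
pose M := \prod_l H l * X.
have M0 : M != 0.
  by rewrite mulf_neq0 //; apply/prodf_neq0 => l _; have [] := HG l.
have hM : M \is E.-homog by rewrite /M -[Y in Y.-homog](subnKC fE); apply: dhomogM.
pose q' i := G i * \prod_(l | l != i) H l * X.
(* Thus [q'] is [q] times [M / q_0], and the identities for [q] pass to [q'] where [q_0] is
   nonzero. *)
have q'E i : q ord0 * q' i = q i * M.
  have [_ _ _ _ e1] := HG i.
  rewrite /M (bigD1 i) //= /q' !mulrA -e1; ring.
have Mp0 : pcomp M p != 0.
  apply: contraNneq M0 => z; apply/eqP/(dominant hM) => v.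
  by rewrite -pcompE z meval0.
exists q'; split.
- move=> i; rewrite /q' -[Y in Y.-homog](subnKC fE); apply: dhomogM => //.
  by rewrite [\sum_l f l](bigD1 i) //=; apply: dhomogM => //; have [] := HG i.
- move=> v a b; apply/eqP; rewrite -subr_eq0; apply/eqP.
  suff z : pcomp (q' a) p * 'X_b - pcomp (q' b) p * 'X_a = 0.
    have := congr1 (meval v) z.
    by rewrite meval0 mevalB !mevalM !pcompE !mevalXU.
  apply: (mpoly_vanish_on (comp_neq0 ord0)) => w; rewrite pcompE => q0w.
  rewrite mevalB !mevalM !pcompE !mevalXU; apply: (mulfI q0w).
  have e1 c : (q ord0).@[evals p w] * (q' c).@[evals p w] = (q c).@[evals p w] * M.@[evals p w].
    by rewrite -!mevalM q'E.
  rewrite mulr0 mulrBr !mulrA !e1 ![_ * M.@[_]]mulrC -!mulrA.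
  by rewrite (qp w a b) subrr.
- move=> v a b; apply/eqP; rewrite -subr_eq0; apply/eqP.
  suff z : pcomp (p a) q' * 'X_b - pcomp (p b) q' * 'X_a = 0.
    have := congr1 (meval v) z.
    by rewrite meval0 mevalB !mevalM !pcompE !mevalXU.
  apply: (mpoly_vanish_on (q_neq0 ord0)) => w q0w.
  rewrite mevalB !mevalM !pcompE !mevalXU; apply: (mulfI (expf_neq0 d q0w)).
  have e1 c : (q ord0).@[w] ^+ d * (p c).@[evals q' w] = M.@[w] ^+ d * (p c).@[evals q w].
    rewrite -!(meval_dhomog _ _ (hp c)); apply: meval_eq => j.
    by rewrite /evals -!mevalM q'E mulrC.
  rewrite mulr0 mulrBr !mulrA !e1 -!mulrA.
  by rewrite (pq w a b) subrr.
have [j pj] : exists j, p j != 0.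
  have [v [j pj]] := pq_neq0; exists j; apply: contraNneq pj => z.
  by rewrite /evals z meval0.
have [v] := mpoly_nonroot (mulf_neq0 (mulf_neq0 Mp0 pj) (mpolyX_neq0 K (ord0 : 'I_n.+1))).
rewrite !mevalM pcompE mevalXU !mulf_eq0 !negb_or => /andP[/andP[Mv pjv] v0].
have [c c0 cE] := hcoord_mkproj v0.
have q'0 : q' ord0 = M by apply: (mulfI (q_neq0 ord0)); rewrite q'E.
exists (mkproj v); rewrite /inverse_dom (funext cE) (evals_scale _ _ hp); split.
  by exists j; rewrite mulf_neq0 // expf_neq0.
exists ord0; rewrite /evals q'0 (meval_dhomog _ _ hM).
by rewrite mulf_neq0 // !expf_neq0.
Qed.

End InverseDegree.

(** * The universal family and the theorem *)

Section InverseOfBirational.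
Variables (K : closedFieldType) (n : nat).
Local Notation Pn := (projective_space K n).
Local Notation polys := ('I_n.+1 -> {mpoly K[n.+1]}).

(** The claim is an identity of polynomials, so it may be checked on the vectors over a nonempty
    open set. There homogeneity removes the scalar [c] between a vector and the chosen coordinates
    of its point. *)
Lemma left_inverse_of_open (p q : polys) d e (O : set Pn) :
  (forall i, p i \is d.-homog) -> (forall i, q i \is e.-homog) -> open O -> O !=set0 ->
  (forall x, O x -> proportional (evals q (evals p (hcoord x))) (hcoord x)) -> left_inverse q p.
Proof.
move=> hp hq oO [x0 Ox0] H v a b; apply/eqP; rewrite -subr_eq0; apply/eqP.
have [k [N [hN Nx NO]]] := proj_form_nbhs oO Ox0.
have N0 : N != 0 by apply: contraNneq Nx => ->; rewrite meval0.
suff z : pcomp (q a) p * 'X_b - pcomp (q b) p * 'X_a = 0.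
  have := congr1 (meval v) z.
  by rewrite meval0 mevalB !mevalM !pcompE !mevalXU.
apply: (mpoly_vanish_on (mulf_neq0 N0 (mpolyX_neq0 K (ord0 : 'I_n.+1)))) => w.
rewrite mevalM mevalXU mulf_eq0 negb_or => /andP[Nw w0].
have [c c0 cE] := hcoord_mkproj w0; have {}cE := funext cE.
have Ow : O (mkproj w).
  by apply: NO; rewrite cE (meval_dhomog _ _ hN) mulf_neq0 // expf_neq0.
have := H _ Ow a b; rewrite cE (evals_scale _ _ hp) (evals_scale _ _ hq) /= => e1.
rewrite mevalB !mevalM !pcompE !mevalXU.
apply: (mulfI (mulf_neq0 (expf_neq0 e (expf_neq0 d c0)) c0)); rewrite mulr0.
by move/eqP: e1; rewrite -subr_eq0 => /eqP <-; rewrite /evals; ring.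
Qed.

(** A local representation of the inverse has an uncontrolled degree [e]; [bounded_inverse] replaces
    it by one whose degree depends only on [n] and [d]. *)
Lemma bir_inverse_pair (f : bir Pn) d : has_degree f d ->
  exists (p q : polys) (g : birmap Pn),
  [/\ (forall i, p i \is d.-homog) /\ (forall i, q i \is (n.+1 * (n * relation_degree n d)).-homog),
      left_inverse q p, left_inverse p q, inverse_dom p q !=set0 &
      f = bir_class g /\ rep_on (bfun g) (bdom g) d p].
Proof.
move=> [p [hp cop [g fg pg]]].
have [og dg mg [U' [V' [oU' dU' oV' dV' [U'g [mg' [h [mh hg gh]]]]]]]] := bfunP g.
have [gV cg _] := mg'; have [hU _ _] := mh.
have [y0 V'y0] := proj_dense_neq0 dV'.
have [O [e [q [oO Oy0 OV rh]]]] := morphism_rep oV' (morphism_on_sub mh (@subset_refl _ _) (fun _ _ => I)) V'y0.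
have [hq qO] := rh.
have rep_y y : O y -> exists c, c != 0 /\ hcoord (h y) = fun i => c * evals q (hcoord y) i.
  move=> Oy; have /line_proportional[[j qj] hy] := qO y Oy.
  have [i xi] := hcoord_neq0 (h y).
  by have [c c0 cE] := proportionalP xi qj hy; exists c; split=> //; apply/funext.
have rep_x x : U' x -> exists c, c != 0 /\ hcoord (bfun g x) = fun i => c * evals p (hcoord x) i.
  move=> Ux; have /line_proportional[[j pj] hx] := pg x (U'g _ Ux).
  have [i yi] := hcoord_neq0 (bfun g x : Pn).
  by have [c c0 cE] := proportionalP yi pj hx; exists c; split=> //; apply/funext.
have pqO y : O y -> exists2 c, c != 0 & hcoord y = fun i => c * evals p (evals q (hcoord y)) i.
  move=> Oy; have Vy := OV _ Oy; have [c [c0 cE]] := rep_y y Oy.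
  have [c' [c'0 c'E]] := rep_x (h y) (hU _ Vy).
  exists (c' * c ^+ d); first by rewrite mulf_neq0 // expf_neq0.
  rewrite -{1}(gh y Vy) c'E cE (evals_scale _ _ hp); apply/funext => i.
  by rewrite mulrA.
have pq : left_inverse p q.
  apply: (left_inverse_of_open hq hp oO); first by exists y0.
  by move=> y /pqO[c _ yE]; apply: proportional_sym; apply: (@scaled_proportional _ _ c) => i; rewrite {1}yE.
pose O' := bfun g @^-1` O `&` U'.
have oO' : open O' by apply: (within_open_continuousP _ oU').1.
have O'x0 : O' (h y0) by split; [rewrite /= gh|exact: hU].
have qpO x : O' x -> exists2 c, c != 0 & hcoord x = fun i => c * evals q (evals p (hcoord x)) i.
  move=> [Oy Ux]; have [c [c0 cE]] := rep_y _ Oy; have [c' [c'0 c'E]] := rep_x x Ux.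
  exists (c * c' ^+ e); first by rewrite mulf_neq0 // expf_neq0.
  rewrite -{1}(hg x Ux) cE c'E (evals_scale _ _ hq); apply/funext => i.
  by rewrite mulrA.
have qp : left_inverse q p.
  apply: (left_inverse_of_open hp hq oO'); first by exists (h y0).
  by move=> y /qpO[c _ yE]; apply: proportional_sym; apply: (@scaled_proportional _ _ c) => i; rewrite {1}yE.
have qp0 : exists v j, evals q (evals p v) j != 0.
  have [c c0 xE] := qpO _ O'x0; have [j xj] := hcoord_neq0 (h y0).
  exists (hcoord (h y0)), j; apply: contraNneq xj => z; by rewrite xE z mulr0.
have pq0 : exists v j, evals p (evals q v) j != 0.
  have [c c0 xE] := pqO _ Oy0; have [j xj] := hcoord_neq0 y0.
  exists (hcoord y0), j; apply: contraNneq xj => z; by rewrite xE z mulr0.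
have [q' [hq' q'p pq' dom]] := bounded_inverse hp hq qp pq qp0 pq0.
by exists p, q', g; split.
Qed.

Lemma rep_eq (g g' : birmap Pn) d d' (p p' : polys) :
  rep_on (bfun g) (bdom g) d p -> rep_on (bfun g') (bdom g') d' p' ->
  (forall v i j, (p i).@[v] * (p' j).@[v] = (p j).@[v] * (p' i).@[v]) -> bir_class g = bir_class g'.
Proof.
move=> [hp rg] [hp' rg'] pp'; apply/bir_class_eq => x gx g'x.
have /line_proportional[[k pk] hx] := rg x gx.
have /line_proportional[[l pl] hx'] := rg' x g'x.
apply: proj_eq.
apply: (@proportional_trans _ _ (fun i => (p i).@[hcoord x]) _ _ k pk hx).
by apply: (@proportional_trans _ _ (fun i => (p' i).@[hcoord x]) _ _ l pl _ (proportional_sym hx')) => i j.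
Qed.
End InverseOfBirational.

(** * Sets defined by polynomial equations in possibly infinitely many unknowns *)

Section AlgebraicSets.
Variable K : closedFieldType.

(** Zariski closedness in [J -> K], phrased through the functions vanishing on [G] so that
    saturation carries over from single equations to [G]. *)
Definition algebraic (J : Type) (G : set (J -> K)) :=
  forall c, (forall F, polyfun F -> (forall c', G c' -> F c' = 0) -> F c = 0) -> G c.

Lemma algebraic_eq (J : Type) (F F' : (J -> K) -> K) : polyfun F -> polyfun F' ->
  algebraic [set c | F c = F' c].
Proof.
move=> pF pF' c H; apply/eqP; rewrite -subr_eq0; apply/eqP.
by apply: (H (fun c => F c - F' c)); [exact: polyfunB|move=> c' ->; rewrite subrr].
Qed.

Lemma algebraic_forall (J I : Type) (G : I -> set (J -> K)) :
  (forall i, algebraic (G i)) -> algebraic [set c | forall i, G i c].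
Proof. by move=> aG c H i; apply: aG => F pF F0; apply: H => // c' Gc'; apply: F0. Qed.

Lemma algebraicI (J : Type) (G G' : set (J -> K)) : algebraic G -> algebraic G' ->
  algebraic (G `&` G').
Proof.
by move=> aG aG' c H; split; [apply: aG|apply: aG'] => F pF F0; apply: H => // c' [? ?]; apply: F0.
Qed.

Lemma polyfun_comp (I J : Type) (F : (I -> K) -> K) (h : I -> (J -> K) -> K) :
  polyfun F -> (forall i, polyfun (h i)) -> polyfun (fun v => F (fun i => h i v)).
Proof.
move=> pF ph; elim: pF => [c|i|f g _ IHf _ IHg|f g _ IHf _ IHg].
- exact: polyfun_cst.
- exact: ph.
- exact: polyfunD.
- exact: polyfunM.
Qed.

Lemma algebraic_preimage (I J : Type) (G : set (I -> K)) (s : I -> J) :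
  algebraic G -> algebraic [set c : J -> K | G (c \o s)].
Proof.
move=> aG c H; apply: aG => F pF F0.
apply: (H (fun c => F (c \o s))); last by move=> c' /F0.
by apply: (polyfun_comp pF (h := fun i v => v (s i))) => i; exact: polyfun_var.
Qed.

Lemma polyfun_meval (J : Type) k (p : {mpoly K[k]}) (h : 'I_k -> (J -> K) -> K) :
  (forall i, polyfun (h i)) -> polyfun (fun v => p.@[fun i => h i v]).
Proof.
move=> ph; rewrite (_ : (fun v => _) = fun v => \sum_(m <- msupp p) p@_m * \prod_i h i v ^+ m i).
  by apply: polyfun_sum => m; apply: polyfunZ; apply: polyfun_prod => i; apply: polyfunX.
by apply/funext => v; rewrite mevalE.
Qed.

Lemma polyfun_mpoly (J : finType) (F : (J -> K) -> K) : polyfun F ->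
  exists p : {mpoly K[#|J|]}, forall c, F c = p.@[fun i => c (enum_val i)].
Proof.
elim=> [c|j|f g _ [p pE] _ [q qE]|f g _ [p pE] _ [q qE]].
- by exists c%:MP => v; rewrite mevalC.
- by exists 'X_(enum_rank j) => v; rewrite mevalXU enum_rankK.
- by exists (p + q) => v; rewrite mevalD pE qE.
- by exists (p * q) => v; rewrite mevalM pE qE.
Qed.

Definition row_of (J : finType) (c : J -> K) : affine_space K #|J| := \row_i c (enum_val i).
Definition coords (J : finType) (t : affine_space K #|J|) : J -> K := fun j => (t : 'rV_#|J|) 0 (enum_rank j).

Lemma row_ofK (J : finType) : cancel (@row_of J) (@coords J).
Proof. by move=> c; apply/funext => j; rewrite /coords mxE enum_rankK. Qed.

Lemma coordsE (J : finType) (t : affine_space K #|J|) :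
  (fun i => coords t (enum_val i)) = (t : 'rV_#|J|) 0.
Proof. by apply/funext => i; rewrite /coords enum_valK. Qed.

Lemma algebraic_closed (J : finType) (G : set (J -> K)) : algebraic G ->
  closed [set t : affine_space K #|J| | G (coords t)].
Proof.
move=> aG; rewrite -openC.
exists [set p | forall t : affine_space K #|J|, G (coords t) -> p.@[(t : 'rV_#|J|) 0] = 0].
rewrite setCK; apply/seteqP; split=> [t Gt p /(_ t Gt) //|t /= tP].
apply: aG => F pF F0; have [p pE] := polyfun_mpoly pF.
rewrite pE coordsE; apply: tP => t' Gt'.
by rewrite -coordsE -pE F0.
Qed.

Lemma closed_algebraic (J : finType) (C : set (affine_space K #|J|)) : closed C ->
  algebraic [set c : J -> K | C (row_of c)].
Proof.
rewrite -openC => -[P]; rewrite setCK => -> c H p Pp.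
rewrite (_ : row_of c 0 = fun i => c (enum_val i)); last by apply/funext => i; rewrite mxE.
apply: (H (fun c => p.@[fun i => c (enum_val i)])).
  by apply: (polyfun_meval p (h := fun i v => v (enum_val i))) => i; exact: polyfun_var.
move=> c' /(_ p Pp); rewrite (_ : row_of c' 0 = fun i => c' (enum_val i)) //.
by apply/funext => i; rewrite mxE.
Qed.

Lemma algebraic_saturation (J : countType) (b : nat -> J -> K) : ~ countable [set: K] ->
  exists c : J -> K, forall G, algebraic G -> (exists M, forall m, (M <= m)%N -> G (b m)) -> G c.
Proof.
move=> Kunc; have [c cE] := @saturation K J (fun j m => b m j) Kunc.
exists c => G aG [M GM]; apply: aG => F pF F0; apply: cE => //.
by exists M => m /GM; apply: F0.
Qed.
End AlgebraicSets.

Section CoefficientExpansion.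
Variables (K : closedFieldType) (n d : nat).

Definition form_of (a : 'X_{1..n.+1 < d.+1} -> K) : {mpoly K[n.+1]} :=
  \sum_(m : 'X_{1..n.+1 < d.+1} | mdeg m == d) a m *: 'X_[m].

Lemma form_of_homog a : form_of a \is d.-homog.
Proof. by apply: rpred_sum => m md; apply: rpredZ; rewrite dhomogX. Qed.

Lemma form_ofK (p : {mpoly K[n.+1]}) : p \is d.-homog -> form_of (fun m => p@_m) = p.
Proof.
move=> hp; have sp : (msize p <= d.+1)%N.
  rewrite msizeE; apply/bigmax_leqP_seq => m mp _; rewrite ltnS.
  by rewrite -(dhomog_mf hp mp).
rewrite [RHS](mpolywE sp) /form_of [LHS]big_mkcond; apply: eq_bigr => m _.
case: ifP => // /negbT md; rewrite (dhomog_nemf_coeff hp md) scale0r //.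
Qed.

Lemma polyfun_form_of (J : Type) (s : 'X_{1..n.+1 < d.+1} -> J) (h : 'I_n.+1 -> (J -> K) -> K) :
  (forall i, polyfun (h i)) -> polyfun (fun c => (form_of (fun m => c (s m))).@[fun i => h i c]).
Proof.
move=> ph; rewrite (_ : (fun c => _) = fun c => \sum_(m : 'X_{1..n.+1 < d.+1} | mdeg m == d)
    c (s m) * \prod_i h i c ^+ m i).
  apply: polyfun_sum => m; apply: polyfunM; first exact: polyfun_var.
  by apply: polyfun_prod => i; apply: polyfunX.
apply/funext => c; rewrite /form_of raddf_sum /=; apply: eq_bigr => m _.
by rewrite mevalZ mevalX.
Qed.
End CoefficientExpansion.

(** * The parameter variety of maps of degree at most [d] with an inverse *)

Section UniversalFamily.
Variables (K : closedFieldType) (n d e : nat).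
Local Notation Pn := (projective_space K n).
Local Notation polys := ('I_n.+1 -> {mpoly K[n.+1]}).

(* Coefficients of [p] and of its inverse [q], a point [x], and three vectors
   certifying that [p x], [q (p x)] and [x] do not vanish. *)
Definition params : Type :=
  ('I_n.+1 * 'X_{1..n.+1 < d.+1}) + ('I_n.+1 * 'X_{1..n.+1 < e.+1}) +
  ('I_n.+1 + 'I_n.+1 + ('I_n.+1 + 'I_n.+1)).
HB.instance Definition _ := Finite.on params.

Implicit Types c : params -> K.

Definition fwd c : polys := fun i => form_of (fun m => c (inl (inl (i, m)))).
Definition bwd c : polys := fun i => form_of (fun m => c (inl (inr (i, m)))).
Definition base c : 'I_n.+1 -> K := fun i => c (inr (inl (inl i))).
Definition cert_fwd c : 'I_n.+1 -> K := fun i => c (inr (inl (inr i))).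
Definition cert_bwd c : 'I_n.+1 -> K := fun i => c (inr (inr (inl i))).
Definition cert_base c : 'I_n.+1 -> K := fun i => c (inr (inr (inr i))).

Definition good : set (params -> K) := [set c |
  [/\ left_inverse (bwd c) (fwd c), left_inverse (fwd c) (bwd c),
      \sum_i cert_fwd c i * evals (fwd c) (base c) i = 1,
      \sum_i cert_bwd c i * evals (bwd c) (evals (fwd c) (base c)) i = 1 &
      \sum_i cert_base c i * base c i = 1]].

Lemma sum_neq0 (u v : 'I_n.+1 -> K) : \sum_i u i * v i = 1 -> exists i, v i != 0.
Proof.
move=> uv; apply: contrapT => /forallNP H; have := oner_neq0 K.
rewrite -uv big1 ?eqxx // => i _.
by have /negP/negPn/eqP -> := H i; rewrite mulr0.
Qed.

Lemma sum_cert (v : 'I_n.+1 -> K) i : v i != 0 -> exists u : 'I_n.+1 -> K, \sum_i u i * v i = 1.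
Proof.
move=> vi; exists (fun j => if j == i then (v i)^-1 else 0).
rewrite (bigD1 i) //= eqxx mulVf // big1 ?addr0 // => j /negPf ->.
by rewrite mul0r.
Qed.

Lemma good_dom c : good c -> inverse_dom (fwd c) (bwd c) !=set0.
Proof.
move=> [_ _ /sum_neq0[i pi] /sum_neq0[j qj] /sum_neq0[l xl]].
have [a a0 aE] := hcoord_mkproj xl; exists (mkproj (base c)).
have hp i0 : fwd c i0 \is d.-homog by exact: form_of_homog.
have hq i0 : bwd c i0 \is e.-homog by exact: form_of_homog.
rewrite /inverse_dom (funext aE) (evals_scale _ _ hp); split.
  by exists i; rewrite mulf_neq0 // expf_neq0.
by exists j; rewrite (evals_scale _ _ hq) mulf_neq0 // !expf_neq0.
Qed.

Lemma good_exists (p q : polys) : (forall i, p i \is d.-homog) -> (forall i, q i \is e.-homog) ->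
  left_inverse q p -> left_inverse p q -> inverse_dom p q !=set0 ->
  exists2 c, good c & fwd c = p.
Proof.
move=> hp hq qp pq [x [[i pi] [j qj]]].
have [u uE] := sum_cert pi; have [w wE] := sum_cert qj.
have [l xl] := hcoord_neq0 x; have [y yE] := sum_cert xl.
pose c (r : params) : K := match r with
  | inl (inl (i, m)) => (p i)@_m
  | inl (inr (i, m)) => (q i)@_m
  | inr (inl (inl i)) => hcoord x i
  | inr (inl (inr i)) => u i
  | inr (inr (inl i)) => w i
  | inr (inr (inr i)) => y i
  end.
have fE : fwd c = p by apply/funext => a; rewrite /fwd form_ofK.
have bE : bwd c = q by apply/funext => a; rewrite /bwd form_ofK.
by exists c => //; rewrite /good /= fE bE; split.
Qed.

Lemma polyfun_fwd (J : Type) (s : params -> J) (h : 'I_n.+1 -> (J -> K) -> K) i :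
  (forall i, polyfun (h i)) -> polyfun (fun c : J -> K => evals (fwd (c \o s)) (fun i => h i c) i).
Proof. by move=> ph; exact: (polyfun_form_of (fun m => s (inl (inl (i, m)))) ph). Qed.

Lemma polyfun_bwd (J : Type) (s : params -> J) (h : 'I_n.+1 -> (J -> K) -> K) i :
  (forall i, polyfun (h i)) -> polyfun (fun c : J -> K => evals (bwd (c \o s)) (fun i => h i c) i).
Proof. by move=> ph; exact: (polyfun_form_of (fun m => s (inl (inr (i, m)))) ph). Qed.

Lemma good_algebraic : algebraic good.
Proof.
have vE (v : 'I_n.+1 -> K) i : polyfun (fun _ : params -> K => v i) by exact: polyfun_cst.
have pv (r : params) : polyfun (fun c : params -> K => c r) by exact: polyfun_var.
have fv (h : 'I_n.+1 -> (params -> K) -> K) i : (forall i, polyfun (h i)) ->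
    polyfun (fun c => evals (fwd c) (fun i => h i c) i) by exact: polyfun_fwd.
have bv (h : 'I_n.+1 -> (params -> K) -> K) i : (forall i, polyfun (h i)) ->
    polyfun (fun c => evals (bwd c) (fun i => h i c) i) by exact: polyfun_bwd.
have fb i : polyfun (fun c => evals (fwd c) (base c) i).
  by apply: (fv (fun i c => base c i)) => j; exact: pv.
have bfb i : polyfun (fun c => evals (bwd c) (evals (fwd c) (base c)) i).
  by apply: (bv (fun i c => evals (fwd c) (base c) i)).
have bf v i : polyfun (fun c => evals (bwd c) (evals (fwd c) v) i).
  by apply: (bv (fun i c => evals (fwd c) v i)) => j; apply: (fv (fun i _ => v i)).
have fb' v i : polyfun (fun c => evals (fwd c) (evals (bwd c) v) i).
  by apply: (fv (fun i c => evals (bwd c) v i)) => j; apply: (bv (fun i _ => v i)).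
rewrite (_ : good = [set c | left_inverse (bwd c) (fwd c)] `&` ([set c | left_inverse (fwd c) (bwd c)] `&`
    ([set c | \sum_i cert_fwd c i * evals (fwd c) (base c) i = 1] `&`
    ([set c | \sum_i cert_bwd c i * evals (bwd c) (evals (fwd c) (base c)) i = 1] `&`
     [set c | \sum_i cert_base c i * base c i = 1])))); last first.
  by apply/seteqP; split=> [c [? ? ? ? ?]|c [? [? [? [? ?]]]]]; split.
apply: algebraicI.
  apply: algebraic_forall => v; apply: algebraic_forall => i; apply: algebraic_forall => j.
  by apply: algebraic_eq; apply: polyfunM.
apply: algebraicI.
  apply: algebraic_forall => v; apply: algebraic_forall => i; apply: algebraic_forall => j.
  by apply: algebraic_eq; apply: polyfunM.
apply: algebraicI; last apply: algebraicI;
  (apply: algebraic_eq; [apply: polyfun_sum => i; apply: polyfunM => //; exact: pv|exact: polyfun_cst]).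
Qed.

Definition good_locus : set (affine_space K #|{: params}|) := [set t | good (coords t)].

Lemma good_closed : closed good_locus.
Proof. exact: (algebraic_closed good_algebraic). Qed.

Lemma universal_family : exists phi : pseudo_aut Pn (closed_subspace good_locus),
  forall t, rep_on (bfun (BirMap (pa_fib phi t))) (bdom (BirMap (pa_fib phi t))) d
              (fwd (coords (sval t))).
Proof.
have fF i : coef_family d (fun t : 'rV_#|{: params}| => fwd (coords (t : affine_space K _)) i).
  exists (fun m => 'X_(enum_rank (inl (inl (i, m)) : params))) => t.
  by apply: eq_bigr => m _; rewrite mevalXU.
have fB i : coef_family e (fun t : 'rV_#|{: params}| => bwd (coords (t : affine_space K _)) i).
  exists (fun m => 'X_(enum_rank (inl (inr (i, m)) : params))) => t.
  by apply: eq_bigr => m _; rewrite mevalXU.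
by apply: (family_pseudo_aut fF fB) => t; have gt := svalP t; [have [] := gt|have [] := gt|exact: good_dom gt].
Qed.

End UniversalFamily.

(** * A closed range meets every degree finitely often *)

Lemma cvg_infty_of_fibers (u : nat -> nat) :
  (forall d, exists M, forall m, (M <= m)%N -> u m <> d) -> u m @[m --> \oo] --> \oo.
Proof.
move=> H A [N _ NA].
have [M MN] : exists M, forall m, (M <= m)%N -> (N <= u m)%N.
  elim: N {NA} => [|N [M MN]]; first by exists 0%N.
  have [M' M'N] := H N; exists (maxn M M') => m; rewrite geq_max => /andP[Mm M'm].
  by rewrite ltn_neqAle MN // andbT; apply/eqP => e; apply: (M'N m M'm).
by exists M => // m /= Mm; apply: NA; apply: MN.
Qed.

Lemma deg_to_infty_of_closed (K : closedFieldType) (n : nat) (f : nat -> bir (projective_space K n)) :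
  injective f -> ~ countable [set: K] -> closed (range f) -> deg (f m) @[m --> \oo] --> \oo.
Proof.
move=> finj Kunc clf; apply: cvg_infty_of_fibers => d; apply: contrapT => /forallNP often.
(* [sigma m >= m] stands in for a subsequence of degree [d]: for fixed [k], injectivity of [f] makes
   [f (sigma m)] differ from [f k] as soon as [m > k]. *)
have /choice[sigma sigmaE] : forall M, exists m, (M <= m)%N /\ deg (f m) = d.
  move=> M; have /existsNP[m /not_implyP[Mm /contrapT dm]] := often M.
  by exists m.
pose e := (n.+1 * (n * relation_degree n d))%N.
have /choice[b bE] : forall m, exists c : params n d e -> K, good c /\
    exists2 g, f (sigma m) = bir_class g & rep_on (bfun g) (bdom g) d (fwd c).
  move=> m; have [_ dm] := sigmaE m; have := deg_has_degree (f (sigma m)); rewrite dm.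
  move=> /bir_inverse_pair[p [q [g [[hp hq] qp pq dom [fg rg]]]]].
  by have [c gc pc] := good_exists hp hq qp pq dom; exists c; split=> //; exists g; rewrite ?pc.
have /choice[R RE] : forall k, exists R : 'I_n.+1 -> {mpoly K[n.+1]}, exists d' g,
    f k = bir_class g /\ rep_on (bfun g) (bdom g) d' R.
  by move=> k; have [R [hR _ [g fg rg]]] := deg_has_degree (f k); exists R, (deg (f k)), g.
(* [inr (k, _)] indexes a point and coefficients that witness that [f (sigma m)] and [f k] differ. *)
pose J : countType := (params n d e + nat * ('I_n.+1 + 'I_n.+1 * 'I_n.+1))%type.
pose test k (c : J -> K) := \sum_i \sum_j c (inr (k, inr (i, j))) *
  (evals (fwd (c \o inl)) (fun l => c (inr (k, inl l))) i * (R k j).@[fun l => c (inr (k, inl l))] -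
   evals (fwd (c \o inl)) (fun l => c (inr (k, inl l))) j * (R k i).@[fun l => c (inr (k, inl l))]).
(* For [k < m] some minor is nonzero at some point, and its inverse is taken as the only nonzero
   coefficient. For other pairs the values are irrelevant, since only almost all [m] count. *)
have wit m k : exists w : 'I_n.+1 + 'I_n.+1 * 'I_n.+1 -> K, (k < m)%N ->
    \sum_i \sum_j w (inr (i, j)) * (evals (fwd (b m)) (w \o inl) i * (R k j).@[w \o inl] -
      evals (fwd (b m)) (w \o inl) j * (R k i).@[w \o inl]) = 1.
  have [km|] := boolP (k < m)%N; last by exists (fun=> 0).
  have [gb [g fg rg]] := bE m; have [d' [g' [fk rk]]] := RE k.
  have [x [i [j nij]]] : exists x i j, evals (fwd (b m)) x i * (R k j).@[x] -
      evals (fwd (b m)) x j * (R k i).@[x] != 0.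
    apply: contrapT => nij; have : f (sigma m) = f k.
      rewrite fg fk; apply: (rep_eq rg rk) => v i j; apply/eqP; rewrite -subr_eq0.
      by apply: contrapT => /negP ne; apply: nij; exists v, i, j.
    move=> /finj sk; have [] := sigmaE m; rewrite sk leqNgt km //.
  pose z := evals (fwd (b m)) x i * (R k j).@[x] - evals (fwd (b m)) x j * (R k i).@[x].
  exists (fun r => match r with inl l => x l
    | inr (i', j') => if (i' == i) && (j' == j) then z^-1 else 0 end) => _.
  rewrite (bigD1 i) //= (bigD1 j) //= !eqxx /= mulVf //.
  rewrite big1 ?addr0 => [|j' /negPf ->]; last by rewrite ?andbF mul0r.
  rewrite big1 ?addr0 // => i' /negPf ni; rewrite big1 // => j' _.
  by rewrite ni mul0r.
have /choice[w wE] : forall mk : nat * nat, exists w : 'I_n.+1 + 'I_n.+1 * 'I_n.+1 -> K, (mk.2 < mk.1)%N ->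
    \sum_i \sum_j w (inr (i, j)) * (evals (fwd (b mk.1)) (w \o inl) i * (R mk.2 j).@[w \o inl] -
      evals (fwd (b mk.1)) (w \o inl) j * (R mk.2 i).@[w \o inl]) = 1 by move=> mk; apply: wit.
pose B m (r : J) := match r with inl r => b m r | inr (k, r) => w (m, k) r end.
have [c cE] := algebraic_saturation B Kunc.
have gc : good (c \o inl).
  apply: (cE [set c : J -> K | good (c \o inl)]).
    exact: (@algebraic_preimage K _ J _ inl (@good_algebraic K n d e)).
  by exists 0%N => m _; have [] := bE m.
have [phi phiE] := universal_family K n d e.
have b0 : good_locus (row_of (b 0%N)) by rewrite /good_locus /= row_ofK; have [] := bE 0%N.
have vT := closed_subspace_is_variety (exist _ _ b0) (@good_closed K n d e).
have clS := (closed_birE (range f)).1 clf _ vT phi.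
have pt_good (c' : params n d e -> K) : good c' -> good_locus (row_of c').
  by rewrite /good_locus /= row_ofK.
pose pt c' (gc' : good c') : closed_subspace (good_locus (K:=K) (n:=n) (d:=d) (e:=e)) :=
  exist _ (row_of c') (pt_good c' gc').
have ptE c' (gc' : good c') : fwd (coords (sval (pt c' gc'))) = fwd c' by rewrite /= row_ofK.
(* The preimage of the range is closed in the parameter variety, so it is cut out by the complement
   of an open set [O] of the ambient affine space; in this form it is a system of equations for
   [c]. *)
have [O oO OE] : open (~` (pa_map phi @^-1` range f)) by rewrite openC.
have SO c' (gc' : good c') : (pa_map phi @^-1` range f) (pt c' gc') <-> ~ O (row_of c').
  have E : (~ (pa_map phi @^-1` range f) (pt c' gc')) = O (row_of c') :=
    congr1 (fun A => A (pt c' gc')) OE.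
  by rewrite -E; split=> [Sz /(_ Sz)|/contrapT].
have limO : ~ O (row_of (c \o inl)).
  apply: (cE [set c : J -> K | (~` O) (row_of (c \o inl))]).
    exact: (@algebraic_preimage K _ J _ inl (closed_algebraic (open_closedC oO))).
  exists 0%N => m _; have [gb [g fg rg]] := bE m; apply/(SO _ gb).
  exists (sigma m) => //; rewrite fg.
  have := phiE (pt _ gb); rewrite ptE => rphi.
  by have := rep_eq rg rphi; apply => v i j; rewrite mulrC.
(* The map given by [c] lies in the range, so it is some [f k]; but the test against [f k] has the
   value 1 at [c], so some minor of the two does not vanish. *)
have [k _ fk] := (SO _ gc).2 limO.
have [d' [g [fkg rk]]] := RE k.
have test1 : test k c = 1.
  apply: (cE [set c | test k c = 1]); last first.
    by exists k.+1 => m km; apply: (wE (m, k)).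
  apply: algebraic_eq; last exact: polyfun_cst.
  have pv (r : J) : polyfun (fun c : J -> K => c r) by exact: polyfun_var.
  have px l : polyfun (fun c : J -> K => c (inr (k, inl l))) by exact: pv.
  have pf i : polyfun (fun c : J -> K => evals (fwd (c \o inl)) (fun l => c (inr (k, inl l))) i).
    exact: (polyfun_fwd inl i px).
  have pR i : polyfun (fun c : J -> K => (R k i).@[fun l => c (inr (k, inl l))]).
    exact: (polyfun_meval _ px).
  apply: polyfun_sum => i; apply: polyfun_sum => j; apply: polyfunM; first exact: pv.
  by apply: polyfunB; apply: polyfunM.
have := phiE (pt _ gc); rewrite ptE => rphi.
have eqb : bir_class g = bir_class (BirMap (pa_fib phi (pt _ gc))) by rewrite -fkg fk.
have [og dg _ _] := bfunP g; have [op dp _ _] := bfunP (BirMap (pa_fib phi (pt _ gc))).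
have W0 := proj_open_meet og op (proj_dense_neq0 dg) (proj_dense_neq0 dp).
have prop := rep_proportional rk rphi (openI og op) W0 (@subIsetl _ _ _) (@subIsetr _ _ _)
  (fun x H => (bir_class_eq _ _).1 eqb x (proj1 H) (proj2 H)).
have := oner_neq0 K; rewrite -test1 /test big1 ?eqxx // => i _; rewrite big1 // => j _.
rewrite /evals [X in X - _]mulrC [X in _ - X]mulrC -!mevalM (prop j i) subrr mulr0 //.
Qed.

Theorem corollary35 (K : closedFieldType) (n : nat) (n_ge2 : (2 <= n)%N) :
  (forall f : nat -> bir (projective_space K n), injective f ->
     (deg (f m) @[m --> \oo] --> \oo -> closed (range f)) /\
     (~ countable [set: K] ->
      closed (range f) -> deg (f m) @[m --> \oo] --> \oo)) /\
  ~ noetherian (bir (projective_space K n)).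
Proof.
split; last exact: bir_not_noetherian.
move=> f finj; split; first exact: closed_of_deg_to_infty.
exact: deg_to_infty_of_closed.
Qed.
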